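(* Let $(M^\circ,\omega)$ be a symplectic 6-manifold and $\varphi_0$ an $F$-harmonic primitive 3-form on it belonging to the orbit $\mathcal{O}_0^+$ at every point. Then: (i) $K=K(\varphi_0)$ is a smooth section of $\mathrm{End}(TM^\circ)$ with $K^2=0$, and $\mathcal{L}:=\ker K=\mathrm{Im}\,K$ defines a Lagrangian foliation on $(M^\circ,\omega)$. (ii) The Nijenhuis tensor of $K$ vanishes, that is, $K[KX,Y]+K[X,KY]-[KX,KY]=0$ for all vector fields $X,Y$ on $M^\circ$. (iii) The natural symmetric bilinear form $q(\cdot,\cdot)=\omega(\cdot,K\cdot)$ induces a Riemannian metric on the vector bundle $TM^\circ/\mathcal{L}$, and $TM^\circ/\mathcal{L}$ is canonically oriented so that the volume form of this metric is exactly $\frac{1}{\sqrt2}F(\varphi_0)$. (iv) Through the bundle isomorphism $K:TM^\circ/\mathcal{L}\cong\mathcal{L}$ one obtains a canonical Riemannian metric $g_{\mathcal{L}}$, together with an orientation, on $\mathcal{L}$, such that $g_{\mathcal{L}}(X,Y)=\omega(K^{-1}X,Y)$ for all vector fields $X,Y$ tangent to $\mathcal{L}$; this is independent of the choice of preimage $K^{-1}X$ of $X$ under $K$.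
   Context: A 3-form $\varphi$ on a symplectic 6-manifold $(M,\omega)$ is primitive if $\omega\wedge\varphi=0$. For such $\varphi$: $K(\varphi)\in\mathrm{End}(TM)$ is defined by $\iota_{K(\varphi)X}\frac{\omega^3}{3!}=-\iota_X\varphi\wedge\varphi$, and the 3-form $F(\varphi)$ by $F(\varphi)(X,Y,Z)=-2\varphi(K(\varphi)X,Y,Z)$. $\varphi$ is $F$-harmonic if $d\varphi=0$ and $dF(\varphi)=0$. A primitive 3-form $\varphi$ belongs to the orbit $\mathcal{O}_0^+$ at a point $p$ if there is a basis $e^1,\dots,e^6$ of $T_p^*M$ with $\omega=e^{12}+e^{34}+e^{56}$ and $\varphi=e^{146}+e^{236}+e^{245}$ (where $e^{ijk}=e^i\wedge e^j\wedge e^k$, etc.). *)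

(* Defs.v *)
From HB Require Import structures.
From mathcomp Require Import all_boot all_order all_algebra.
From mathcomp Require Import all_fingroup.
From mathcomp Require Import all_classical all_reals all_analysis.

Set Implicit Arguments.
Unset Strict Implicit.
Unset Printing Implicit Defensive.

Import Order.TTheory GRing.Theory Num.Theory.
Import numFieldNormedType.Exports.
Local Open Scope classical_set_scope.
Local Open Scope ring_scope.

(* Vectors are row vectors, so linear maps act on the right: the image of v
   under the map with matrix A is v *m A. *)

Section Smoothness.
Context {R : realType} {n : nat} {V : normedModType R}.

(* [Ck k U f]: on the open set U, f has continuous iterated partial
   derivatives up to order k. *)
Fixpoint Ck (k : nat) (U : set 'rV[R]_n) (f : 'rV[R]_n -> V) : Prop :=
  (forall x, U x -> {for x, continuous f}) /\
  if k is k'.+1 then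
    forall j : 'I_n, (forall x, U x -> derivable f x (delta_mx 0 j)) /\
      Ck k' U ('D_(delta_mx 0 j) f)
  else True.

Definition smooth_on (U : set 'rV[R]_n) (f : 'rV[R]_n -> V) : Prop :=
  forall k, Ck k U f.

End Smoothness.

Section MultilinearAlgebra.
Context {R : realType} {n : nat}.

(* A k-linear form on R^n takes as argument the k x n matrix whose rows are
   its k arguments. *)
Definition kform (k : nat) := 'M[R]_(k, n) -> R.

Definition multilinear_form k (a : kform k) : Prop :=
  forall (i : 'I_k) (A B C : 'M[R]_(k, n)) (b c : R),
    row i A = b *: row i B + c *: row i C ->
    row' i B = row' i A -> row' i C = row' i A ->
    a A = b * a B + c * a C.

Definition alternating_form k (a : kform k) : Prop :=
  multilinear_form a /\
  forall (A : 'M[R]_(k, n)) (i j : 'I_k),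
    i != j -> row i A = row j A -> a A = 0.

(* Normalized so that a wedge of k covectors is the determinant of their
   values. *)
Definition wedge k l (a : kform k) (b : kform l) : kform (k + l) :=
  fun A => ((k`! * l`!)%:R)^-1 *
    \sum_(s : 'S_(k + l))
      (-1) ^+ s * (a (usubmx (row_perm s A)) * b (dsubmx (row_perm s A))).

Definition interior_prod k (v : 'rV[R]_n) (a : kform (1 + k)) : kform k :=
  fun A => a (col_mx v A).

Definition eval2 (a : kform 2) (u v : 'rV[R]_n) : R :=
  a (col_mx u v : 'M[R]_(1 + 1, n)).

Definition nondegenerate_form (w : kform 2) : Prop :=
  forall u, (forall v, eval2 w u v = 0) -> u = 0.

(* Subspaces of R^n are row spaces of matrices. *)
Definition lagrangian (w : kform 2) (L : 'M[R]_n) : Prop :=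
  forall u : 'rV[R]_n,
    (u <= L)%MS <-> (forall v : 'rV[R]_n, (v <= L)%MS -> eval2 w u v = 0).

End MultilinearAlgebra.
Arguments kform R n k : clear implicits.

Section SixDimensionalAlgebra.
Context {R : realType}.
Implicit Types (w : kform R 6 2) (f : kform R 6 3).

Definition primitive w f : Prop := wedge w f = fun=> 0.

Definition liouville w : kform R 6 6 :=
  fun A => wedge (wedge w w) w A / (3`!)%:R.

Definition K_spec w f (K : 'M[R]_6) : Prop :=
  forall v : 'rV[R]_6,
    interior_prod (k := 5) (v *m K) (liouville w) =
    fun A => - wedge (interior_prod (k := 2) v f) f A.

(* The matrix satisfying [K_spec] exists and is unique when w is
   nondegenerate; 0 is a junk value. *)
Definition Kmap w f : 'M[R]_6 := xget 0 [set K | K_spec w f K].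

Definition Fform w f : kform R 6 3 :=
  fun A : 'M[R]_(1 + 2, 6) =>
    - 2 * f (col_mx (usubmx A *m Kmap w f) (dsubmx A)).

(* The columns of an invertible E are a basis e^1, ..., e^6 of the dual space;
   the index k of [covec E k] ranges over 1, ..., 6. *)
Definition covec (E : 'M[R]_6) (k : nat) : kform R 6 1 :=
  fun v => (v *m E) 0 (inord k.-1).

Definition covec2 E i j : kform R 6 2 := wedge (covec E i) (covec E j).
Definition covec3 E i j k : kform R 6 3 := wedge (covec2 E i j) (covec E k).

Definition orbit_O0plus w f : Prop :=
  exists2 E : 'M[R]_6, E \in unitmx &
    (w = fun A => covec2 E 1 2 A + covec2 E 3 4 A + covec2 E 5 6 A) /\
    (f = fun A => covec3 E 1 4 6 A + covec3 E 2 3 6 A + covec3 E 2 4 5 A).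

End SixDimensionalAlgebra.

Record manifold (R : realType) (n : nat) := Manifold {
  carrier :> topologicalType;
  carrier_hausdorff : hausdorff_space carrier;
  carrier_second_countable : @second_countable carrier;
  chart_index : Type;
  dom : chart_index -> set carrier;
  chart : chart_index -> carrier -> 'rV[R]_n;
  chart_inv : chart_index -> 'rV[R]_n -> carrier;
  chart_at : carrier -> chart_index;
  dom_chart_at : forall p, dom (chart_at p) p;
  dom_open : forall i, open (dom i);
  chart_image_open : forall i, open (chart i @` dom i);
  chartK : forall i p, dom i p -> chart_inv i (chart i p) = p;
  chart_continuous : forall i p, dom i p -> {for p, continuous (chart i)};
  chart_inv_continuous : forall i x, (chart i @` dom i) x ->
    {for x, continuous (chart_inv i)};
  transition_smooth : forall i j,
    smooth_on (chart i @` (dom i `&` dom j)) (chart j \o chart_inv i)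
}.
Arguments dom {R n} M i : rename.
Arguments chart {R n} M i p : rename.
Arguments chart_inv {R n} M i x : rename.
Arguments chart_at {R n} M p : rename.

(* The tangent space T_pM is identified with R^n by means of the preferred
   chart [chart_at M p]. Hence vector fields, endomorphism fields, k-forms and
   distributions are functions from M to 'rV_n, 'M_n, kform R n k and 'M_n (up
   to row space), whose value at p is expressed in the coordinates of
   [chart_at M p]; their expressions in any other chart are obtained with the
   Jacobians of the coordinate changes. *)
Section Manifolds.
Context {R : realType} {n : nat} {M : manifold R n}.

(* Coordinates in chart i of a tangent vector at p are turned into coordinates
   in chart j by right multiplication with [coord_change i j p]. *)
Definition coord_change i j (p : M) : 'M[R]_n :=
  'J (chart M j \o chart_inv M i) (chart M i p).

Definition field_in_chart i (X : M -> 'rV[R]_n) : 'rV[R]_n -> 'rV[R]_n :=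
  fun x => let p := chart_inv M i x in
    X p *m coord_change (chart_at M p) i p.

Definition endo_in_chart i (K : M -> 'M[R]_n) : 'rV[R]_n -> 'M[R]_n :=
  fun x => let p := chart_inv M i x in
    coord_change i (chart_at M p) p *m K p *m coord_change (chart_at M p) i p.

Definition form_in_chart k i (a : M -> kform R n k) : 'rV[R]_n -> kform R n k :=
  fun x A => let p := chart_inv M i x in
    a p (A *m coord_change i (chart_at M p) p).

Definition smooth_fun_on (V : normedModType R) (U : set M) (f : M -> V) : Prop :=
  forall i, smooth_on (chart M i @` (dom M i `&` U)) (f \o chart_inv M i).

Definition smooth_field_on (U : set M) (X : M -> 'rV[R]_n) : Prop :=
  forall i, smooth_on (chart M i @` (dom M i `&` U)) (field_in_chart i X).

Definition smooth_field (X : M -> 'rV[R]_n) : Prop := smooth_field_on setT X.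

Definition smooth_endo (K : M -> 'M[R]_n) : Prop :=
  forall i, smooth_on (chart M i @` dom M i) (endo_in_chart i K).

Definition smooth_form k (a : M -> kform R n k) : Prop :=
  forall i (A : 'M[R]_(k, n)),
    smooth_on (V := R^o) (chart M i @` dom M i)
      (fun x => form_in_chart i a x A).

Definition differential_form k (a : M -> kform R n k) : Prop :=
  (forall p, alternating_form (a p)) /\ smooth_form a.

(* da(v_0, ..., v_k) = \sum_i (-1)^i v_i(a(v_0, ..., ^v_i, ..., v_k)) for
   constant vector fields v_0, ..., v_k on R^n *)
Definition ext_deriv k (a : 'rV[R]_n -> kform R n k) : 'rV[R]_n -> kform R n k.+1 :=
  fun x A => \sum_(i < k.+1)
    (-1) ^+ i * ('D_(row i A) ((fun y => a y (row' i A)) : _ -> R^o) x : R).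

Definition closed_form k (a : M -> kform R n k) : Prop :=
  forall i x, (chart M i @` dom M i) x ->
    ext_deriv (form_in_chart i a) x = fun=> 0.

Definition bracket (X Y : M -> 'rV[R]_n) : M -> 'rV[R]_n :=
  fun p => let i := chart_at M p in
    let x := chart M i p in
    let Xi := field_in_chart i X in
    let Yi := field_in_chart i Y in
    'D_(Xi x) Yi x - 'D_(Yi x) Xi x.

Definition apply_endo (K : M -> 'M[R]_n) (X : M -> 'rV[R]_n) : M -> 'rV[R]_n :=
  fun p => X p *m K p.

Definition symplectic_form (w : M -> kform R n 2) : Prop :=
  [/\ differential_form w, closed_form w & forall p, nondegenerate_form (w p)].

Definition differential_at m (f : M -> 'rV[R]_m) (p : M) : 'M[R]_(n, m) :=
  'J (f \o chart_inv M (chart_at M p)) (chart M (chart_at M p) p).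

(* The distribution L is tangent to a foliation of codimension m: the leaves
   are locally the fibres of a submersion to R^m. *)
Definition foliation (m : nat) (L : M -> 'M[R]_n) : Prop :=
  forall p, exists (U : set M) (f : M -> 'rV[R]_m),
    [/\ open U, U p, smooth_fun_on U f &
        forall q, U q -> row_full (differential_at f q) /\
                         (kermx (differential_at f q) == L q)%MS].

(* Below, S and N are subbundles of TM with N contained in S, and the notions
   are those of the vector bundle S/N; TM/L is obtained for S = TM, N = L, and
   L itself for S = L, N = 0. *)

Definition metric_on (S N : M -> 'M[R]_n)
    (b : M -> 'rV[R]_n -> 'rV[R]_n -> R) : Prop :=
  [/\ forall p (c : R) (u u' v : 'rV[R]_n),
        (u <= S p)%MS -> (u' <= S p)%MS -> (v <= S p)%MS ->
        b p (c *: u + u') v = c * b p u v + b p u' v,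
      forall p (u v : 'rV[R]_n),
        (u <= S p)%MS -> (v <= S p)%MS -> b p u v = b p v u,
      forall p (u v : 'rV[R]_n),
        (u <= N p)%MS -> (v <= S p)%MS -> b p u v = 0,
      forall p (u : 'rV[R]_n),
        (u <= S p)%MS -> ~~ (u <= N p)%MS -> 0 < b p u u &
      forall (U : set M) (X Y : M -> 'rV[R]_n), open U ->
        smooth_field_on U X -> smooth_field_on U Y ->
        (forall p, U p -> (X p <= S p)%MS /\ (Y p <= S p)%MS) ->
        smooth_fun_on (V := R^o) U (fun p => b p (X p) (Y p))].

(* The rows of A represent a basis of S/N. *)
Definition basis_mod r (S N : 'M[R]_n) (A : 'M[R]_(r, n)) : Prop :=
  (A + N == S)%MS /\ (r + \rank N = \rank S)%N.

(* [o p] is the set of positively oriented bases of the fibre at p. *)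
Definition orientation_on r (S N : M -> 'M[R]_n) (o : M -> set 'M[R]_(r, n)) : Prop :=
  [/\ forall p A, o p A -> basis_mod (S p) (N p) A,
      forall p A B (P : 'M[R]_r), basis_mod (S p) (N p) A -> o p B ->
        (A - P *m B <= N p)%MS -> (o p A <-> 0 < \det P) &
      forall p, exists (U : set M) (s : M -> 'M[R]_(r, n)),
        [/\ open U, U p, forall j, smooth_field_on U (fun q => row j (s q)) &
            forall q, U q -> o q (s q)]].

(* nu is the Riemannian volume form of the metric b on TM/N, oriented by o;
   forms on TM/N are identified with forms on TM that vanish as soon as one
   argument is in N. *)
Definition quotient_volume_form r (N : M -> 'M[R]_n)
    (b : M -> 'rV[R]_n -> 'rV[R]_n -> R) (o : M -> set 'M[R]_(r, n))
    (nu : M -> kform R n r) : Prop :=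
  forall p,
    [/\ alternating_form (nu p),
        forall A i, (row i A <= N p)%MS -> nu p A = 0 &
        forall A, o p A ->
          (forall i j, b p (row i A) (row j A) = (i == j)%:R) -> nu p A = 1].

End Manifolds.

Section SymplecticSixManifold.
Context {R : realType} {M : manifold R 6}.
Implicit Types (w : M -> kform R 6 2) (f : M -> kform R 6 3).

Definition Kfield w f : M -> 'M[R]_6 := fun p => Kmap (w p) (f p).

Definition Ffield w f : M -> kform R 6 3 := fun p => Fform (w p) (f p).

Definition F_harmonic w f : Prop := closed_form f /\ closed_form (Ffield w f).

End SymplecticSixManifold.

(* Main.v *)
(* In a frame adapted to the orbit, K maps e_2, e_4, e_6 to -2 e_1, -2 e_3, -2 e_5
   and vanishes on e_1, e_3, e_5, F = 4 e^246 and q is twice the sum of the squares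
   of e^2, e^4, e^6; this gives all pointwise assertions. The integrability of
   L = ker K and the vanishing of the Nijenhuis tensor both come from
   differentiating F(K ., ., .) = 0 and F = - 2 phi(K ., ., .) and comparing with
   d phi = 0 and d F = 0; nondegeneracy of phi, resp. of F modulo L, concludes.
   The leaves are then given by Frobenius' theorem, proved by means of the smooth
   dependence of ordinary differential equations on initial data. TM/L is oriented
   by the sign of F; the metric of L is smooth because K + N is invertible near a
   point for a constant complement N, and its inverse inverts K on L. *)

Require Import Defs.
From HB Require Import structures.
From mathcomp Require Import all_boot all_order all_algebra.
From mathcomp Require Import all_fingroup.
From mathcomp Require Import all_classical all_reals all_analysis.
From mathcomp Require Import ring lra zify.

Set Implicit Arguments.
Unset Strict Implicit.
Unset Printing Implicit Defensive.

Import Order.TTheory GRing.Theory Num.Theory.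
Import numFieldNormedType.Exports.
Local Open Scope classical_set_scope.
Local Open Scope ring_scope.

(** * Calculus of maps of class C^k *)

Section CkCalculus.
Context {R : realType} {n : nat}.
Implicit Types (U : set 'rV[R]_n).

(** An adapted coframe is given point by point only, and no smooth choice of it is ever made: it
    serves identities at a single point. Smoothness has other sources: for K, a quotient formula for
    its entries in terms of omega and phi; for F, the smoothness of K; for frames of TM/L, matrices
    that are constant in a chart. Likewise the identification of the tangent space with R^6 by the
    preferred chart may jump with p, so every differential statement is first moved to one fixed
    chart, where K and F are again those of the transported forms. In a chart, the identities
    satisfied by phi, F and K hold on an open set, so differentiating them trades a derivative of a
    form for a derivative of K; dphi = 0 and dF = 0 thus become linear relations between values of
    phi and F, solvable by linear arithmetic. Origin of 1 / sqrt 2: as q is twice a sum of three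
    squares, its volume form is 2 sqrt 2 e^246, which is 4 e^246 / sqrt 2. *)

Lemma Ck_sub (V : normedModType R) k U U' (f : 'rV[R]_n -> V) :
  U' `<=` U -> Ck k U f -> Ck k U' f.
Proof.
move=> sU; elim: k f => [|k IH] f [cf df]; split=> //; try by move=> x /sU/cf.
by move=> j; have [d c] := df j; split=> [x /sU/d//|]; exact: IH.
Qed.

Lemma CkW (V : normedModType R) k U (f : 'rV[R]_n -> V) :
  Ck k.+1 U f -> Ck k U f.
Proof.
elim: k f => [|k IH] f [cf df]; split=> // j.
by have [d c] := df j; split=> //; exact: IH.
Qed.

Lemma Ck_continuous (V : normedModType R) k U (f : 'rV[R]_n -> V) x :
  Ck k U f -> U x -> {for x, continuous f}.
Proof. by case: k => [|k] [cf _]; apply: cf. Qed.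

Lemma open_near_eq (T : topologicalType) (S : Type) (U : set T) (f g : T -> S) x :
  open U -> U x -> (forall y, U y -> f y = g y) -> {near x, f =1 g}.
Proof. by move=> oU Ux fg; near=> y; apply: fg; near: y; exact: open_nbhs_nbhs. Unshelve. all: by end_near. Qed.

Lemma near_continuous (T U : topologicalType) (f g : T -> U) x :
  {near x, f =1 g} -> {for x, continuous f} -> {for x, continuous g}.
Proof.
move=> fg cf; rewrite /prop_for /continuous_at -(nbhs_singleton fg).
by apply: cvg_trans cf; exact: near_eq_cvg.
Qed.

Lemma near_derivable (V W : normedModType R) (f g : V -> W) x v :
  {near x, f =1 g} -> derivable f x v -> derivable g x v.
Proof.
have [->|v0] := eqVneq v 0; first by move=> *; exact: derivable0.
exact: near_eq_derivable.
Qed.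

Lemma near_derive (V W : normedModType R) (f g : V -> W) x v :
  {near x, f =1 g} -> 'D_v f x = 'D_v g x.
Proof.
have [->|v0] := eqVneq v 0; first by rewrite !derive0.
exact: near_eq_derive.
Qed.

(** Openness of U matters: a derivative at a point of U sees a neighbourhood of it. Most smoothness
    proofs below exhibit a formula valid on U and transfer its regularity by this lemma. *)
Lemma Ck_eq (V : normedModType R) k U (f g : 'rV[R]_n -> V) : open U ->
  (forall x, U x -> f x = g x) -> Ck k U f -> Ck k U g.
Proof.
move=> oU; elim: k f g => [|k IH] f g fg [cf df]; split=> //;
  try by move=> x Ux; apply: (near_continuous (open_near_eq oU Ux fg)); exact: cf.
move=> j; have [d c] := df j; split.
  by move=> x Ux; apply: (near_derivable (open_near_eq oU Ux fg)); exact: d.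
by apply: IH c => x Ux; apply: near_derive; exact: open_near_eq oU Ux fg.
Qed.

Lemma continuous_mxP (T : topologicalType) p q (f : T -> 'M[R]_(p, q)) x :
  {for x, continuous f} <->
  forall i j, {for x, continuous (fun y => f y i j : R^o)}.
Proof.
split=> [cf i j|cf].
  exact: (continuous_comp cf (@coord_continuous R p q i j (f x))).
apply/(@cvgrPdist_le _ 'M[R]_(p, q)) => e e0; near=> y.
rewrite /Num.Def.normr/= mx_normrE (bigmax_le _ (ltW e0))//= => i _.
rewrite !mxE; move: i; near: y; apply: filter_forall => i.
by move: (cf i.1 i.2) => /(@cvgrPdist_le _ R^o); exact.
Unshelve. all: by end_near. Qed.

(** The reduction to entries, thanks to which the rules for products, inverses and composition only
    have to be proved for scalar functions. *)
Lemma Ck_mx k U p q (f : 'rV[R]_n -> 'M[R]_(p, q)) : open U ->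
  Ck k U f <-> forall i j, Ck (V := R^o) k U (fun x => f x i j).
Proof.
move=> oU; elim: k f => [|k IH] f.
  split=> [[cf _] i j|cf]; split=> // x Ux.
    by move: i j; apply/continuous_mxP; exact: cf.
  by apply/continuous_mxP => i j; have [+ _] := cf i j; exact.
split=> [[cf df] i j|h].
  split=> [x Ux|l].
    by move: i j; apply/continuous_mxP; exact: cf.
  have [d c] := df l; split=> [x Ux|].
    by move: i j; apply/derivable_mxP; exact: d.
  have /IH/(_ i j) := c; apply: Ck_eq => // x Ux.
  by rewrite derive_mx ?mxE//; exact: d.
split=> [x Ux|l].
  by apply/continuous_mxP => i j; exact: Ck_continuous (h i j) Ux.
have d x : U x -> derivable f x (delta_mx 0 l).
  by move=> Ux; apply/derivable_mxP => i j; have [_ /(_ l)[+ _]] := h i j; exact.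
split => //; apply/IH => i j.
have [_ /(_ l)[_ +]] := h i j; apply: Ck_eq => // x Ux.
by rewrite derive_mx ?mxE//; exact: d.
Qed.

Lemma Ck_cst (V : normedModType R) k U (c : V) : Ck k U (fun=> c).
Proof.
elim: k c => [|k IH] c; split=> //; try by move=> x _; exact: cst_continuous.
move=> j; split=> [x _|]; first exact: derivable_cst.
have -> : 'D_(delta_mx 0 j) (fun=> c : V) = (fun=> 0) :> ('rV[R]_n -> V).
  by apply/funext => x; exact: derive_cst.
exact: IH.
Qed.

Lemma CkD (V : normedModType R) k U (f g : 'rV[R]_n -> V) : open U ->
  Ck k U f -> Ck k U g -> Ck k U (fun x => f x + g x).
Proof.
move=> oU; elim: k f g => [|k IH] f g [cf df] [cg dg].
  by split=> // x Ux; apply: continuousD; [exact: cf|exact: cg].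
split=> [x Ux|j]; first by apply: continuousD; [exact: cf|exact: cg].
have [df1 cf1] := df j; have [dg1 cg1] := dg j; split=> [x Ux|].
  by apply: derivableD; [exact: df1|exact: dg1].
apply: Ck_eq (IH _ _ cf1 cg1) => // x Ux.
by rewrite -deriveD//; [exact: df1|exact: dg1].
Qed.

Lemma CkZ (V : normedModType R) k U (c : R) (f : 'rV[R]_n -> V) : open U ->
  Ck k U f -> Ck k U (fun x => c *: f x).
Proof.
move=> oU; elim: k f => [|k IH] f [cf df].
  by split=> // x Ux; apply: continuousZl_tmp; exact: cf.
split=> [x Ux|j]; first by apply: continuousZl_tmp; exact: cf.
have [df1 cf1] := df j; split=> [x Ux|].
  by apply: derivableZ; exact: df1.
apply: Ck_eq (IH _ cf1) => // x Ux.
by rewrite -deriveZ//; exact: df1.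
Qed.

Lemma CkM k U (f g : 'rV[R]_n -> R^o) : open U ->
  Ck k U f -> Ck k U g -> Ck (V := R^o) k U (fun x => f x * g x).
Proof.
move=> oU; elim: k f g => [|k IH] f g F G.
  by split=> // x Ux; apply: (@continuousM R); [exact: Ck_continuous F Ux|exact: Ck_continuous G Ux].
have [cf df] := F; have [cg dg] := G.
split=> [x Ux|j]; first by apply: (@continuousM R); [exact: cf|exact: cg].
have [df1 cf1] := df j; have [dg1 cg1] := dg j; split=> [x Ux|].
  by apply: derivableM; [exact: df1|exact: dg1].
apply: Ck_eq (CkD oU (IH _ _ (CkW F) cg1) (IH _ _ (CkW G) cf1)) => // x Ux.
by rewrite deriveM//; [exact: df1|exact: dg1].
Qed.

(** The derivative of 1/f is - (1/f)(1/f) f', so the induction hypothesis, applied to 1/f itself,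
    provides the next order. *)
Lemma CkV k U (f : 'rV[R]_n -> R^o) : open U -> (forall x, U x -> f x != 0) ->
  Ck k U f -> Ck (V := R^o) k U (fun x => (f x)^-1).
Proof.
move=> oU f0; elim: k => [|k IH] F.
  by split=> // x Ux; apply: (@continuousV R); [exact: f0|exact: Ck_continuous F Ux].
have [cf df] := F.
split=> [x Ux|j]; first by apply: (@continuousV R); [exact: f0|exact: cf].
have [df1 cf1] := df j; split=> [x Ux|].
  by apply: derivableV; [exact: f0|exact: df1].
have I := IH (CkW F).
apply: Ck_eq (CkZ (-1) oU (CkM oU (CkM oU I I) cf1)) => // x Ux.
rewrite deriveV//; [|exact: f0|exact: df1].
by rewrite /GRing.scale/= expr2 invfM; ring.
Qed.

Lemma Ck_sum (I : Type) (r : seq I) (P : pred I) (V : normedModType R) k U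
    (f : I -> 'rV[R]_n -> V) : open U ->
  (forall i, P i -> Ck k U (f i)) -> Ck k U (fun x => \sum_(i <- r | P i) f i x).
Proof.
move=> oU h; elim: r => [|i r IH].
  by apply: Ck_eq (Ck_cst k U 0) => // x _; rewrite big_nil.
case Pi : (P i); last by apply: Ck_eq IH => // x _; rewrite big_cons Pi.
by apply: Ck_eq (CkD oU (h i Pi) IH) => // x _; rewrite big_cons Pi.
Qed.

Lemma Ck_prod (I : Type) (r : seq I) (P : pred I) k U
    (f : I -> 'rV[R]_n -> R^o) : open U ->
  (forall i, P i -> Ck k U (f i)) ->
  Ck (V := R^o) k U (fun x => \prod_(i <- r | P i) f i x).
Proof.
move=> oU h; elim: r => [|i r IH].
  by apply: Ck_eq (Ck_cst k U (1 : R^o)) => // x _; rewrite big_nil.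
case Pi : (P i); last by apply: Ck_eq IH => // x _; rewrite big_cons Pi.
by apply: Ck_eq (CkM oU (h i Pi) IH) => // x _; rewrite big_cons Pi.
Qed.

Lemma Ck_id k U : open U -> Ck k U (fun x : 'rV[R]_n => x).
Proof.
move=> oU; case: k => [|k]; split=> //; try by move=> x _; exact: cvg_id.
move=> j; split=> [x _|]; first exact: derivable_id.
by apply: Ck_eq (Ck_cst k U (delta_mx 0 j : 'rV[R]_n)) => // x _; apply/esym/derive_id.
Qed.

Lemma CkMmx k U p q r (f : 'rV[R]_n -> 'M[R]_(p, q)) (g : 'rV[R]_n -> 'M[R]_(q, r)) :
  open U -> Ck k U f -> Ck k U g -> Ck k U (fun x => f x *m g x).
Proof.
move=> oU /Ck_mx F /Ck_mx G; apply/Ck_mx => // i j.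
apply: (@Ck_eq _ _ _ (fun x => \sum_l f x i l * g x l j : R^o)) => //.
  by move=> x _; rewrite mxE.
by apply: Ck_sum => // l _; apply: CkM => //; [exact: F|exact: G].
Qed.

Lemma Ck_det k U p (f : 'rV[R]_n -> 'M[R]_p) : open U ->
  Ck k U f -> Ck (V := R^o) k U (fun x => \det (f x)).
Proof.
move=> oU /Ck_mx F; apply: Ck_sum => // s _; apply: CkM => //; first exact: Ck_cst.
by apply: Ck_prod => // i _; exact: F.
Qed.

(** Cramer's rule: the entries of the inverse are signed minors divided by the determinant. *)
Lemma Ck_invmx k U p (f : 'rV[R]_n -> 'M[R]_p) : open U ->
  (forall x, U x -> f x \in unitmx) ->
  Ck k U f -> Ck k U (fun x => invmx (f x)).
Proof.
move=> oU fu F; apply/Ck_mx => // i j.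
have F1 : Ck (V := R^o) k U (fun x => (\det (f x))^-1).
  by apply: CkV (Ck_det oU F) => // x /fu; rewrite unitmxE unitfE.
apply: Ck_eq (CkM oU F1 (CkM oU (Ck_cst k U ((-1) ^+ (j + i) : R^o))
  (Ck_det (f := fun x => row' j (col' i (f x))) oU _))) => //.
  by move=> x /fu fx; rewrite /invmx fx !mxE.
apply/Ck_mx => // a b; have /Ck_mx -/(_ oU (lift j a) (lift i b)) := F.
by apply: Ck_eq => // x _; rewrite !mxE.
Qed.

End CkCalculus.

(** * Mean value bounds and differentiability of C^1 maps *)

Section Differentiability.
Context {R : realType}.

Lemma is_derive_line (V W : normedModType R) (f : V -> W) y v s :
  derivable f (y + s *: v) v ->
  is_derive s 1 (fun t : R => f (y + t *: v)) ('D_v f (y + s *: v)).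
Proof.
move=> d.
have E : (fun h : R => h^-1 *: (((fun t : R => f (y + t *: v)) \o shift s) (h *: 1) -
    f (y + s *: v))) =
    (fun h => h^-1 *: ((f \o shift (y + s *: v)) (h *: v) - f (y + s *: v))).
  apply/funext => h /=; congr (_ *: (f _ - _)).
  by rewrite (_ : h *: (1 : R) = h) ?scalerDl 1?addrCA// /GRing.scale/= mulr1.
by split; rewrite /derivable/derive E.
Qed.

Lemma is_derive_addf (V W : normedModType R) (f g : V -> W) x v df dg :
  is_derive x v f df -> is_derive x v g dg -> is_derive x v (fun y => f y + g y) (df + dg).
Proof. exact: is_deriveD. Qed.

Lemma is_derive_subf (V W : normedModType R) (f g : V -> W) x v df dg :
  is_derive x v f df -> is_derive x v g dg -> is_derive x v (fun y => f y - g y) (df - dg).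
Proof. exact: is_deriveB. Qed.

Lemma is_derive_mulf (V : normedModType R) (f g : V -> R) x v df dg :
  is_derive x v f df -> is_derive x v g dg ->
  is_derive x v (fun y => f y * g y) (df * g x + f x * dg).
Proof. by move=> F G; apply: is_derive_eq; rewrite /GRing.scale/= addrC mulrC. Qed.

Lemma is_derive_cstf (V W : normedModType R) (c : W) (x v : V) :
  is_derive x v (fun=> c) 0.
Proof. exact: is_derive_cst. Qed.

Lemma is_derive_sumf (V W : normedModType R) (I : Type) (r : seq I)
    (f : I -> V -> W) x v (df : I -> W) :
  (forall i, is_derive x v (f i) (df i)) ->
  is_derive x v (fun y => \sum_(i <- r) f i y) (\sum_(i <- r) df i).
Proof.
move=> h; elim: r => [|i r IH].
  by rewrite big_nil (_ : (fun _ => _) = fun=> 0) ?funeqE => [|y]; [exact: is_derive_cstf|rewrite big_nil].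
rewrite big_cons (_ : (fun _ => _) = fun y => f i y + \sum_(j <- r) f j y).
  exact: is_derive_addf.
by apply/funext => y; rewrite big_cons.
Qed.

Lemma is_derive_mx (V : normedModType R) p q (f : V -> 'M[R]_(p, q)) x v (df : 'M[R]_(p, q)) :
  is_derive x v f df <-> forall i j, is_derive x v (fun y => f y i j : R^o) (df i j).
Proof.
split=> [[d <-] i j|h].
  by split; [move: i j; exact/derivable_mxP|rewrite derive_mx// mxE].
have d : derivable f x v by apply/derivable_mxP => i j; have [] := h i j.
split=> //; rewrite derive_mx//; apply/matrixP => i j; rewrite mxE.
by have [_ <-] := h i j.
Qed.

Lemma is_derive_mulmx (V : normedModType R) p q r (f : V -> 'M[R]_(p, q))
    (g : V -> 'M[R]_(q, r)) x v df dg :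
  is_derive x v f df -> is_derive x v g dg ->
  is_derive x v (fun y => f y *m g y) (df *m g x + f x *m dg).
Proof.
move=> /is_derive_mx F /is_derive_mx G; apply/is_derive_mx => i j.
rewrite (_ : (fun y => _) = (fun y => \sum_l f y i l * g y l j)); last first.
  by apply/funext => y; rewrite mxE.
rewrite !mxE -big_split/=; apply: is_derive_sumf => l.
exact: is_derive_mulf.
Qed.

Lemma mvt_bound (g dg : R -> R) (a b M : R) :
  (forall s, Num.min a b <= s <= Num.max a b ->
     is_derive s 1 g (dg s) /\ `|dg s| <= M) ->
  `|g b - g a| <= M * `|b - a|.
Proof.
wlog ab : a b / a <= b.
  move=> H h; case/orP: (le_total a b) => ab; first exact: H.
  rewrite distrC (distrC b); apply: H => // s.
  by rewrite minC maxC; exact: h.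
rewrite (min_idPl ab) (max_idPr ab) => h.
have h1 s : s \in `[a, b] -> is_derive s 1 g (dg s) /\ `|dg s| <= M.
  by rewrite in_itv/=; exact: h.
have [s sab|s sab|c cab ->] := @MVT_segment R g dg a b ab.
- by apply: (h1 s _).1; exact: subset_itv_oo_cc.
- by apply: derivable_within_continuous sab => t /h1[[]].
- by rewrite normrM ler_wpM2r//; exact: (h1 c cab).2.
Qed.

Lemma norm_sum_le (V : normedModType R) n (f : 'I_n -> V) c : (forall i, `|f i| <= c) ->
  `|\sum_i f i| <= n%:R * c.
Proof.
move=> fc; apply: le_trans (ler_norm_sum _ _ _) _.
by rewrite mulr_natl -[X in _ *+ X]card_ord -sumr_const; exact: ler_sum.
Qed.

Variable n : nat.
Implicit Types (U : set 'rV[R]_n).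

Lemma entry_le_norm p q (A : 'M[R]_(p, q)) i j : `|A i j| <= `|A|.
Proof.
by rewrite [leRHS]/Num.Def.normr/= mx_normrE; exact: (le_bigmax _ _ (i, j)).
Qed.

Lemma norm_le_entries p q (A : 'M[R]_(p, q)) M : 0 <= M ->
  (forall i j, `|A i j| <= M) -> `|A| <= M.
Proof.
by move=> M0 h; rewrite [leLHS]/Num.Def.normr/= mx_normrE bigmax_le.
Qed.

(** The points x + [trunc h k], for k from 0 to n, lead from x to x + h by steps parallel to the
    axes. *)
Let trunc (h : 'rV[R]_n) (k : nat) : 'rV[R]_n :=
  \row_i (if (i < k)%N then h 0 i else 0).

(** The increment is telescoped along the axis-parallel path from x to x + h. In each step one
    coordinate varies, and the mean value bound applies to f minus the linear function of slope
    [c j]. *)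
Lemma increment_estimate (f : 'rV[R]_n -> R^o) (x h : 'rV[R]_n)
    (c : 'I_n -> R) e r : 0 <= e -> `|h| < r ->
  (forall y, `|y - x| < r -> forall j, derivable f y (delta_mx 0 j) /\
     `|'D_(delta_mx 0 j) f y - c j| <= e) ->
  `|f (x + h) - f x - \sum_j h 0 j * c j| <= n%:R * (e * `|h|).
Proof.
move=> e0 hr H.
have E0 : x + trunc h 0 = x.
  by apply/rowP => i; rewrite !mxE addr0.
have En : x + trunc h n = x + h.
  by apply/rowP => i; rewrite !mxE ltn_ord.
have -> : f (x + h) - f x = \sum_(j < n) (f (x + trunc h j.+1) - f (x + trunc h j)).
  rewrite -(big_mkord predT (fun j => f (x + trunc h j.+1) - f (x + trunc h j))).
  by rewrite telescope_sumr// E0 En.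
rewrite -sumrB; apply: norm_sum_le => j.
have -> : x + trunc h j.+1 = x + trunc h j + h 0 j *: delta_mx 0 j.
  apply/rowP => i; rewrite !mxE eqxx/= -addrA; congr (_ + _).
  rewrite ltnS leq_eqVlt; have [->|ij] := eqVneq i j; first by rewrite eqxx ltnn mulr1 add0r.
  by rewrite -val_eqE in ij; rewrite (negPf ij)/= mulr0 addr0.
set y := x + trunc h j.
pose g (s : R) : R := f (y + s *: delta_mx 0 j) - s * c j.
have -> : f (y + h 0 j *: delta_mx 0 j) - f y - h 0 j * c j = g (h 0 j) - g 0.
  by rewrite /g scale0r mul0r addr0 subr0 addrAC.
apply: (@le_trans _ _ (e * `|h 0 j - 0|)); last first.
  by rewrite subr0 ler_wpM2l// entry_le_norm.
apply: (@mvt_bound g (fun s => 'D_(delta_mx 0 j) f (y + s *: delta_mx 0 j) - c j)) => s sh.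
have sh1 : `|s| <= `|h 0 j|.
  case: (lerP 0 (h 0 j)) sh => h0 /andP[s1 s2].
    by rewrite !ger0_norm//.
  by rewrite !ler0_norm// ?lerN2// ltW.
(* The coordinates of this difference are those of h before index j, then s with |s| <= |h_j|, then
   zeros; hence its sup norm is at most that of h. *)
have yr : `|y + s *: delta_mx 0 j - x| < r.
  apply: le_lt_trans hr; apply: norm_le_entries => // a i.
  rewrite !mxE ord1 eqxx/= addrAC [x _ _ + _]addrC addrK.
  have [ij|ij] := eqVneq i j; first by rewrite ij ltnn mulr1 add0r (le_trans sh1)// entry_le_norm.
  rewrite mulr0 addr0; case: ifP => _; first exact: entry_le_norm.
  by rewrite normr0.
have [d de] := H _ yr j; split => //.
apply: is_derive_subf; first exact: is_derive_line.
have := is_derive_mulf (is_derive_id s (1 : R)) (is_derive_cstf (c j : R) s 1).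
by rewrite mulr0 addr0 mul1r.
Qed.

Lemma C1_estimate (f : 'rV[R]_n -> R^o) U x : open U -> U x -> Ck 1 U f ->
  forall e, 0 < e -> \forall h \near (0 : 'rV[R]_n),
  `|f (x + h) - f x - \sum_j h 0 j * 'D_(delta_mx 0 j) f x| <= e * `|h|.
Proof.
move=> oU Ux [cf df] e e0.
(* Compensates the factor n lost in [increment_estimate]; n + 1 instead of n covers dimension 0. *)
pose e' := e / n.+1%:R.
have e'0 : 0 < e' by rewrite divr_gt0.
have N : \forall y \near x, forall j, derivable f y (delta_mx 0 j) /\
     `|'D_(delta_mx 0 j) f y - 'D_(delta_mx 0 j) f x| <= e'.
  suff H (j : 'I_n) : \forall y \near x, derivable f y (delta_mx 0 j) /\
     `|'D_(delta_mx 0 j) f y - 'D_(delta_mx 0 j) f x| <= e'.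
    exact: (filter_forall _ H).
  have [d [c _]] := df j.
  have := c x Ux => /(@cvgrPdist_le _ R^o)/(_ _ e'0) c1.
  near=> y; split; last by rewrite distrC; near: y.
  by apply: d; near: y; exact: open_nbhs_nbhs.
have /nbhs_ballP[r /= r0 rN] := N.
near=> h.
apply: (@le_trans _ _ (n%:R * (e' * `|h|))).
  apply: (@increment_estimate f x h _ e' r); [exact: ltW| |].
    near: h; apply/nbhs_ballP; exists r => //= h.
    by rewrite -ball_normE/= sub0r normrN.
  by move=> y yr; apply: rN; rewrite -ball_normE/= distrC.
rewrite mulrA ler_wpM2r// /e' mulrCA ler_piMr//; first exact: ltW.
by rewrite ler_pdivrMr// mul1r ler_nat.
Unshelve. all: by end_near. Qed.

(** The matrix of partial derivatives, meaningful before differentiability is known; [C1_diff]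
    identifies it with the Jacobian 'J. *)
Definition Jac p (f : 'rV[R]_n -> 'rV[R]_p) x : 'M[R]_(n, p) :=
  \matrix_(i, j) ('D_(delta_mx 0 i) (fun y => f y 0 j : R^o) x : R).

(** For each of the finitely many entries, [C1_estimate] says that the remainder after the linear
    term is o(h); in the sup norm this is total differentiability. *)
Lemma C1_diff p (f : 'rV[R]_n -> 'rV[R]_p) U x : open U -> U x -> Ck 1 U f ->
  differentiable f x /\ 'J f x = Jac f x.
Proof.
move=> oU Ux /(Ck_mx _ _ oU) F.
pose dJ : {linear 'rV[R]_n -> 'rV[R]_p} := mulmxr (Jac f x).
have cJ : continuous dJ.
  by move=> y; apply: (Ck_continuous (CkMmx openT (Ck_id 0 openT) (Ck_cst 0 setT (Jac f x))) (x := y)).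
have E : (f \o shift x : 'rV[R]_n -> 'rV[R]_p) =
    (cst (f x) : 'rV[R]_n -> 'rV[R]_p) + (dJ : 'rV[R]_n -> 'rV[R]_p) +o_ (0 : 'rV[R]_n) id.
  apply/eqaddoP => e e0; rewrite /= -nbhs_nearE.
  have N : \forall h \near (0 : 'rV[R]_n), forall j : 'I_p,
    `|f (x + h) 0 j - f x 0 j - \sum_l h 0 l * 'D_(delta_mx 0 l) (fun y => f y 0 j : R^o) x| <= e * `|h|.
    by apply: (filter_forall _ (fun j => C1_estimate oU Ux (F 0 j) e0)).
  apply: filterS N => h N.
  apply: norm_le_entries; first by rewrite mulr_ge0// ltW.
  move=> i j; rewrite ord1 !mxE/=.
  have -> : \sum_j0 h 0 j0 * Jac f x j0 j =
            \sum_l h 0 l * 'D_(delta_mx 0 l) (fun y => f y 0 j : R^o) x.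
    by apply: eq_bigr => l _; rewrite mxE.
  by rewrite opprD addrA [h + x]addrC.
have dE := diff_unique cJ E.
split; first by apply/diff_locallyP; rewrite dE.
apply/row_matrixP => i; rewrite !rowE -[LHS]deriveEjacobian ?deriveE ?dE//.
  by apply/diff_locallyP; rewrite dE.
by apply/diff_locallyP; rewrite dE.
Qed.

End Differentiability.

(** * The chain rule, Jacobians and the mean value bound on convex sets *)

Section ChainRule.
Context {R : realType}.

Lemma C1_is_derive n p (f : 'rV[R]_n -> 'rV[R]_p) U x v : open U -> U x -> Ck 1 U f ->
  is_derive x v f (v *m 'J f x).
Proof.
move=> oU Ux F; have [d _] := C1_diff oU Ux F.
by split; [exact: diff_derivable|exact: deriveEjacobian].
Qed.

Lemma C1_is_derive_scalar n (f : 'rV[R]_n -> R^o) U x v : open U -> U x -> Ck 1 U f ->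
  is_derive x v f (\sum_j v 0 j * ('D_(delta_mx 0 j) f x : R)).
Proof.
move=> oU Ux F.
(* A scalar function is read as a row vector of length 1, for which the Jacobian is available. *)
have F1 : Ck 1 U (fun y => \row_(i < 1) (f y : R)).
  apply/(Ck_mx _ _ oU) => i j; apply: (Ck_eq oU _ F) => y _.
  by rewrite mxE.
have := C1_is_derive v oU Ux F1; rewrite (C1_diff oU Ux F1).2.
move=> /is_derive_mx/(_ 0 0); rewrite (_ : (fun y => _) = f); last first.
  by apply/funext => y; rewrite mxE.
rewrite mxE; congr is_derive; apply: eq_bigr => j _; rewrite mxE.
congr (_ * _); apply: (congr1 (fun h : _ -> R^o => 'D_(delta_mx 0 j) h x)).
by apply/funext => y; rewrite mxE.
Qed.

Lemma C1_is_derive_mx n p q (f : 'rV[R]_n -> 'M[R]_(p, q)) U x v : open U -> U x ->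
  Ck 1 U f -> is_derive x v f (\sum_j v 0 j *: 'D_(delta_mx 0 j) f x).
Proof.
move=> oU Ux F; apply/is_derive_mx => i j.
have /(Ck_mx _ _ oU)/(_ i j) Fij := F.
rewrite summxE; have := C1_is_derive_scalar v oU Ux Fij.
congr is_derive; apply: eq_bigr => l _; rewrite mxE derive_mx ?mxE//.
by have [_ /(_ l)[+ _]] := F; exact.
Qed.

Lemma is_derive_lineP (V W : normedModType R) (f : V -> W) x v df :
  is_derive x v f df <-> is_derive (0 : R) 1 (fun t : R => f (x + t *: v)) df.
Proof.
have E : (fun h : R => h^-1 *: (((fun t : R => f (x + t *: v)) \o shift 0) (h *: 1) -
    f (x + 0 *: v))) =
    (fun h => h^-1 *: ((f \o shift x) (h *: v) - f x)).
  apply/funext => h /=; rewrite scale0r !addr0; congr (_ *: (f _ - _)).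
  by rewrite (_ : h *: (1 : R) = h) 1?addrC// /GRing.scale/= mulr1.
by split=> -[d D]; split; move: d D; rewrite /derivable/derive E.
Qed.

(** Only a directional derivative of g is assumed, not differentiability. Restricted to the line x +
    t v, however, g is differentiable in t, and the chain rule for differentials applies there. *)
Lemma is_derive_comp_scalar n (V : normedModType R) (f : 'rV[R]_n -> R^o) (g : V -> 'rV[R]_n) U x v dg :
  open U -> U (g x) -> Ck 1 U f -> is_derive x v g dg ->
  is_derive x v (f \o g) (\sum_j dg 0 j * ('D_(delta_mx 0 j) f (g x) : R)).
Proof.
move=> oU Ux F /is_derive_lineP G; apply/is_derive_lineP.
pose g1 (t : R) := g (x + t *: v); rewrite -/g1 in G.
have g10 : g1 0 = g x by rewrite /g1 scale0r addr0.
have F1 : Ck 1 U (fun y => \row_(i < 1) (f y : R)).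
  apply/(Ck_mx _ _ oU) => i j; apply: (Ck_eq oU _ F) => y _.
  by rewrite mxE.
set f1 := (fun y => _) in F1.
have dg1 : differentiable g1 0 by apply/derivable1_diffP; case: G.
have df1 : differentiable f1 (g1 0) by rewrite g10; exact: (C1_diff oU Ux F1).1.
have dfg : differentiable (f1 \o g1) 0 by exact: differentiable_comp.
have : is_derive (0 : R) 1 (f1 \o g1) (dg *m 'J f1 (g x)).
  split; first exact: diff_derivable.
  have [_ <-] := G; rewrite deriveE// diff_comp//= [in RHS](deriveE (1 : R) dg1).
  by rewrite -g10 -deriveEjacobian// deriveE.
move=> /is_derive_mx/(_ 0 0); rewrite (_ : (fun y => _) = (fun t => f (g (x + t *: v)))); last first.
  by apply/funext => y; rewrite mxE.
rewrite (C1_diff oU Ux F1).2 mxE; congr is_derive; apply: eq_bigr => j _; rewrite mxE.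
congr (_ * _); apply: (congr1 (fun h : _ -> R^o => 'D_(delta_mx 0 j) h (g x))).
by apply/funext => y; rewrite mxE.
Qed.

Lemma is_derive_comp n p q (V : normedModType R) (f : 'rV[R]_n -> 'M[R]_(p, q))
    (g : V -> 'rV[R]_n) U x v dg :
  open U -> U (g x) -> Ck 1 U f -> is_derive x v g dg ->
  is_derive x v (f \o g) ('D_dg f (g x)).
Proof.
move=> oU Ux F G; apply/is_derive_mx => i j.
have /(Ck_mx _ _ oU)/(_ i j) Fij := F.
have := is_derive_comp_scalar oU Ux Fij G; congr is_derive.
have D := C1_is_derive_mx dg oU Ux F; have [_ ->] := D.
have /is_derive_mx/(_ i j)[_ <-] := D.
by have [_ ->] := C1_is_derive_scalar dg oU Ux Fij.
Qed.

(** The partial derivatives of f \o g are sums of products of those of g with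
    ['D_(delta_mx 0 l) f \o g]; the induction hypothesis covers the latter, with the same g. *)
Lemma Ck_comp_scalar n m k U V (f : 'rV[R]_m -> R^o) (g : 'rV[R]_n -> 'rV[R]_m) :
  open U -> open V -> (forall x, U x -> V (g x)) ->
  Ck k V f -> Ck k U g -> Ck k U (f \o g).
Proof.
move=> oU oV gUV; elim: k f => [|k IH] f F G.
  split=> // x Ux; apply: continuous_comp; first exact: Ck_continuous G Ux.
  exact: Ck_continuous F (gUV x Ux).
have [cf df] := F; have [cg dg] := G.
have C1 r (W : normedModType R) (S : set 'rV[R]_r) (h : 'rV[R]_r -> W) :
    Ck k.+1 S h -> Ck 1 S h.
  move=> [ch dh]; split=> // j; have [d c] := dh j; split=> //; split=> // x.
  exact: Ck_continuous c.
have D x j : U x -> is_derive x (delta_mx 0 j) (f \o g)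
    (\sum_l 'D_(delta_mx 0 j) g x 0 l * ('D_(delta_mx 0 l) f (g x) : R)).
  move=> Ux; apply: (is_derive_comp_scalar oV (gUV x Ux)); first exact: C1.
  by apply: derivableP; exact: (dg j).1.
split=> [x Ux|j].
  by apply: continuous_comp; [exact: cg|exact: (cf _ (gUV x Ux))].
split=> [x Ux|]; first by have [] := D x j Ux.
apply: (@Ck_eq _ _ _ _ _ (fun x => \sum_l 'D_(delta_mx 0 j) g x 0 l * ('D_(delta_mx 0 l) f (g x) : R) : R^o)) => //.
  by move=> x Ux; have [_ ->] := D x j Ux.
apply: Ck_sum => // l _; apply: CkM => //.
  by have [_ /(Ck_mx _ _ oU)] := dg j; exact.
exact: (IH _ (df l).2 (CkW G)).
Qed.

Lemma Ck_comp n m p q k U V (f : 'rV[R]_m -> 'M[R]_(p, q)) (g : 'rV[R]_n -> 'rV[R]_m) :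
  open U -> open V -> (forall x, U x -> V (g x)) ->
  Ck k V f -> Ck k U g -> Ck k U (f \o g).
Proof.
move=> oU oV gUV /(Ck_mx _ _ oV) F G; apply/Ck_mx => // i j.
exact: Ck_comp_scalar (F i j) G.
Qed.

Lemma smooth_C1 n (V : normedModType R) U (f : 'rV[R]_n -> V) : smooth_on U f -> Ck 1 U f.
Proof. exact. Qed.

Lemma smooth_partial n (V : normedModType R) U (f : 'rV[R]_n -> V) j :
  smooth_on U f -> smooth_on U ('D_(delta_mx 0 j) f).
Proof. by move=> F k; have [_ /(_ j)[]] := F k.+1. Qed.

Lemma smooth_jacobian n p U (f : 'rV[R]_n -> 'rV[R]_p) :
  open U -> smooth_on U f -> smooth_on U (jacobian f).
Proof.
move=> oU F k; apply/Ck_mx => // i j.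
have /(Ck_mx _ _ oU)/(_ 0 j) := smooth_partial i F k; apply: Ck_eq => // x Ux.
have [_ ->] := C1_is_derive (delta_mx 0 i) oU Ux (smooth_C1 F).
by rewrite -rowE mxE.
Qed.

Lemma jacobian_comp n m p U V (f : 'rV[R]_m -> 'rV[R]_p) (g : 'rV[R]_n -> 'rV[R]_m) x :
  open U -> open V -> U x -> V (g x) -> Ck 1 V f -> Ck 1 U g ->
  'J (f \o g) x = 'J g x *m 'J f (g x).
Proof.
move=> oU oV Ux Vx F G.
have [df _] := C1_diff oV Vx F; have [dg _] := C1_diff oU Ux G.
apply/row_matrixP => i; rewrite !rowE mulmxA.
rewrite -deriveEjacobian; last exact: differentiable_comp.
rewrite deriveE; last exact: differentiable_comp.
by rewrite diff_comp//= -!deriveE// !deriveEjacobian.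
Qed.

Lemma near_jacobian n p (f g : 'rV[R]_n -> 'rV[R]_p) U x :
  open U -> U x -> Ck 1 U f -> (forall y, U y -> f y = g y) -> 'J f x = 'J g x.
Proof.
move=> oU Ux F fg; have G := Ck_eq oU fg F.
have [dF _] := C1_diff oU Ux F; have [dG _] := C1_diff oU Ux G.
have H (v : 'rV[R]_n) : v *m 'J f x = v *m 'J g x.
  transitivity ('D_v f x); first exact/esym/deriveEjacobian.
  transitivity ('D_v g x); last exact: deriveEjacobian.
  by apply: near_derive; exact: open_near_eq fg.
move: H; generalize ('J f x) ('J g x) => A B H.
by apply/row_matrixP => i; rewrite !rowE H.
Qed.

Definition convex_set (V : normedModType R) (C : set V) :=
  forall x y (s : R), C x -> C y -> 0 <= s <= 1 -> C (x + s *: (y - x)).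

(** The one-variable bound along the segment from x to y, for each entry. The factor n comes from
    the sum over the n partial derivatives. *)
Lemma mvt_convex n p q (f : 'rV[R]_n -> 'M[R]_(p, q)) U C (M : R) x y :
  open U -> C `<=` U -> convex_set C -> Ck 1 U f -> 0 <= M ->
  (forall z, C z -> forall j, `|'D_(delta_mx 0 j) f z| <= M) ->
  C x -> C y -> `|f y - f x| <= n%:R * M * `|y - x|.
Proof.
move=> oU CU convC F M0 bM Cx Cy; apply: norm_le_entries => [|i j].
  by rewrite !mulr_ge0.
have /(Ck_mx _ _ oU)/(_ i j) Fij := F.
pose g (s : R) : R := f (x + s *: (y - x)) i j.
rewrite mxE [X in _ + X]mxE.
have -> : f y i j - f x i j = g 1 - g 0.
  by rewrite /g scale1r scale0r addr0 [x + _]addrC subrK.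
have := @mvt_bound R g (fun s => \sum_l (y - x) 0 l * ('D_(delta_mx 0 l) (fun z => f z i j : R^o) (x + s *: (y - x)) : R)) 0 1 (n%:R * M * `|y - x|).
rewrite subr0 normr1 mulr1; apply => s.
rewrite (min_idPl ler01) (max_idPr ler01) => s01.
have Cs := convC _ _ _ Cx Cy s01.
have D := C1_is_derive_scalar (y - x) oU (CU _ Cs) Fij.
split; first by have [d <-] := D; exact: is_derive_line.
rewrite -mulrA; apply: norm_sum_le => l; rewrite normrM mulrC ler_pM//; last exact: entry_le_norm.
apply: le_trans (bM _ Cs l); have d : derivable f (x + s *: (y - x)) (delta_mx 0 l).
  by have [_ /(_ l)[+ _]] := F; apply; exact: CU.
by rewrite [leRHS](_ : _ = `|'D_(delta_mx 0 l) f (x + s *: (y - x))|)// derive_mx//;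
  apply: le_trans (entry_le_norm _ i j); rewrite mxE.
Qed.

End ChainRule.

(** * Ordinary differential equations *)

Section ODE.
Context {R : realType}.

(** Equations are solved on [0, 1] with two-sided derivatives at both ends. This is why the
    primitive lives on the larger interval ]-1, 2[: it is an integral from -1, normalized at 0
    afterwards. *)
Lemma primitive_ex (f : R -> R) : continuous f ->
  exists2 F : R -> R, F 0 = 0 & forall s : R, s \in `]-1, 2[ -> is_derive s 1 F (f s).
Proof.
move=> cf.
pose F0 (s : R) := (\int[lebesgue_measure]_(t in `[-1, s]) (f t))%R.
exists (fun s => F0 s - F0 0); first by rewrite subrr.
move=> s; rewrite in_itv/= => /andP[s1 s2].
have int : lebesgue_measure.-integrable `[-1, 2] (EFin \o f).
  apply: continuous_compact_integrable; first exact: segment_compact.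
  exact: continuous_subspaceT.
have [d D] := continuous_FTC1_closed s2 int s1 (cf s).
have D1 : is_derive s 1 F0 (f s) by split; [exact: d|rewrite -derive1E; exact: D].
by have := is_derive_subf D1 (is_derive_cstf (F0 0) s 1); rewrite subr0.
Qed.

Lemma primitive_rV_ex m (f : R -> 'rV[R]_m) : continuous f ->
  exists2 F : R -> 'rV[R]_m, F 0 = 0 & forall s : R, s \in `]-1, 2[ -> is_derive s 1 F (f s).
Proof.
move=> cf.
have H j : exists F : R -> R, F 0 = 0 /\ forall s : R, s \in `]-1, 2[ -> is_derive s 1 F (f s 0 j).
  have [|F F0 dF] := @primitive_ex (fun s => f s 0 j); last by exists F.
  by move=> s; have /continuous_mxP := cf s; exact.
have [F FP] := choice H.
exists (fun s => \row_j F j s); first by apply/rowP => j; rewrite !mxE (FP j).1.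
move=> s s1; apply/is_derive_mx => i j; rewrite ord1.
rewrite (_ : (fun y => _) = F j); last by apply/funext => y; rewrite mxE.
exact: (FP j).2.
Qed.

Lemma ler_derive01 (u du v dv : R -> R) :
  (forall s : R, 0 <= s <= 1 -> is_derive s 1 u (du s)) ->
  (forall s : R, 0 <= s <= 1 -> is_derive s 1 v (dv s)) ->
  (forall s : R, 0 <= s <= 1 -> du s <= dv s) -> u 0 <= v 0 ->
  forall s : R, 0 <= s <= 1 -> u s <= v s.
Proof.
move=> U V UV uv0 s /andP[s0 s1].
pose h (t : R) : R := v t - u t; pose dh (t : R) : R := dv t - du t.
have D t : t \in `[0, s] -> is_derive t 1 h (dh t).
  rewrite in_itv/= => /andP[t0 ts].
  by apply: is_derive_subf; [apply: V|apply: U]; rewrite t0 (le_trans ts).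
have D1 t : t \in `]0, s[ -> is_derive t 1 h (dh t).
  by move=> ts; apply: D; exact: subset_itv_oo_cc.
have C : {within `[0, s], continuous h}.
  by apply: derivable_within_continuous => t /D[].
have [c] := MVT_segment s0 D1 C; rewrite in_itv/= => /andP[c0 cs] E.
have : 0 <= dh c * (s - 0).
  by rewrite mulr_ge0 ?subr_ge0// UV// c0 (le_trans cs).
by rewrite -E /h subr_ge0 => E1; lra.
Qed.

(** The sup norm is not differentiable, so [ler_derive01] is applied to each coordinate of u and to
    its opposite. *)
Lemma comparison m (u du : R -> 'rV[R]_m) (v dv : R -> R) :
  (forall s : R, 0 <= s <= 1 -> is_derive s 1 u (du s)) ->
  (forall s : R, 0 <= s <= 1 -> is_derive s 1 v (dv s)) ->
  (forall s : R, 0 <= s <= 1 -> `|du s| <= dv s) -> `|u 0| <= v 0 ->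
  forall s : R, 0 <= s <= 1 -> `|u s| <= v s.
Proof.
move=> U V UV uv0 s s01.
have v0 : 0 <= v s.
  apply: (@ler_derive01 (fun=> 0) (fun=> 0) v dv) s01.
  - move=> t t01; exact: le_trans (normr_ge0 _) (UV t t01).
  - exact: le_trans (normr_ge0 _) uv0.
apply: norm_le_entries => // i j; rewrite ord1 ler_norml.
have Uj (t : R) : 0 <= t <= 1 -> is_derive t 1 (fun t : R => u t 0 j : R) (du t 0 j).
  by move=> /U/is_derive_mx; exact.
have UNj (t : R) : 0 <= t <= 1 -> is_derive t 1 (fun t : R => - u t 0 j : R) (- du t 0 j).
  by move=> /Uj tj; exact: is_deriveN.
have le1 (w : 'rV[R]_m) c : `|w| <= c -> w 0 j <= c.
  by apply: le_trans; apply: le_trans (entry_le_norm _ 0 j); rewrite ler_norm.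
have leN (w : 'rV[R]_m) c : `|w| <= c -> - w 0 j <= c.
  by apply: le_trans; apply: le_trans (entry_le_norm _ 0 j); rewrite -normrN ler_norm.
apply/andP; split.
  rewrite lerNl; apply: (ler_derive01 UNj V _ _ s01); last exact: leN.
  by move=> t t01; apply: leN; exact: UV.
apply: (ler_derive01 Uj V _ _ s01); last exact: le1.
by move=> t t01; apply: le1; exact: UV.
Qed.

Lemma is_derive_scale (a s : R) : is_derive s 1 (fun t : R => a * t) a.
Proof.
have := is_derive_mulf (is_derive_cstf a s 1) (is_derive_id s (1 : R)).
by rewrite mul0r add0r mulr1.
Qed.

Lemma is_derive_expRM (a s : R) : is_derive s 1 (fun t => expR (a * t)) (a * expR (a * s)).
Proof.
have := @is_derive1_comp R expR (fun t => a * t) s _ _ (is_derive_expR (a * s)) (is_derive_scale a s).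
by rewrite mulrC.
Qed.

(** The sum of squares E is a differentiable substitute for the squared norm: |u|^2 <= E <= m |u|^2.
    From E' <= c (E + e^2) it follows that (E + e^2) exp(- c s) stays below its initial value. B
    depends on m and L alone, so it can be fixed before the solutions and the error e are known. *)
Lemma gronwall m (L : R) : 0 <= L -> exists2 B : R, 0 <= B &
  forall (u du : R -> 'rV[R]_m) (e : R), 0 <= e ->
  (forall s : R, 0 <= s <= 1 -> is_derive s 1 u (du s)) ->
  (forall s : R, 0 <= s <= 1 -> `|du s| <= L * `|u s| + e) ->
  forall s : R, 0 <= s <= 1 -> `|u s| <= B * (`|u 0| + e).
Proof.
(* The term L |u| contributes 2 m L; the term 2 e |u_j| <= u_j^2 + e^2, summed over j, contributes 1
   and m. *)
move=> L0; pose c : R := 2 * m%:R * L + 1 + m%:R.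
have c1 : 1 <= c by rewrite /c -addrA addrC -addrA lerDl addr_ge0// mulr_ge0// mulr_ge0.
have c0 : 0 <= c by exact: le_trans c1.
exists (m.+1%:R * expR c) => [|u du e e0 U dU s s01]; first by rewrite mulr_ge0// expR_ge0.
pose E (t : R) : R := \sum_j u t 0 j * u t 0 j.
pose dE (t : R) : R := \sum_j (du t 0 j * u t 0 j + u t 0 j * du t 0 j).
have uE t : `|u t| ^+ 2 <= E t.
  rewrite -ler_sqrt ?sqr_ge0//; last by apply: sumr_ge0 => j _; rewrite -expr2 sqr_ge0.
  rewrite sqrtr_sqr normr_id; apply: norm_le_entries => [|i j]; first exact: sqrtr_ge0.
  rewrite ord1 -sqrtr_sqr ler_sqrt ?sumr_ge0// => [|k _]; last by rewrite -expr2 sqr_ge0.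
  rewrite /E (bigD1 j)//= expr2 lerDl sumr_ge0// => k _.
  by rewrite -expr2 sqr_ge0.
have Eu t : E t <= m%:R * `|u t| ^+ 2.
  rewrite mulr_natl -[X in _ *+ X]card_ord -sumr_const; apply: ler_sum => j _.
  by rewrite -expr2 -real_normK ?num_real// lerXn2r ?nnegrE// entry_le_norm.
have DE (t : R) : 0 <= t <= 1 -> is_derive t 1 E (dE t).
  move=> /U Ut; apply: is_derive_sumf => j.
  by apply: is_derive_mulf; move/is_derive_mx : Ut; exact.
have dEle (t : R) : 0 <= t <= 1 -> dE t <= c * (E t + e ^+ 2).
  move=> /dU Ut.
  have : dE t <= \sum_(j < m) (2 * L * `|u t| ^+ 2 + u t 0 j * u t 0 j + e ^+ 2).
    apply: ler_sum => j _.
    have h1 : `|du t 0 j| <= L * `|u t| + e by exact: le_trans (entry_le_norm _ _ _) Ut.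
    have h2 := entry_le_norm (u t) 0 j.
    have h3 : du t 0 j * u t 0 j <= (L * `|u t| + e) * `|u t 0 j|.
      by rewrite (le_trans (ler_norm _))// normrM ler_wpM2r.
    have h4 : (L * `|u t|) * `|u t 0 j| <= (L * `|u t|) * `|u t|.
      by rewrite ler_wpM2l// mulr_ge0.
    have h5 : `|u t 0 j| * `|u t 0 j| = u t 0 j * u t 0 j.
      by rewrite -normrM ger0_norm// -expr2 sqr_ge0.
    have h6 : 0 <= (`|u t 0 j| - e) ^+ 2 by rewrite sqr_ge0.
    nra.
  move=> /le_trans; apply.
  rewrite !big_split/= !sumr_const card_ord -/(E t).
  rewrite -(mulr_natr (2 * L * `|u t| ^+ 2) m) -(mulr_natr (e ^+ 2) m).
  have := uE t; set U2 := `|u t| ^+ 2 => uEt.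
  have U20 : 0 <= U2 by rewrite sqr_ge0.
  have h1 : 2 * L * U2 * m%:R <= 2 * L * E t * m%:R.
    by rewrite ler_wpM2r// ler_wpM2l// mulr_ge0.
  have h2 : 0 <= m%:R * E t by rewrite mulr_ge0// (le_trans U20).
  have h3 : 0 <= e ^+ 2 by rewrite sqr_ge0.
  have h4 : 0 <= m%:R * L * e ^+ 2 by rewrite mulr_ge0// mulr_ge0.
  have h5 : 0 <= E t by rewrite (le_trans U20).
  by rewrite /c; nra.
pose h (t : R) : R := (E t + e ^+ 2) * expR (- c * t).
pose dh (t : R) : R := (dE t + 0) * expR (- c * t) + (E t + e ^+ 2) * (- c * expR (- c * t)).
have Dh : forall t : R, 0 <= t <= 1 -> is_derive t 1 h (dh t).
  move=> t t01; have Et := is_derive_addf (DE t t01) (is_derive_cstf (e ^+ 2 : R) t 1).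
  exact: (is_derive_mulf Et (is_derive_expRM (- c) t)).
have key : (E s + e ^+ 2) * expR (- c * s) <= E 0 + e ^+ 2.
  pose C : R := E 0 + e ^+ 2.
  apply: (@ler_derive01 h dh (fun=> C) (fun=> 0) Dh (fun t _ => is_derive_cstf C t 1) _ _ s s01).
  - move=> t t01; have := dEle t t01; have := expR_gt0 (- c * t).
    by rewrite /dh addr0; nra.
  - by rewrite /h mulr0 expR0 mulr1.
have key2 : E s + e ^+ 2 <= (E 0 + e ^+ 2) * expR c.
  have e1 : 0 < expR (c * s) by exact: expR_gt0.
  apply: (@le_trans _ _ ((E 0 + e ^+ 2) * expR (c * s))).
    by rewrite -ler_pdivrMr// -expRN -mulNr.
  rewrite ler_wpM2l ?ler_expR//.
    by rewrite addr_ge0 ?sqr_ge0// (le_trans _ (uE 0)) ?sqr_ge0.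
  by case/andP: s01 => s0 s1; rewrite ler_piMr.
have ec : 1 <= expR c by rewrite -expR0 ler_expR.
(* The two sides are compared after squaring. The square of B is larger than the factor (m + 1) exp
   c actually needed, since both m + 1 and exp c are at least 1. *)
rewrite -(@ler_pXn2r _ 2)// ?nnegrE ?mulr_ge0 ?expR_ge0 ?addr_ge0//.
apply: le_trans (uE s) _; apply: (@le_trans _ _ ((E 0 + e ^+ 2) * expR c)).
  by apply: le_trans key2; rewrite lerDl sqr_ge0.
rewrite exprMn exprMn.
have h1 : E 0 + e ^+ 2 <= m.+1%:R * (`|u 0| + e) ^+ 2.
  have := Eu 0; rewrite -[m.+1%:R]natr1; have := normr_ge0 (u 0).
  have : 0 <= m%:R * (2 * `|u 0| * e + e ^+ 2) :> R.
    by rewrite mulr_ge0// addr_ge0 ?sqr_ge0// mulr_ge0// mulr_ge0.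
  nra.
have h2 : m.+1%:R <= m.+1%:R ^+ 2 :> R by rewrite expr2 ler_peMl// ler1n.
have h3 : expR c <= expR c ^+ 2 by rewrite expr2 ler_peMl// expR_ge0.
apply: (@le_trans _ _ (m.+1%:R * (`|u 0| + e) ^+ 2 * expR c)).
  by rewrite ler_wpM2r ?expR_ge0.
rewrite [leLHS]mulrAC; apply: ler_wpM2r; first exact: sqr_ge0.
by rewrite ler_pM// expR_ge0.
Qed.

End ODE.

(** * Picard iteration on [0, 1] *)

Section Picard.
Context {R : realType}.

(** The intervals of centre [a n] and radius 2 A / 2^n meet pairwise ([cross]). The supremum of
    their left ends lies in all of them, which gives the limit together with its rate. *)
Lemma geometric_limit_scalar (a : nat -> R) (A : R) :
  (forall n, `|a n.+1 - a n| <= A / 2 ^+ n) ->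
  exists l, forall n, `|a n - l| <= 2 * A / 2 ^+ n.
Proof.
move=> h.
have e0 n : 0 <= 2 * A / 2 ^+ n by rewrite -mulrA mulr_ge0// (le_trans _ (h n)).
have step n k : `|a (n + k)%N - a n| <= 2 * A / 2 ^+ n - 2 * A / 2 ^+ (n + k).
  elim: k => [|k IH]; first by rewrite addn0 !subrr normr0.
  rewrite addnS; apply: le_trans (ler_distD (a (n + k)%N) _ _) _.
  apply: le_trans (lerD (h _) IH) _.
  rewrite exprS invfM; set x := (2 ^+ (n + k))^-1; set y := 2 * A / _; nra.
have cross n k : a n - 2 * A / 2 ^+ n <= a k + 2 * A / 2 ^+ k.
  have [nk|kn] := leqP n k.
    have := step n (k - n)%N; rewrite subnKC// ler_norml => /andP[+ _].
    by have := e0 k; lra.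
  have := step k (n - k)%N; rewrite subnKC 1?ltnW// ler_norml => /andP[_].
  by have := e0 n; lra.
pose S := [set x | exists n, x = a n - 2 * A / 2 ^+ n].
exists (sup S) => n; rewrite ler_distlC; apply/andP; split.
  apply: ub_le_sup; last by exists n.
  by exists (a 0%N + 2 * A / 2 ^+ 0) => x [k ->].
apply: ge_sup; first by exists (a 0%N - 2 * A / 2 ^+ 0), 0%N.
by move=> x [k ->].
Qed.

Lemma geometric_limit m (u : nat -> 'rV[R]_m) (A : R) :
  (forall n, `|u n.+1 - u n| <= A / 2 ^+ n) ->
  exists l, forall n, `|u n - l| <= 2 * A / 2 ^+ n.
Proof.
move=> h.
have H j : exists l, forall n, `|u n 0 j - l| <= 2 * A / 2 ^+ n.
  apply: geometric_limit_scalar => n; apply: le_trans (h n).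
  by have := entry_le_norm (u n.+1 - u n) 0 j; rewrite !mxE.
have [l lP] := choice H; exists (\row_j l j) => n.
apply: norm_le_entries => [|i j]; last by rewrite ord1 !mxE.
by rewrite -mulrA mulr_ge0// (le_trans _ (h n)).
Qed.

(** Composing with it extends a function continuously from [0, 1] to the whole line, so that it can
    be fed to [primitive_rV_ex]. *)
Definition clamp (s : R) : R := Num.max 0 (Num.min s 1).

Lemma clamp_id s : 0 <= s <= 1 -> clamp s = s.
Proof. by move=> /andP[s0 s1]; rewrite /clamp (min_idPl s1) (max_idPr s0). Qed.

Lemma clamp01 s : 0 <= clamp s <= 1.
Proof.
by rewrite /clamp le_max lexx/= ge_max ler01 ge_min lexx orbT.
Qed.

Lemma clamp_continuous : continuous clamp.
Proof.
move=> s.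
have c1 : {for s, continuous (fun t : R => t : R^o)} by exact: cvg_id.
have c2 (c : R) : {for s, continuous (fun _ : R => c : R^o)} by exact: cst_continuous.
exact: (continuous_max (c2 0) (continuous_min c1 (c2 1))).
Qed.

Lemma is_derive_continuous (V : normedModType R) (f : R -> V) (s : R) df :
  is_derive s 1 f df -> {for s, continuous f}.
Proof.
by move=> [d _]; apply: differentiable_continuous; exact/derivable1_diffP.
Qed.

Lemma clamp_comp_continuous (V : normedModType R) (f : R -> V) :
  (forall s : R, 0 <= s <= 1 -> {for s, continuous f}) -> continuous (f \o clamp).
Proof.
move=> cf s; apply: continuous_comp; first exact: clamp_continuous.
by apply: cf; exact: clamp01.
Qed.

Lemma clamp_bounded m (f : R -> 'rV[R]_m) : continuous (f \o clamp) ->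
  exists2 C : R, 0 <= C & forall s : R, 0 <= s <= 1 -> `|f s| <= C.
Proof.
move=> cf.
have : compact ((f \o clamp) @` `[0, 1]).
  by apply: continuous_compact; [exact: continuous_subspaceT|exact: segment_compact].
move=> /compact_bounded[M [Mr MP]]; exists (Num.max 0 (M + 1)); first by rewrite le_max lexx.
move=> s s01; apply: (@le_trans _ _ (M + 1)); last by rewrite le_max lexx orbT.
by apply: MP; [rewrite ltrDl|exists s => //=; rewrite ?clamp_id// in_itv].
Qed.

(** The Lipschitz bound is global in space, so a solution exists on all of [0, 1] without gluing
    short intervals. Callers arrange such a bound by a retraction or by linearity of the
    equation. *)
Theorem picard m (g : R -> 'rV[R]_m -> 'rV[R]_m) (L : R) (y0 : 'rV[R]_m) :
  0 <= L ->
  (forall y : R -> 'rV[R]_m, continuous y -> continuous (fun s => g s (y s))) ->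
  (forall s u v, 0 <= s <= 1 -> `|g s u - g s v| <= L * `|u - v|) ->
  exists2 y, y 0 = y0 & forall s : R, 0 <= s <= 1 -> is_derive s 1 y (g s (y s)).
Proof.
move=> L0 cg lip.
pose step (y z : R -> 'rV[R]_m) := z 0 = y0 /\
  forall s : R, 0 <= s <= 1 -> is_derive s 1 z (g s (y s)).
have stepc y z : step y z -> continuous (z \o clamp).
  by move=> [_ D]; apply: clamp_comp_continuous => s /D/is_derive_continuous.
have stepP y : continuous (y \o clamp) -> exists z, step y z.
  move=> cy.
  have cgy : continuous ((fun s => g s ((y \o clamp) s)) \o clamp).
    by apply: clamp_comp_continuous => s _; exact: (cg _ cy).
  have [F F0 dF] := primitive_rV_ex cgy.
  exists (fun s => y0 + F s); split=> [|s s01]; first by rewrite F0 addr0.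
  have s12 : s \in `]-1, 2[ by case/andP: s01 => ? ?; rewrite in_itv/=; apply/andP; split; lra.
  have := is_derive_addf (is_derive_cstf y0 s 1) (dF s s12).
  by rewrite add0r /= !clamp_id// clamp_id.
(* The default value is never taken along the iteration: [YP] shows that each iterate is continuous
   on [0, 1] and hence has a successor. *)
pose T y := xget y [set z | step y z].
pose Y n := iter n T (fun=> y0).
have YP n : continuous (Y n \o clamp) /\ step (Y n) (Y n.+1).
  have Tst n' : continuous (Y n' \o clamp) -> step (Y n') (Y n'.+1).
    by move=> /stepP[z zP]; apply: (xgetPex _ (ex_intro _ z zP)).
  elim: n => [|n [IH1 IH2]].
    have c0 : continuous (Y 0%N \o clamp) by move=> s; exact: cst_continuous.
    by split => //; exact: Tst.
  have c := stepc _ _ IH2.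
  by split => //; exact: Tst.
have Y0 n : Y n 0 = y0 by case: n => [|n] //; exact: (YP n).2.1.
have [C C0 CP] : exists2 C : R, 0 <= C & forall s : R, 0 <= s <= 1 -> `|Y 1%N s - Y 0%N s| <= C.
  apply: (@clamp_bounded _ (fun s => Y 1%N s - Y 0%N s)) => s.
  exact: (continuousB ((YP 1%N).1 s) ((YP 0%N).1 s)).
(* The weight exp(2 L s) makes the iteration a contraction of ratio 1/2 on the whole interval:
   integrating L exp(2 L s) gains the factor 1/2. *)
have est n (s : R) : 0 <= s <= 1 -> `|Y n.+1 s - Y n s| <= C / 2 ^+ n * expR (2 * L * s).
  elim: n s => [|n IH] s s01.
    rewrite expr0 divr1; apply: le_trans (CP s s01) _; rewrite ler_peMr//.
    by rewrite -expR0 ler_expR mulr_ge0 ?mulr_ge0//; case/andP: s01.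
  have D : forall t : R, 0 <= t <= 1 -> is_derive t 1 (fun t : R => Y n.+2 t - Y n.+1 t)
      (g t (Y n.+1 t) - g t (Y n t)).
    by move=> t t01; apply: is_derive_subf; [exact: (YP n.+1).2.2|exact: (YP n).2.2].
  have V : forall t : R, 0 <= t <= 1 ->
    is_derive t 1 (fun t : R => C / 2 ^+ n.+1 * expR (2 * L * t) : R)
      (C / 2 ^+ n.+1 * (2 * L * expR (2 * L * t))).
    move=> t _.
    have := is_derive_mulf (is_derive_cstf (C / 2 ^+ n.+1 : R) t 1) (is_derive_expRM (2 * L) t).
    by rewrite mul0r add0r.
  apply: (comparison D V _ _ s01); last first.
    by rewrite !Y0 subrr normr0 mulr_ge0 ?expR_ge0// divr_ge0// exprn_ge0.
  move=> t t01; apply: le_trans (lip _ _ _ t01) _.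
  apply: le_trans (ler_wpM2l L0 (IH t t01)) _.
  rewrite exprS invfM le_eqVlt; apply/orP; left; apply/eqP.
  have : 2 / 2 = 1 :> R by rewrite divff.
  set x := (2^-1 : R) => xE; rewrite !mulrA; set e := expR _; set z := (2 ^+ n)^-1.
  have -> : C * x * z * 2 * L * e = (2 * x) * (L * C * z * e) by ring.
  by rewrite xE; ring.
pose A := C * expR (2 * L).
have A0 : 0 <= A by rewrite mulr_ge0// expR_ge0.
have est2 n (s : R) : 0 <= s <= 1 -> `|Y n.+1 s - Y n s| <= A / 2 ^+ n.
  move=> s01; apply: le_trans (est n s s01) _.
  rewrite /A mulrAC; apply: ler_wpM2r; first by rewrite invr_ge0 exprn_ge0.
  apply: ler_wpM2l => //.
  by rewrite ler_expR ler_piMr ?mulr_ge0//; case/andP: s01.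
have [y yP] : exists y : R -> 'rV[R]_m, forall s : R, 0 <= s <= 1 ->
    forall n, `|Y n s - y s| <= 2 * A / 2 ^+ n.
  have H (s : R) : exists l, 0 <= s <= 1 -> forall n, `|Y n s - l| <= 2 * A / 2 ^+ n.
    case: (boolP (0 <= s <= 1)) => s01; last by exists 0.
    by have [l lP] := geometric_limit (fun n => est2 n s s01); exists l.
  by have [y yP] := choice H; exists y.
have small (B e : R) : 0 < e -> exists n, B / 2 ^+ n < e.
  move=> e0; exists (Num.bound `|B / e|).
  rewrite ltr_pdivrMr ?exprn_gt0// mulrC -ltr_pdivrMr//.
  apply: le_lt_trans (ler_norm _) _; apply: lt_trans (archi_boundP (normr_ge0 (B / e))) _.
  by rewrite -natrX ltr_nat ltn_expl.
have cy : continuous (y \o clamp).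
  move=> s; apply/cvgrPdist_le => e e0.
  have [n nP] := small (2 * A) (e / 3) ltac:(by rewrite divr_gt0).
  have /cvgrPdist_le/(_ (e / 3)) := (YP n).1 s; rewrite divr_gt0// => /(_ isT) c.
  near=> t.
  have h1 := yP _ (clamp01 s) n; have h2 := yP _ (clamp01 t) n.
  have h3 : `|(Y n \o clamp) s - (Y n \o clamp) t| <= e / 3 by near: t.
  have -> : (y \o clamp) s - (y \o clamp) t = (y (clamp s) - Y n (clamp s)) +
     ((Y n (clamp s) - Y n (clamp t)) + (Y n (clamp t) - y (clamp t))).
    by rewrite /= subrKA subrKA.
  apply: le_trans (ler_normD _ _) _; rewrite distrC in h1.
  apply: le_trans (lerD h1 (le_trans (ler_normD _ _) (lerD h3 h2))) _.
  by move: nP; set z := _ / 2 ^+ n; lra.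
(* The limit y is only known to be continuous. One further Picard step z is differentiable, and it
   equals y on [0, 1] because the iterates converge to both. *)
have [z [z0 dz]] := stepP y cy.
suff zy : forall s : R, 0 <= s <= 1 -> z s = y s.
  by exists z => // s s01; rewrite zy//; exact: dz.
move=> s s01; apply/eqP; rewrite -subr_eq0 -normr_eq0 eq_le normr_ge0 andbT.
apply/ler_addgt0Pl => e e0; rewrite addr0.
have [n nP] := small (L * (2 * A) + 2 * A) e e0.
have D : forall t : R, 0 <= t <= 1 -> is_derive t 1 (fun t : R => z t - Y n.+1 t)
      (g t (y t) - g t (Y n t)).
  by move=> t t01; apply: is_derive_subf; [exact: dz|exact: (YP n).2.2].
have V : forall t : R, 0 <= t <= 1 ->
    is_derive t 1 (fun t : R => L * (2 * A / 2 ^+ n) * t : R) (L * (2 * A / 2 ^+ n)).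
  by move=> t _; exact: is_derive_scale.
have h1 : `|z s - Y n.+1 s| <= L * (2 * A / 2 ^+ n) * s.
  apply: (comparison D V _ _ s01) => [t t01|]; last by rewrite Y0 z0 subrr normr0 mulr0.
  by apply: le_trans (lip _ _ _ t01) _; rewrite ler_wpM2l// distrC yP.
have h2 := yP s s01 n.+1.
rewrite -(subrKA (Y n.+1 s)); apply: le_trans (ler_normD _ _) _.
apply: le_trans (lerD h1 h2) _; apply: le_trans (ltW nP).
have e1 : 0 <= 2 * A / 2 ^+ n by rewrite divr_ge0 ?mulr_ge0// exprn_ge0.
have -> : (L * (2 * A) + 2 * A) / 2 ^+ n = L * (2 * A / 2 ^+ n) + 2 * A / 2 ^+ n.
  by set r := (2 ^+ n)^-1; ring.
apply: lerD.
  by rewrite ler_piMr ?mulr_ge0//; case/andP: s01.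
by rewrite exprS invfM mulrCA ler_piMl// invf_le1// ler1n.
Unshelve. all: by end_near. Qed.

End Picard.

(** * Smooth dependence of solutions on initial data *)

Section SmoothDependence.
Context {R : realType}.

Lemma is_derive_eps (V W : normedModType R) (f : V -> W) x v df :
  is_derive x v f df <-> forall e : R, 0 < e ->
    \forall h \near (0 : R), `|f (x + h *: v) - f x - h *: df| <= e * `|h|.
Proof.
have E (h : R) : h != 0 ->
    `|df - h^-1 *: ((f \o shift x) (h *: v) - f x)| = `|h|^-1 * `|f (x + h *: v) - f x - h *: df|.
  move=> h0; rewrite -normfV -normrZ distrC /= [h *: v + x]addrC.
  by congr (`|_|); rewrite [RHS]scalerBr [in RHS]scalerA mulVf// scale1r.
split=> [[d D] e e0|H].
  have /cvgrPdist_le/(_ e e0) : (fun h : R => h^-1 *: ((f \o shift x) (h *: v) - f x)) @ 0^' --> df.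
    by rewrite -D; exact: d.
  rewrite near_withinE; apply: filterS => h hP.
  have [->|h0] := eqVneq h 0; first by rewrite !scale0r addr0 subrr subr0 !normr0 mulr0.
  by have := hP h0; rewrite E// mulrC ler_pdivrMr// normr_gt0.
have cv : (fun h : R => h^-1 *: ((f \o shift x) (h *: v) - f x)) @ 0^' --> df.
  apply/cvgrPdist_le => e e0; rewrite near_withinE.
  apply: filterS (H e e0) => h hP h0.
  by rewrite E// mulrC ler_pdivrMr ?normr_gt0.
by split; [apply/cvg_ex; exists df|exact: cvg_lim cv].
Qed.

Lemma Ck_row_mx n k U p q1 q2 (f : 'rV[R]_n -> 'M[R]_(p, q1)) (g : 'rV[R]_n -> 'M[R]_(p, q2)) :
  open U -> Ck k U f -> Ck k U g -> Ck k U (fun x => row_mx (f x) (g x)).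
Proof.
move=> oU /(Ck_mx _ _ oU) F /(Ck_mx _ _ oU) G; apply/(Ck_mx _ _ oU) => i j.
have [j' ->|j' ->] := split_ordP j.
  by apply: (Ck_eq oU _ (F i j')) => x _; rewrite row_mxEl.
by apply: (Ck_eq oU _ (G i j')) => x _; rewrite row_mxEr.
Qed.

Lemma Ck_lsubmx n k U p q1 q2 (f : 'rV[R]_n -> 'M[R]_(p, q1 + q2)) :
  open U -> Ck k U f -> Ck k U (fun x => lsubmx (f x)).
Proof.
move=> oU /(Ck_mx _ _ oU) F; apply/(Ck_mx _ _ oU) => i j.
by apply: (Ck_eq oU _ (F i (lshift q2 j))) => x _; rewrite mxE.
Qed.

Lemma Ck_rsubmx n k U p q1 q2 (f : 'rV[R]_n -> 'M[R]_(p, q1 + q2)) :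
  open U -> Ck k U f -> Ck k U (fun x => rsubmx (f x)).
Proof.
move=> oU /(Ck_mx _ _ oU) F; apply/(Ck_mx _ _ oU) => i j.
by apply: (Ck_eq oU _ (F i (rshift q1 j))) => x _; rewrite mxE.
Qed.

Lemma compact_sub_bounded (V W : normedModType R) (U C : set V) (f : V -> W) :
  open U -> compact C -> C `<=` U -> (forall x, U x -> {for x, continuous f}) ->
  exists2 M : R, 0 <= M & forall x, C x -> `|f x| <= M.
Proof.
move=> oU cC CU cf.
have : compact (f @` C).
  apply: continuous_compact => //; apply: continuous_in_subspaceT => x.
  by rewrite inE => /CU /cf.
move=> /compact_bounded[M [Mr MP]]; exists (Num.max 0 (M + 1)); first by rewrite le_max lexx.
move=> x Cx; apply: (@le_trans _ _ (M + 1)); last by rewrite le_max lexx orbT.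
by apply: MP; [rewrite ltrDl|exists x].
Qed.

Lemma partials_bounded n p q U C (f : 'rV[R]_n -> 'M[R]_(p, q)) :
  open U -> compact C -> C `<=` U -> Ck 1 U f ->
  exists2 M : R, 0 <= M & forall x, C x -> forall j, `|'D_(delta_mx 0 j) f x| <= M.
Proof.
move=> oU cC CU [cf df].
have H j : exists M : R, 0 <= M /\ forall x, C x -> `|'D_(delta_mx 0 j) f x| <= M.
  have [|M M0 MP] := @compact_sub_bounded _ _ U C ('D_(delta_mx 0 j) f) oU cC CU; last by exists M.
  by have [_ []] := df j.
have [M MP] := choice H; exists (\sum_j M j) => [|x Cx j].
  by apply: sumr_ge0 => j _; exact: (MP j).1.
apply: le_trans ((MP j).2 x Cx) _; rewrite (bigD1 j)//= lerDl.
by apply: sumr_ge0 => k _; exact: (MP k).1.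
Qed.

Lemma derive_lipschitz n p q U (f : 'rV[R]_n -> 'M[R]_(p, q)) x (M : R) u v :
  open U -> U x -> Ck 1 U f -> (forall j, `|'D_(delta_mx 0 j) f x| <= M) ->
  `|'D_u f x - 'D_v f x| <= n%:R * M * `|u - v|.
Proof.
move=> oU Ux F MP.
have [_ ->] := C1_is_derive_mx u oU Ux F; have [_ ->] := C1_is_derive_mx v oU Ux F.
rewrite -sumrB; rewrite -mulrA; apply: norm_sum_le => j.
rewrite -scalerBl normrZ mulrC ler_pM//.
by have := entry_le_norm (u - v) 0 j; rewrite !mxE.
Qed.

Lemma convex_setI (V : normedModType R) (C D : set V) :
  convex_set C -> convex_set D -> convex_set (C `&` D).
Proof. by move=> cC cD x y s [? ?] [? ?] s01; split; [exact: cC|exact: cD]. Qed.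

Lemma convex_closed_ball n (a : 'rV[R]_n) (r : R) :
  convex_set [set x | `|x - a| <= r].
Proof.
move=> x y s /= xr yr /andP[s0 s1].
have -> : x + s *: (y - x) - a = (1 - s) *: (x - a) + s *: (y - a).
  by apply/rowP => j; rewrite !mxE; ring.
apply: le_trans (ler_normD _ _) _; rewrite !normrZ !ger0_norm ?subr_ge0//.
have h1 : (1 - s) * `|x - a| <= (1 - s) * r by rewrite ler_wpM2l ?subr_ge0.
have h2 : s * `|y - a| <= s * r by rewrite ler_wpM2l.
lra.
Qed.

(** The mean value bound is applied to f minus its linear part at x, on the convex set of points of
    C no further from x than y. There the partial derivatives of the difference are O(|y - x|),
    which yields the second power. *)
Lemma taylor_estimate n p U C (f : 'rV[R]_n -> 'rV[R]_p) :
  open U -> compact C -> convex_set C -> C `<=` U -> smooth_on U f ->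
  exists2 B : R, 0 <= B & forall x y, C x -> C y ->
    `|f y - f x - 'D_(y - x) f x| <= B * `|y - x| ^+ 2.
Proof.
move=> oU cC convC CU F.
have H j : exists M : R, 0 <= M /\ forall x, C x -> forall l,
    `|'D_(delta_mx 0 l) ('D_(delta_mx 0 j) f) x| <= M.
  have [M M0 MP] := partials_bounded oU cC CU (smooth_C1 (smooth_partial j F)).
  by exists M.
have [M MP] := choice H.
pose M2 := \sum_j M j.
have M20 : 0 <= M2 by apply: sumr_ge0 => j _; exact: (MP j).1.
have lip j x y : C x -> C y ->
    `|'D_(delta_mx 0 j) f y - 'D_(delta_mx 0 j) f x| <= n%:R * M2 * `|y - x|.
  move=> Cx Cy; apply: (mvt_convex oU CU convC (smooth_C1 (smooth_partial j F))) => // z Cz l.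
  apply: le_trans ((MP j).2 z Cz l) _; rewrite /M2 (bigD1 j)//= lerDl.
  by apply: sumr_ge0 => k _; exact: (MP k).1.
exists (n%:R * (n%:R * M2)); first by rewrite !mulr_ge0.
move=> x y Cx Cy.
pose A : 'M[R]_(n, p) := \matrix_j ('D_(delta_mx 0 j) f x).
have AE v : v *m A = 'D_v f x.
  have [_ ->] := C1_is_derive_mx v oU (CU x Cx) (smooth_C1 F).
  by rewrite mulmx_sum_row; apply: eq_bigr => j _; rewrite rowK.
pose g z := f z - z *m A.
have G1 : Ck 1 U g.
  have -> : g = fun z => f z + (-1) *: (z *m A) by apply/funext => z; rewrite scaleN1r.
  exact: (CkD oU (smooth_C1 F) (CkZ _ oU (CkMmx oU (Ck_id 1 oU) (Ck_cst 1 U A)))).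
have dg z j : C z -> 'D_(delta_mx 0 j) g z = 'D_(delta_mx 0 j) f z - 'D_(delta_mx 0 j) f x.
  move=> Cz; have D1 := C1_is_derive_mx (delta_mx 0 j) oU (CU z Cz) (smooth_C1 F).
  have D2 := is_derive_mulmx (is_derive_id z (delta_mx 0 j)) (is_derive_cstf A z (delta_mx 0 j)).
  rewrite mulmx0 addr0 AE in D2.
  have [_ ->] := is_derive_subf D1 D2.
  by have [_ ->] := D1.
pose D := C `&` [set z | `|z - x| <= `|y - x|].
have -> : f y - f x - 'D_(y - x) f x = g y - g x.
  by rewrite -AE mulmxBl /g !opprB addrACA [RHS]addrACA [- f x - _]addrC.
have -> : n%:R * (n%:R * M2) * `|y - x| ^+ 2 = n%:R * (n%:R * M2 * `|y - x|) * `|y - x| by ring.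
apply: (@mvt_convex R n 1 p g U D) => //.
- by move=> z [Cz _]; exact: CU.
- by apply: convex_setI => //; exact: convex_closed_ball.
- by rewrite !mulr_ge0.
- move=> z [Cz zx] j; rewrite dg//; apply: le_trans (lip j x z Cx Cz) _.
  by rewrite ler_wpM2l// mulr_ge0.
- by split=> //=; rewrite subrr normr0.
- by split=> /=.
Qed.

End SmoothDependence.

Section FlowFamilies.
Context {R : realType} {n : nat}.

Lemma continuous_near_le (T : topologicalType) (V : normedModType R) (f : T -> V) x :
  {for x, continuous f} <->
  forall e : R, 0 < e -> \forall z \near x, `|f x - f z| <= e.
Proof. by split=> [/cvgrPdist_le|h]; [|apply/cvgrPdist_le]. Qed.

Lemma closed_ball_compact m (a : 'rV[R]_m) (r : R) : compact [set x | `|x - a| <= r].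
Proof.
apply: bounded_closed_compact.
  exists (r + `|a|); split; first exact: num_real.
  move=> M /ltW rM x /= xr; apply: le_trans rM; rewrite -[x](subrK a).
  by apply: le_trans (ler_normD _ _) _; rewrite lerD2r.
have -> : [set x : 'rV[R]_m | `|x - a| <= r] =
    (fun x : 'rV[R]_m => `|x - a| : R) @^-1` [set t | t <= r] by [].
apply: closed_comp; last exact: closed_le.
move=> x _; apply: continuous_comp; last exact: norm_continuous.
by apply: continuousB; [exact: cvg_id|exact: cst_continuous].
Qed.

Lemma compact_row_mx m1 m2 (C : set 'rV[R]_m1) (D : set 'rV[R]_m2) :
  compact C -> compact D -> compact [set z : 'rV[R]_(m1 + m2) | C (lsubmx z) /\ D (rsubmx z)].
Proof.
move=> cC cD; apply: bounded_closed_compact.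
  have [K [Kr KP]] := compact_bounded cC; have [N [Nr NP]] := compact_bounded cD.
  exists (Num.max 0 (Num.max (K + 1) (N + 1))); split; first exact: num_real.
  move=> r; rewrite !gt_max => /and3P[r0 rK rN] z [Cz Dz].
  apply: norm_le_entries => [|i k]; first exact: ltW.
  have [k' ->|k' ->] := split_ordP k.
    apply: le_trans (ltW rK); have := KP (K + 1) _ _ Cz; rewrite ltrDl => /(_ ltr01).
    by apply: le_trans; have := entry_le_norm (lsubmx z) i k'; rewrite mxE.
  apply: le_trans (ltW rN); have := NP (N + 1) _ _ Dz; rewrite ltrDl => /(_ ltr01).
  by apply: le_trans; have := entry_le_norm (rsubmx z) i k'; rewrite mxE.
have -> : [set z : 'rV[R]_(m1 + m2) | C (lsubmx z) /\ D (rsubmx z)] =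
    ((lsubmx : 'rV[R]_(m1 + m2) -> 'rV[R]_m1) @^-1` C) `&`
    ((rsubmx : 'rV[R]_(m1 + m2) -> 'rV[R]_m2) @^-1` D) by [].
apply: closedI.
  apply: closed_comp; first by move=> z _; exact: continuous_lsubmx.
  by apply: compact_closed => //; exact: norm_hausdorff.
apply: closed_comp; first by move=> z _; exact: continuous_rsubmx.
by apply: compact_closed => //; exact: norm_hausdorff.
Qed.

Lemma convex_row_mx m1 m2 (C : set 'rV[R]_m1) (D : set 'rV[R]_m2) :
  convex_set C -> convex_set D ->
  convex_set [set z : 'rV[R]_(m1 + m2) | C (lsubmx z) /\ D (rsubmx z)].
Proof.
move=> cC cD a b s [aC aD] [bC bD] s01 /=.
have -> : lsubmx (a + s *: (b - a)) = lsubmx a + s *: (lsubmx b - lsubmx a).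
  by apply/rowP => l; rewrite !mxE.
have -> : rsubmx (a + s *: (b - a)) = rsubmx a + s *: (rsubmx b - rsubmx a).
  by apply/rowP => l; rewrite !mxE.
by split; [exact: cC|exact: cD].
Qed.

(* The solutions of y' = G y on [0, 1] with initial value y0 x, for x in V;
   those with x close to x1 stay in one convex compact subset of W. *)
Record flow_family m (W : set 'rV[R]_m) (G : 'rV[R]_m -> 'rV[R]_m)
    (V : set 'rV[R]_n) (y0 : 'rV[R]_n -> 'rV[R]_m) (y : R -> 'rV[R]_n -> 'rV[R]_m) : Prop := {
  flow_open : open W;
  flow_field_smooth : smooth_on W G;
  flow_params_open : open V;
  flow_init_smooth : smooth_on V y0;
  flow_init : forall x, V x -> y 0 x = y0 x;
  flow_ode : forall x, V x -> forall s : R, 0 <= s <= 1 ->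
    is_derive s 1 (fun t => y t x) (G (y s x));
  flow_compact : forall x1, V x1 -> exists2 C, [/\ compact C, convex_set C & C `<=` W] &
    \forall x \near x1, forall s : R, 0 <= s <= 1 -> C (y s x) }.

(** Gronwall for the difference of two solutions: both stay in the convex compact set of
    [flow_compact], on which the field is Lipschitz by the mean value bound. *)
Lemma flow_lipschitz m W G V y0 y x1 : @flow_family m W G V y0 y -> V x1 ->
  exists2 B : R, 0 <= B & \forall x \near x1, V x /\ forall s : R, 0 <= s <= 1 ->
    `|y s x - y s x1| <= B * `|y0 x - y0 x1|.
Proof.
move=> [oW sG oV s0 init ode comp] Vx1.
have [C [cC convC CW] nC] := comp x1 Vx1.
have [M M0 MP] := partials_bounded oW cC CW (smooth_C1 sG).
have L0 : 0 <= m%:R * M by rewrite mulr_ge0.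
have [B B0 BP] := @gronwall R m _ L0.
exists B => //; near=> x.
have Vx : V x by near: x; exact: open_nbhs_nbhs.
have Cx : forall s : R, 0 <= s <= 1 -> C (y s x) by near: x.
have Cx1 := nbhs_singleton nC.
split=> // s s01.
have D : forall t : R, 0 <= t <= 1 ->
    is_derive t 1 (fun t => y t x - y t x1) (G (y t x) - G (y t x1)).
  by move=> t t01; apply: is_derive_subf; exact: ode.
have E : forall t : R, 0 <= t <= 1 ->
    `|G (y t x) - G (y t x1)| <= m%:R * M * `|y t x - y t x1| + 0.
  move=> t t01; rewrite addr0.
  by apply: (mvt_convex oW CW convC (smooth_C1 sG) M0 MP); [exact: Cx1|exact: Cx].
by have := BP _ _ 0 (lexx _) D E s s01; rewrite !init// addr0.
Unshelve. all: by end_near. Qed.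

Lemma flow_continuous m W G V y0 y (s : R) : @flow_family m W G V y0 y -> 0 <= s <= 1 ->
  forall x, V x -> {for x, continuous (y s)}.
Proof.
move=> F s01 x Vx; have [B B0 BP] := flow_lipschitz F Vx.
apply/continuous_near_le => e e0.
have c0 : {for x, continuous y0} := Ck_continuous (flow_init_smooth F 0) Vx.
have e1 : 0 < e / (B + 1) by rewrite divr_gt0// ltr_wpDl.
near=> z.
have [Vz /(_ s s01) zP] : V z /\ forall s : R, 0 <= s <= 1 ->
    `|y s z - y s x| <= B * `|y0 z - y0 x| by near: z.
rewrite distrC; apply: le_trans zP _.
have : `|y0 x - y0 z| <= e / (B + 1).
  by near: z; move/continuous_near_le : c0; exact.
rewrite distrC => h; apply: le_trans (ler_wpM2l B0 h) _.
by rewrite mulrCA ler_piMr ?ltW// ltr_pdivrMr ?ltr_wpDl// mul1r ltrDl.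
Unshelve. all: by end_near. Qed.

(** The field on pairs (y, w) whose second component is the variational equation w' = DG(y) w along
    y' = G(y). *)
Definition tangent_field m (G : 'rV[R]_m -> 'rV[R]_m) (z : 'rV[R]_(m + m)) : 'rV[R]_(m + m) :=
  row_mx (G (lsubmx z)) ('D_(rsubmx z) G (lsubmx z)).

Lemma open_lsubmx m (W : set 'rV[R]_m) : open W ->
  open [set z : 'rV[R]_(m + m) | W (lsubmx z)].
Proof.
move=> oW; apply: (@open_comp _ _ (lsubmx : 'rV[R]_(m + m) -> 'rV[R]_m)) => // z _.
exact: continuous_lsubmx.
Qed.

Lemma smooth_directional p m W (G : 'rV[R]_m -> 'rV[R]_p) : open W -> smooth_on W G ->
  smooth_on [set z : 'rV[R]_(m + m) | W (lsubmx z)] (fun z => 'D_(rsubmx z) G (lsubmx z)).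
Proof.
move=> oW sG k.
have oW2 := @open_lsubmx m W oW.
have cl := Ck_lsubmx oW2 (Ck_id k oW2).
have cr := Ck_rsubmx oW2 (Ck_id k oW2).
apply/(Ck_mx _ _ oW2) => i j.
apply: (@Ck_eq _ _ _ _ _ (fun z => \sum_l rsubmx z 0 l * 'D_(delta_mx 0 l) G (lsubmx z) i j : R^o)) => //.
  move=> z Wz; have [_ ->] := C1_is_derive_mx (rsubmx z) oW Wz (smooth_C1 sG).
  by rewrite summxE; apply: eq_bigr => l _; rewrite !mxE.
apply: (Ck_sum _ oW2) => l _; apply: (CkM oW2).
  by have /(Ck_mx _ _ oW2) := cr; exact.
have := Ck_comp (f := 'D_(delta_mx 0 l) G) (V := W) oW2 oW (fun z Wz => Wz) (smooth_partial l sG k) cl.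
by move=> /(Ck_mx _ _ oW2); exact.
Qed.

Lemma smooth_tangent_field m W (G : 'rV[R]_m -> 'rV[R]_m) : open W -> smooth_on W G ->
  open [set z : 'rV[R]_(m + m) | W (lsubmx z)] /\
  smooth_on [set z : 'rV[R]_(m + m) | W (lsubmx z)] (tangent_field G).
Proof.
move=> oW sG.
have oW2 := @open_lsubmx m W oW.
split=> // k; apply: (Ck_row_mx oW2); last exact: smooth_directional.
exact: (Ck_comp (f := G) (V := W) oW2 oW (fun z Wz => Wz) (sG k) (Ck_lsubmx oW2 (Ck_id k oW2))).
Qed.

(** The equation is linear with coefficients bounded along the solution, hence globally Lipschitz,
    and [picard] applies. Since y s x is controlled for s in [0, 1] only, the time is clamped. *)
Lemma variational_solution m W G V y0 y x (w0 : 'rV[R]_m) : @flow_family m W G V y0 y -> V x ->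
  exists2 w : R -> 'rV[R]_m, w 0 = w0 & forall s : R, 0 <= s <= 1 ->
    is_derive s 1 w ('D_(w s) G (y s x)).
Proof.
move=> F Vx; have [oW sG oV s0 init ode comp] := F.
have [C [cC convC CW] /nbhs_singleton Cx] := comp x Vx.
have [M M0 MP] := partials_bounded oW cC CW (smooth_C1 sG).
have L0 : 0 <= m%:R * M by rewrite mulr_ge0.
have cy : continuous ((fun t => y t x) \o clamp).
  by apply: clamp_comp_continuous => t /(ode x Vx t)/is_derive_continuous.
pose g (s : R) (w : 'rV[R]_m) : 'rV[R]_m := 'D_w G (y (clamp s) x).
have [w cw s|s u v s01|w w00 dw] := @picard R m g _ w0 L0.
- have Wz : W (lsubmx (row_mx (y (clamp s) x) (w s))).
    by rewrite row_mxKl; apply: CW; apply: Cx; exact: clamp01.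
  have c1 : {for s, continuous (fun s => row_mx (y (clamp s) x) (w s))}.
    apply/continuous_mxP => i j.
    have [j' ->|j' ->] := split_ordP j.
      rewrite (_ : (fun _ => _) = (fun t => y (clamp t) x i j')).
        by move: i j'; apply/continuous_mxP; exact: (cy s).
      by apply/funext => t; rewrite row_mxEl.
    rewrite (_ : (fun _ => _) = (fun t => w t i j')).
      by move: i j'; apply/continuous_mxP; exact: (cw s).
    by apply/funext => t; rewrite row_mxEr.
  have := continuous_comp c1 (Ck_continuous (smooth_directional oW sG 0) Wz).
  suff -> : (fun s => g s (w s)) = ((fun z => 'D_(rsubmx z) G (lsubmx z)) \o
      (fun s => row_mx (y (clamp s) x) (w s))) by exact.
  by apply/funext => t; rewrite /= row_mxKl row_mxKr.
- have Cs := Cx _ (clamp01 s).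
  exact: (derive_lipschitz u v oW (CW _ Cs) (smooth_C1 sG) (MP _ Cs)).
- by exists w => // s s01; have := dw s s01; rewrite /g clamp_id.
Qed.

(* The derivative of a flow family in x, paired with the family itself, is
   again a flow family: this makes an induction on the order of differentiability
   possible. *)
Lemma variational_family m W G V y0 y j : @flow_family m W G V y0 y ->
  exists w : R -> 'rV[R]_n -> 'rV[R]_m,
    flow_family [set z : 'rV[R]_(m + m) | W (lsubmx z)] (tangent_field G) V
      (fun x => row_mx (y0 x) ('D_(delta_mx 0 j) y0 x)) (fun s x => row_mx (y s x) (w s x)).
Proof.
move=> F; have [oW sG oV s0 init ode comp] := F.
have H x : exists w : R -> 'rV[R]_m, V x -> w 0 = 'D_(delta_mx 0 j) y0 x /\
    forall s : R, 0 <= s <= 1 -> is_derive s 1 w ('D_(w s) G (y s x)).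
  have [Vx|nVx] := pselect (V x); last by exists (fun=> 0).
  by have [w w0 dw] := variational_solution ('D_(delta_mx 0 j) y0 x) F Vx; exists w.
have [w wP] := choice H; exists (fun s x => w x s).
have [oW2 sG2] := smooth_tangent_field oW sG.
split=> //.
- by move=> k; apply: (Ck_row_mx oV); [exact: s0|exact: smooth_partial].
- by move=> x Vx; rewrite init// (wP x Vx).1.
- move=> x Vx s s01; rewrite /tangent_field row_mxKl row_mxKr.
  have /is_derive_mx D1 := ode x Vx s s01; have /is_derive_mx D2 := (wP x Vx).2 s s01.
  apply/is_derive_mx => i k; have [k' ->|k' ->] := split_ordP k.
    rewrite row_mxEl (_ : (fun _ => _) = (fun t => y t x i k')); first exact: D1.
    by apply/funext => t; rewrite row_mxEl.
  rewrite row_mxEr (_ : (fun _ => _) = (fun t => w x t i k')); first exact: D2.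
  by apply/funext => t; rewrite row_mxEr.
- move=> x1 Vx1; have [C [cC convC CW] nC] := comp x1 Vx1.
  have [M M0 MP] := partials_bounded oW cC CW (smooth_C1 sG).
  have L0 : 0 <= m%:R * M by rewrite mulr_ge0.
  have [B B0 BP] := @gronwall R m _ L0.
  (* Gronwall bounds the variation by B times its initial value, whose norm near x1 exceeds the one
     at x1 by at most 1. *)
  pose N := B * (`|'D_(delta_mx 0 j) y0 x1| + 1).
  have N0 : 0 <= N by rewrite mulr_ge0// addr_ge0.
  exists [set z : 'rV[R]_(m + m) | C (lsubmx z) /\ `|rsubmx z - 0| <= N].
    split; last by move=> z [/CW].
      exact: (compact_row_mx cC (@closed_ball_compact m 0 N)).
    exact: (convex_row_mx convC (@convex_closed_ball R m 0 N)).
  have c1 : {for x1, continuous ('D_(delta_mx 0 j) y0)}.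
    exact: Ck_continuous (smooth_partial j s0 0) Vx1.
  near=> x => s s01 /=; rewrite row_mxKl row_mxKr subr0.
  have Vx : V x by near: x; exact: open_nbhs_nbhs.
  have Cx : forall s : R, 0 <= s <= 1 -> C (y s x) by near: x.
  split; first exact: Cx.
  have [w0 dw] := wP x Vx.
  have E : forall t : R, 0 <= t <= 1 -> `|'D_(w x t) G (y t x)| <= m%:R * M * `|w x t| + 0.
    move=> t t01; have := derive_lipschitz (w x t) 0 oW (CW _ (Cx t t01)) (smooth_C1 sG) (MP _ (Cx t t01)).
    by rewrite derive0 !subr0 addr0.
  have := BP _ _ 0 (lexx _) dw E s s01; rewrite addr0 w0 => /le_trans; apply.
  rewrite ler_wpM2l//.
  have : `|'D_(delta_mx 0 j) y0 x1 - 'D_(delta_mx 0 j) y0 x| <= 1.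
    by near: x; move/continuous_near_le : c1; exact.
  move=> h; rewrite -[X in `|X|](subKr ('D_(delta_mx 0 j) y0 x1)).
  by apply: le_trans (ler_normB _ _) _; rewrite lerD2l.
Unshelve. all: by end_near. Qed.

End FlowFamilies.

Section FlowSmooth.
Context {R : realType} {n : nat}.

Lemma is_derive_row_mx (V : normedModType R) p q1 q2 (f : V -> 'M[R]_(p, q1 + q2)) x v a b :
  is_derive x v f (row_mx a b) ->
  is_derive x v (fun y => lsubmx (f y)) a /\ is_derive x v (fun y => rsubmx (f y)) b.
Proof.
move=> /is_derive_mx D; split; apply/is_derive_mx => i j.
  have := D i (lshift q2 j); rewrite row_mxEl; congr is_derive.
  by apply/funext => y; rewrite mxE.
have := D i (rshift q1 j); rewrite row_mxEr; congr is_derive.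
by apply/funext => y; rewrite mxE.
Qed.

(** The remainder y(x + h e_j) - y(x) - h w satisfies the variational equation up to the Taylor
    remainder of G, which is O(h^2) because y is Lipschitz in x, and its initial value is o(h).
    Gronwall makes it o(h) at all times. *)
Lemma flow_partial m W G (V : set 'rV[R]_n) y0 y j w : @flow_family R n m W G V y0 y ->
  flow_family [set z : 'rV[R]_(m + m) | W (lsubmx z)] (tangent_field G) V
      (fun x => row_mx (y0 x) ('D_(delta_mx 0 j) y0 x)) (fun s x => row_mx (y s x) (w s x)) ->
  forall x (s : R), V x -> 0 <= s <= 1 -> is_derive x (delta_mx 0 j) (y s) (w s x).
Proof.
move=> F F2 x s Vx s01; have [oW sG oV s0 init ode comp] := F.
have dw (t : R) : 0 <= t <= 1 -> is_derive t 1 (fun t => w t x) ('D_(w t x) G (y t x)).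
  move=> t01; have := flow_ode F2 Vx t01; rewrite /tangent_field row_mxKl row_mxKr.
  move=> /is_derive_row_mx[_]; congr is_derive.
  by apply/funext => r; rewrite row_mxKr.
have w0 : w 0 x = 'D_(delta_mx 0 j) y0 x.
  by have := flow_init F2 Vx => /(congr1 rsubmx); rewrite !row_mxKr.
have [C [cC convC CW] nC] := comp x Vx.
have Cx := nbhs_singleton nC.
have [M M0 MP] := partials_bounded oW cC CW (smooth_C1 sG).
have L0 : 0 <= m%:R * M by rewrite mulr_ge0.
have [B B0 BP] := @gronwall R m _ L0.
have [B1 B10 B1P] := flow_lipschitz F Vx.
have [T T0 TP] := taylor_estimate oW cC convC CW sG.
have dy0 : is_derive x (delta_mx 0 j) y0 ('D_(delta_mx 0 j) y0 x).
  by apply: derivableP; have [_ /(_ j)[+ _]] := s0 1%N; exact.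
set d := 'D_(delta_mx 0 j) y0 x in w0 dy0 *.
move/is_derive_eps in dy0.
pose ej : 'rV[R]_n := delta_mx 0 j.
have line (P : 'rV[R]_n -> Prop) : (\forall z \near x, P z) ->
    \forall h \near (0 : R), P (x + h *: ej).
  move=> nP; have c : {for (0 : R), continuous (fun h : R => x + h *: ej)}.
    by apply: continuousD; [exact: cst_continuous|exact: scalel_continuous].
  by apply: c; rewrite scale0r addr0.
apply/is_derive_eps => e e0.
pose D1 := B1 * (`|d| + 1).
have D10 : 0 <= D1 by rewrite mulr_ge0// addr_ge0.
(* The initial error and the Taylor term may each cost e1 |h|, which after multiplication by B
   totals at most e |h|. The bound e2 on |h| below makes the quadratic term at most e1 |h|. The
   added ones keep the denominators positive. *)
pose e1 := e / 2 / (B + 1).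
have e10 : 0 < e1 by rewrite !divr_gt0// ltr_wpDl.
pose e2 := e1 / (T * D1 ^+ 2 + 1).
have TD0 : 0 <= T * D1 ^+ 2 by rewrite mulr_ge0// sqr_ge0.
have e20 : 0 < e2 by rewrite divr_gt0// ltr_wpDl.
have n1 := line _ nC; have n2 := line _ B1P.
have n3 := dy0 _ e10; have n4 := dy0 1 ltr01.
near=> h.
have h1 : forall t : R, 0 <= t <= 1 -> C (y t (x + h *: ej)) by near: h.
have [Vh h2] : V (x + h *: ej) /\ forall t : R, 0 <= t <= 1 ->
  `|y t (x + h *: ej) - y t x| <= B1 * `|y0 (x + h *: ej) - y0 x| by near: h.
have h3 : `|y0 (x + h *: ej) - y0 x - h *: d| <= e1 * `|h| by near: h.
have h4 : `|y0 (x + h *: ej) - y0 x - h *: d| <= 1 * `|h| by near: h.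
have h5 : `|h| <= e2.
  near: h; apply/nbhs_ballP; exists e2 => //= z; rewrite /ball/= sub0r normrN.
  exact: ltW.
have Dy (t : R) : 0 <= t <= 1 -> `|y t (x + h *: ej) - y t x| <= D1 * `|h|.
  move=> t01; apply: le_trans (h2 t t01) _; rewrite /D1 -mulrA ler_wpM2l//.
  rewrite -(subrK (h *: d) (y0 (x + h *: ej) - y0 x)).
  apply: le_trans (ler_normD _ _) _; rewrite normrZ.
  by apply: le_trans (lerD h4 (lexx _)) _; rewrite mul1r mulrDl mul1r addrC [`|h| * _]mulrC.
pose r (t : R) := y t (x + h *: ej) - y t x - h *: w t x.
pose dr (t : R) := G (y t (x + h *: ej)) - G (y t x) - h *: 'D_(w t x) G (y t x).
have Dr : forall t : R, 0 <= t <= 1 -> is_derive t 1 r (dr t).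
  move=> t t01; apply: is_derive_subf.
    by apply: is_derive_subf; exact: ode.
  exact: (is_deriveZ h (dw t t01)).
have rle : forall t : R, 0 <= t <= 1 -> `|dr t| <= m%:R * M * `|r t| + T * (D1 * `|h|) ^+ 2.
  move=> t t01; have Wt := CW _ (Cx t t01).
  pose De := y t (x + h *: ej) - y t x.
  have lin (u v : 'rV[R]_m) : 'D_(u - h *: v) G (y t x) = 'D_u G (y t x) - h *: 'D_v G (y t x).
    have DE a := @derive_val _ _ _ _ _ _ _ (C1_is_derive a oW Wt (smooth_C1 sG)).
    by rewrite !DE mulmxBl scalemxAl.
  have -> : dr t = 'D_(r t) G (y t x) + (G (y t (x + h *: ej)) - G (y t x) - 'D_De G (y t x)).
    by rewrite /dr /r lin -/De [RHS]addrC [in RHS]addrA subrK.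
  apply: le_trans (ler_normD _ _) _; apply: lerD.
    by have := derive_lipschitz (r t) 0 oW Wt (smooth_C1 sG) (MP _ (Cx t t01)); rewrite derive0 !subr0.
  apply: le_trans (TP _ _ (Cx t t01) (h1 t t01)) _; apply: ler_wpM2l => //.
  by rewrite lerXn2r ?nnegrE ?mulr_ge0// Dy.
have E0 : 0 <= T * (D1 * `|h|) ^+ 2 by rewrite mulr_ge0// sqr_ge0.
have := BP r dr _ E0 Dr rle s s01; rewrite -/ej.
have -> : r 0 = y0 (x + h *: ej) - y0 x - h *: d by rewrite /r !init// w0.
move=> /le_trans; apply.
have h6 : T * (D1 * `|h|) ^+ 2 <= e1 * `|h|.
  have : `|h| * (T * D1 ^+ 2 + 1) <= e1.
    by rewrite -ler_pdivlMr ?ltr_wpDl.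
  by move=> hh; have := normr_ge0 h; nra.
apply: le_trans (ler_wpM2l B0 (lerD h3 h6)) _.
have : B * e1 <= e / 2.
  by rewrite /e1 mulrCA ler_piMr ?divr_ge0 ?ltW// ltr_pdivrMr ?ltr_wpDl// mul1r ltrDl.
by have := normr_ge0 h; nra.
Unshelve. all: by end_near. Qed.

(** The induction on k runs over all dimensions m and all fields at once, because each derivative
    doubles m. *)
Theorem flow_smooth m W G (V : set 'rV[R]_n) y0 y (s : R) :
  @flow_family R n m W G V y0 y -> 0 <= s <= 1 -> smooth_on V (y s).
Proof.
move=> + s01 k; elim: k m W G y0 y => [|k IH] m W G y0 y F.
  by split=> // x Vx; exact: flow_continuous F s01 x Vx.
split=> [x Vx|j]; first exact: flow_continuous F s01 x Vx.
have [w F2] := variational_family j F.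
have D x : V x -> is_derive x (delta_mx 0 j) (y s) (w s x).
  by move=> Vx; exact: flow_partial F F2 x s Vx s01.
split=> [x /D[]//|].
have oV := flow_params_open F.
have C2 := Ck_rsubmx oV (IH _ _ _ _ _ F2).
by apply: (Ck_eq oV _ C2) => x /D[_ ->]; rewrite row_mxKr.
Qed.

Lemma flow_derivative m W G (V : set 'rV[R]_n) y0 y x (v : 'rV[R]_n) :
  @flow_family R n m W G V y0 y -> V x ->
  exists w : R -> 'rV[R]_m, [/\ w 0 = 'D_v y0 x,
    forall s : R, 0 <= s <= 1 -> is_derive s 1 w ('D_(w s) G (y s x)) &
    forall s : R, 0 <= s <= 1 -> is_derive x v (y s) (w s)].
Proof.
move=> F Vx; have [oW sG oV s0 init ode comp] := F.
have H j : exists w : R -> 'rV[R]_m, [/\ w 0 = 'D_(delta_mx 0 j) y0 x,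
    forall s : R, 0 <= s <= 1 -> is_derive s 1 w ('D_(w s) G (y s x)) &
    forall s : R, 0 <= s <= 1 -> is_derive x (delta_mx 0 j) (y s) (w s)].
  have [w F2] := variational_family j F; exists (fun s => w s x); split.
  - by have := flow_init F2 Vx => /(congr1 rsubmx); rewrite !row_mxKr.
  - move=> s s01; have := flow_ode F2 Vx s01; rewrite /tangent_field row_mxKl row_mxKr.
    move=> /is_derive_row_mx[_]; congr is_derive.
    by apply/funext => r; rewrite row_mxKr.
  - by move=> s s01; exact: flow_partial F F2 x s Vx s01.
have [w wP] := choice H.
exists (fun s => \sum_j v 0 j *: w j s); split.
- have [_ ->] := C1_is_derive_mx v oV Vx (smooth_C1 s0).
  by apply: eq_bigr => j _; have [-> _ _] := wP j.
- move=> s s01.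
  have Ws : W (y s x).
    by have [C [_ _ CW] /nbhs_singleton Cx] := comp x Vx; apply: CW; exact: Cx.
  have DE a := @derive_val _ _ _ _ _ _ _ (C1_is_derive a oW Ws (smooth_C1 sG)).
  have D : is_derive s 1 (fun s => \sum_j v 0 j *: w j s) (\sum_j v 0 j *: 'D_(w j s) G (y s x)).
    apply: is_derive_sumf => j; have [_ dw _] := wP j.
    exact: (is_deriveZ (v 0 j) (dw s s01)).
  suff -> : 'D_(\sum_j v 0 j *: w j s) G (y s x) = \sum_j v 0 j *: 'D_(w j s) G (y s x) by exact: D.
  by rewrite DE mulmx_suml; apply: eq_bigr => j _; rewrite DE scalemxAl.
- move=> s s01; have [d D] := C1_is_derive_mx v oV Vx (smooth_C1 (flow_smooth F s01)).
  split=> //; rewrite D; apply: eq_bigr => j _.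
  by have [_ _ /(_ s s01)[_ ->]] := wP j.
Qed.

Lemma variational_unique m W G (V : set 'rV[R]_n) y0 y x (u w : R -> 'rV[R]_m) :
  @flow_family R n m W G V y0 y -> V x -> u 0 = w 0 ->
  (forall s : R, 0 <= s <= 1 -> is_derive s 1 u ('D_(u s) G (y s x))) ->
  (forall s : R, 0 <= s <= 1 -> is_derive s 1 w ('D_(w s) G (y s x))) ->
  forall s : R, 0 <= s <= 1 -> u s = w s.
Proof.
move=> F Vx uw0 du dw s s01; have [oW sG oV s0 init ode comp] := F.
have [C [cC convC CW] /nbhs_singleton Cx] := comp x Vx.
have [M M0 MP] := partials_bounded oW cC CW (smooth_C1 sG).
have L0 : 0 <= m%:R * M by rewrite mulr_ge0.
have [B B0 BP] := @gronwall R m _ L0.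
have D : forall t : R, 0 <= t <= 1 ->
    is_derive t 1 (fun t => u t - w t) ('D_(u t) G (y t x) - 'D_(w t) G (y t x)).
  by move=> t t01; apply: is_derive_subf; [exact: du|exact: dw].
have E : forall t : R, 0 <= t <= 1 ->
    `|'D_(u t) G (y t x) - 'D_(w t) G (y t x)| <= m%:R * M * `|u t - w t| + 0.
  move=> t t01; rewrite addr0.
  exact: derive_lipschitz oW (CW _ (Cx t t01)) (smooth_C1 sG) (MP _ (Cx t t01)).
have := BP _ _ 0 (lexx _) D E s s01.
rewrite uw0 subrr normr0 addr0 mulr0 normr_le0 subr_eq0 => /eqP.
exact.
Qed.

End FlowSmooth.

(** * Frobenius' theorem *)

Section Frobenius.
Context {R : realType}.

Lemma norm_mulmx p q r (A : 'M[R]_(p, q)) (B : 'M[R]_(q, r)) :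
  `|A *m B| <= q%:R * `|A| * `|B|.
Proof.
apply: norm_le_entries => [|i j]; first by rewrite !mulr_ge0.
rewrite mxE; rewrite -mulrA; apply: norm_sum_le => k.
by rewrite normrM ler_pM// entry_le_norm.
Qed.

(** The retraction onto a closed ball of the sup norm; acting on each coordinate separately, it is
    1-Lipschitz. It turns a field that is Lipschitz on the ball into a globally Lipschitz one. *)
Definition clamp_ball n (a : 'rV[R]_n) (r : R) (x : 'rV[R]_n) : 'rV[R]_n :=
  \row_j (a 0 j + Num.max (- r) (Num.min r (x 0 j - a 0 j))).

Lemma clamp_ball_in n (a : 'rV[R]_n) (r : R) x : 0 <= r -> `|clamp_ball a r x - a| <= r.
Proof.
move=> r0; apply: norm_le_entries => // i j; rewrite ord1 !mxE addrAC subrr add0r.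
by rewrite ler_norml le_max lexx/= ge_max ge_min lexx/= andbT; lra.
Qed.

Lemma clamp_ball_id n (a : 'rV[R]_n) (r : R) x : `|x - a| <= r -> clamp_ball a r x = x.
Proof.
move=> xr; apply/rowP => j; rewrite mxE.
have := le_trans (entry_le_norm (x - a) 0 j) xr; rewrite !mxE ler_norml => /andP[h1 h2].
by rewrite (min_idPr h2) (max_idPr h1); ring.
Qed.

Lemma clamp_lipschitz (r s t : R) :
  `|Num.max (- r) (Num.min r s) - Num.max (- r) (Num.min r t)| <= `|s - t|.
Proof.
have lemax a b c : `|Num.max a b - Num.max a c| <= `|b - c| :> R.
  by case: (ger0P (b - c)) => h; rewrite ler_norml; case: (leP a b) => h1;
    case: (leP a c) => h2; apply/andP; split; lra.
apply: le_trans (lemax _ _ _) _.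
by case: (ger0P (s - t)) => h; rewrite ler_norml; case: (leP r s) => h1;
  case: (leP r t) => h2; apply/andP; split; lra.
Qed.

Lemma clamp_ball_lipschitz n (a : 'rV[R]_n) (r : R) x y : 0 <= r ->
  `|clamp_ball a r x - clamp_ball a r y| <= `|x - y|.
Proof.
move=> r0; apply: norm_le_entries => // i j; rewrite ord1 !mxE.
rewrite opprD addrACA subrr add0r; apply: le_trans (clamp_lipschitz _ _ _) _.
have := entry_le_norm (x - y) 0 j; rewrite !mxE.
by rewrite opprB addrA subrK.
Qed.

(** The parameter tau = [lsubmx z] is carried along as a constant component. Thus the equations y' =
    - tau a(y), whose tau depends on the starting point, become a single autonomous equation and fit
    [flow_family]. *)
Definition ray_field n r (a : 'rV[R]_n -> 'M[R]_(r, n)) (z : 'rV[R]_(r + n)) : 'rV[R]_(r + n) :=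
  row_mx 0 (- (lsubmx z *m a (rsubmx z))).

Lemma open_rsubmx n r (O : set 'rV[R]_n) : open O ->
  open [set z : 'rV[R]_(r + n) | O (rsubmx z)].
Proof.
move=> oO; apply: (@open_comp _ _ (rsubmx : 'rV[R]_(r + n) -> 'rV[R]_n)) => // z _.
exact: continuous_rsubmx.
Qed.

Lemma CkN n p q k U (f : 'rV[R]_n -> 'M[R]_(p, q)) : open U -> Ck k U f ->
  Ck k U (fun x => - f x).
Proof.
move=> oU F; apply: (Ck_eq oU _ (CkZ (-1) oU F)) => x _; exact: scaleN1r.
Qed.

Lemma smooth_ray_field n r O (a : 'rV[R]_n -> 'M[R]_(r, n)) : open O -> smooth_on O a ->
  smooth_on [set z : 'rV[R]_(r + n) | O (rsubmx z)] (ray_field a).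
Proof.
move=> oO sa k; have oW := @open_rsubmx n r O oO.
apply: (Ck_row_mx oW); first exact: Ck_cst.
apply: (CkN oW); apply: (CkMmx oW); first exact: (Ck_lsubmx oW (Ck_id k oW)).
exact: (Ck_comp (f := a) oW oO (fun z Wz => Wz) (sa k) (Ck_rsubmx oW (Ck_id k oW))).
Qed.

(** The field is retracted to a closed ball inside O and solved by [picard]. Solutions that start
    close enough to x0 do not leave the ball before time 1, so the retraction drops out. *)
Lemma ray_family n r O (a : 'rV[R]_n -> 'M[R]_(r, n)) (D : 'M[R]_(n, r)) x0 :
  open O -> O x0 -> smooth_on O a ->
  exists (V : set 'rV[R]_n) (z : R -> 'rV[R]_n -> 'rV[R]_(r + n)), [/\ V x0, V `<=` O &
    flow_family [set z : 'rV[R]_(r + n) | O (rsubmx z)] (ray_field a) V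
      (fun x => row_mx ((x - x0) *m D) x) z].
Proof.
move=> oO Ox0 sa.
have [rho rho0 rhoO] : exists2 rho : R, 0 < rho & [set x | `|x - x0| <= rho] `<=` O.
  have /nbhs_ballP[e /= e0 eO] := open_nbhs_nbhs (conj oO Ox0).
  exists (e / 2); first by rewrite divr_gt0.
  move=> x /= xe; apply: eO; rewrite -ball_normE/= distrC; apply: le_lt_trans xe _.
  by rewrite ltr_pdivrMr// mulr_natr mulr2n ltrDl.
pose C := [set x : 'rV[R]_n | `|x - x0| <= rho].
have cC : compact C by exact: closed_ball_compact.
have convC : convex_set C by exact: convex_closed_ball.
have [A A0 AP] := compact_sub_bounded oO cC rhoO (fun x Ox => Ck_continuous (sa 0) Ox).
have [M M0 MP] := partials_bounded oO cC rhoO (smooth_C1 sa).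
pose kD := n%:R * `|D|.
have kD0 : 0 <= kD by rewrite mulr_ge0.
have tauP x : `|(x - x0) *m D| <= kD * `|x - x0|.
  by apply: le_trans (norm_mulmx _ _) _; rewrite mulrAC.
(* Chosen so that delta + r kD delta A = rho: the initial distance to x0 plus a bound on the speed,
   over unit time, is the radius of the ball. *)
pose delta := rho / (1 + r%:R * kD * A).
have den0 : 0 <= r%:R * kD * A by rewrite !mulr_ge0.
have delta0 : 0 < delta by rewrite divr_gt0// ltr_wpDr.
pose V := [set x : 'rV[R]_n | `|x - x0| < delta].
have pi := @clamp_ball_in n x0 rho _ (ltW rho0).
pose g (tau : 'rV[R]_r) (s : R) (y : 'rV[R]_n) : 'rV[R]_n := - (tau *m a (clamp_ball x0 rho y)).
have sol x : exists y : R -> 'rV[R]_n, y 0 = x /\ forall s : R, 0 <= s <= 1 ->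
    is_derive s 1 y (g ((x - x0) *m D) s (y s)).
  set tau := (x - x0) *m D.
  have [|y cy s|s u v s01|y y0 dy] := @picard R n (g tau) (r%:R * `|tau| * (n%:R * M)) x.
  - by rewrite !mulr_ge0.
  - have c1 : {for s, continuous (fun s => clamp_ball x0 rho (y s))}.
      apply/continuous_near_le => e e0; have /continuous_near_le/(_ e e0) := cy s.
      by apply: filterS => t; apply: le_trans; exact: clamp_ball_lipschitz (ltW rho0).
    have c2 := Ck_continuous (CkN oO (CkMmx oO (Ck_cst 0 O tau) (sa 0))) (rhoO _ (pi (y s))).
    exact: (continuous_comp c1 c2).
  - rewrite /g -opprD normrN -mulmxBr; apply: le_trans (norm_mulmx _ _) _.
    rewrite -[leRHS]mulrA ler_wpM2l ?mulr_ge0//.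
    apply: le_trans (mvt_convex oO rhoO convC (smooth_C1 sa) M0 MP (pi v) (pi u)) _.
    by rewrite ler_wpM2l ?mulr_ge0//; exact: clamp_ball_lipschitz (ltW rho0).
  - by exists y.
have [y yP] := choice sol.
have yC x (s : R) : V x -> 0 <= s <= 1 -> C (y x s).
  move=> Vx s01; have [y0 dy] := yP x.
  pose B := r%:R * (kD * delta) * A.
  have D1 : forall t : R, 0 <= t <= 1 -> is_derive t 1 (fun t => y x t - x0)
      (g ((x - x0) *m D) t (y x t) - 0).
    move=> t t01; exact: (is_derive_subf (dy t t01) (is_derive_cstf x0 t 1)).
  have D2 : forall t : R, 0 <= t <= 1 -> is_derive t 1 (fun t : R => delta + B * t) (0 + B).
    move=> t _; exact: (is_derive_addf (is_derive_cstf delta t 1) (is_derive_scale B t)).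
  have B0 : 0 <= B.
    by apply: mulr_ge0 => //; apply: mulr_ge0 => //; apply: mulr_ge0 => //; exact: ltW.
  apply: (@le_trans _ _ (delta + B * s)).
    apply: (comparison D1 D2 _ _ s01); last by rewrite y0 mulr0 addr0; exact: ltW.
    move=> t t01; rewrite subr0 add0r /g normrN; apply: le_trans (norm_mulmx _ _) _.
    apply: ler_pM; [by apply: mulr_ge0|exact: normr_ge0| |exact: AP _ (pi _)].
    rewrite ler_wpM2l//; apply: le_trans (tauP x) _.
    by rewrite ler_wpM2l// ltW.
  have -> : rho = delta + B.
    rewrite /B (_ : r%:R * (kD * delta) * A = delta * (r%:R * kD * A)); last by ring.
    by rewrite -{1}[delta]mulr1 -mulrDr /delta divfK// gt_eqF// ltr_wpDr.
  by rewrite lerD2l ler_piMr//; case/andP: s01.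
exists V, (fun s x => row_mx ((x - x0) *m D) (y x s)).
have oV : open V.
  have -> : V = (fun x : 'rV[R]_n => `|x - x0| : R) @^-1` [set t | t < delta] by [].
  apply: open_comp; last exact: open_lt.
  move=> x _; apply: continuous_comp; last exact: norm_continuous.
  by apply: continuousB; [exact: cvg_id|exact: cst_continuous].
have VO : V `<=` O by move=> x Vx; apply: rhoO; have := yC x 0 Vx; rewrite (yP x).1 lexx ler01; exact.
split => //; first by rewrite /V/= subrr normr0.
split.
- exact: open_rsubmx.
- exact: smooth_ray_field.
- exact: oV.
- move=> k; apply: (Ck_row_mx oV); last exact: Ck_id.
  apply: (CkMmx oV); last exact: Ck_cst.
  exact: (CkD oV (Ck_id k oV) (Ck_cst k V (- x0))).
- by move=> x Vx; rewrite (yP x).1.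
- move=> x Vx s s01; rewrite /ray_field row_mxKl row_mxKr.
  have /is_derive_mx D1 := (yP x).2 s s01; apply/is_derive_mx => i j.
  have [j' ->|j' ->] := split_ordP j.
    rewrite row_mxEl mxE (_ : (fun _ => _) = (fun=> ((x - x0) *m D) i j')); first exact: is_derive_cstf.
    by apply/funext => t; rewrite row_mxEl.
  rewrite row_mxEr (_ : (fun _ => _) = (fun t => y x t i j')).
    by have := D1 i j'; rewrite /g clamp_ball_id//; exact: yC.
  by apply/funext => t; rewrite row_mxEr.
- move=> x1 Vx1.
  exists [set z : 'rV[R]_(r + n) | [set t | `|t - 0| <= kD * delta] (lsubmx z) /\ C (rsubmx z)].
    split; last by move=> z [_ /rhoO].
      exact: (compact_row_mx (@closed_ball_compact R r 0 _) cC).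
    exact: (convex_row_mx (@convex_closed_ball R r 0 _) convC).
  have := open_nbhs_nbhs (conj oV Vx1); apply: filterS => x Vx s s01 /=.
  rewrite row_mxKl row_mxKr subr0; split; last exact: yC.
  by apply: le_trans (tauP x) _; rewrite ler_wpM2l// ltW.
Qed.

End Frobenius.

Section FrobeniusTheorem.
Context {R : realType}.

Lemma is_derive_ray_field n r O (a : 'rV[R]_n -> 'M[R]_(r, n)) (z u : 'rV[R]_(r + n)) :
  open O -> O (rsubmx z) -> smooth_on O a ->
  'D_u (ray_field a) z =
  row_mx 0 (- (lsubmx u *m a (rsubmx z) + lsubmx z *m 'D_(rsubmx u) a (rsubmx z))).
Proof.
move=> oO Oz sa.
have D0 : is_derive z u (fun z : 'rV[R]_(r + n) => z) (row_mx (lsubmx u) (rsubmx u)).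
  by rewrite hsubmxK; exact: is_derive_id.
have [Dl Dr] := is_derive_row_mx D0.
have /is_derive_mx D := is_derive_mulmx Dl (is_derive_comp oO Oz (smooth_C1 sa) Dr).
apply: (@derive_val _ _ _ _ _ _ _ _); apply/is_derive_mx => i j.
have [j' ->|j' ->] := split_ordP j.
  rewrite row_mxEl mxE (_ : (fun _ => _) = (fun=> 0)); first exact: is_derive_cstf.
  by apply/funext => t; rewrite row_mxEl mxE.
rewrite row_mxEr mxE.
rewrite (_ : (fun _ => _) = (fun z => - ((lsubmx z *m a (rsubmx z)) i j'))).
  exact: (is_deriveN (D i j')).
by apply/funext => t; rewrite row_mxEr mxE.
Qed.

Lemma near_neq0 (T : topologicalType) (f : T -> R^o) x :
  {for x, continuous f} -> f x != 0 -> \forall y \near x, f y != 0.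
Proof.
move=> /continuous_near_le cf fx.
have e0 : 0 < `|f x| / 2 by rewrite divr_gt0// normr_gt0.
apply: filterS (cf _ e0) => y; apply: contraTneq => ->.
by rewrite subr0 -ltNge ltr_pdivrMr// mulr_natr mulr2n ltrDl normr_gt0.
Qed.

(* The rows of [a x] span the distribution, are normalized by D and hence commute;
   f x is the point where the curve y' = - (x - x0) D a(y) starting at x, which
   stays in a leaf, meets at time 1 the transversal y D = x0 D, on which D'
   gives coordinates. Differentiating the curve along a vector
   s *m a x yields (1 - t) *: (s *m a (y t)) by uniqueness for the variational
   equation, so f is constant on the leaves. *)
Theorem frobenius n r c O (a : 'rV[R]_n -> 'M[R]_(r, n)) (D : 'M[R]_(n, r))
    (D' : 'M[R]_(n, c)) (N : 'M[R]_(c, n)) x0 :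
  open O -> O x0 -> smooth_on O a -> N *m D = 0 -> N *m D' = 1%:M ->
  (forall x, O x -> a x *m D = 1%:M) ->
  (forall x (s t : 'rV[R]_r), O x ->
     s *m 'D_(t *m a x) a x = t *m 'D_(s *m a x) a x) ->
  exists (U : set 'rV[R]_n) (f : 'rV[R]_n -> 'rV[R]_c),
    [/\ open U, U x0, U `<=` O, smooth_on U f & forall x, U x ->
      a x *m 'J f x = 0 /\ \det (N *m 'J f x) != 0].
Proof.
move=> oO Ox0 sa ND ND' aD comm.
have [V [z [Vx0 VO F]]] := ray_family D oO Ox0 sa.
have [oW sG oV s0 init ode comp] := F.
have one01 : 0 <= (1 : R) <= 1 by rewrite ler01 lexx.
have sz1 : smooth_on V (z 1) := flow_smooth F one01.
pose f (x : 'rV[R]_n) : 'rV[R]_c := rsubmx (z 1 x) *m D'.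
have sf : smooth_on V f.
  by move=> k; apply: (CkMmx oV (Ck_rsubmx oV (sz1 k)) (Ck_cst k V D')).
have zW x (s : R) : V x -> 0 <= s <= 1 -> O (rsubmx (z s x)).
  by move=> Vx s01; have [C [_ _ CW] /nbhs_singleton Cx] := comp x Vx; exact: (CW _ (Cx s s01)).
have Dy0 x (v : 'rV[R]_n) : V x -> 'D_v (fun x => row_mx ((x - x0) *m D) x) x = row_mx (v *m D) v.
  move=> Vx.
  have D1 := is_derive_mulmx (is_derive_subf (is_derive_id x v) (is_derive_cstf x0 x v)) (is_derive_cstf D x v).
  rewrite subr0 mulmx0 addr0 in D1.
  apply: (@derive_val _ _ _ _ _ _ _ _); apply/is_derive_mx => i j.
  have [j' ->|j' ->] := split_ordP j.
    rewrite row_mxEl; have /is_derive_mx/(_ i j') := D1; congr is_derive.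
    by apply/funext => t; rewrite row_mxEl.
  rewrite row_mxEr; have /is_derive_mx/(_ i j') := is_derive_id x v; congr is_derive.
  by apply/funext => t; rewrite row_mxEr.
have zl x (s : R) : V x -> 0 <= s <= 1 -> lsubmx (z s x) = (x - x0) *m D.
  move=> Vx s01; apply/eqP; rewrite -subr_eq0 -normr_le0.
  have D1 : forall t : R, 0 <= t <= 1 ->
      is_derive t 1 (fun t => lsubmx (z t x) - (x - x0) *m D) (0 - 0).
    move=> t t01; have [Dl _] := is_derive_row_mx (ode x Vx t t01).
    exact: (is_derive_subf Dl (is_derive_cstf ((x - x0) *m D) t 1)).
  apply: (@comparison R r _ _ (fun=> 0) (fun=> 0) D1 (fun t _ => is_derive_cstf (0 : R) t 1) _ _ s s01).
    by move=> t _; rewrite subrr normr0.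
  by rewrite init// row_mxKl subrr normr0.
have Jf x (v w : 'rV[R]_n) : V x -> is_derive x v (z 1) (row_mx (v *m D) w) ->
    v *m 'J f x = w *m D'.
  move=> Vx /is_derive_row_mx[_].
  move=> Dr; have D1 := is_derive_mulmx Dr (is_derive_cstf D' x v).
  rewrite mulmx0 addr0 in D1.
  have [_ <-] := C1_is_derive v oV Vx (smooth_C1 sf).
  by have [_ ->] := D1.
have kill x : V x -> a x *m 'J f x = 0.
  move=> Vx; apply/row_matrixP => i; rewrite row_mul row0 rowE.
  set s := delta_mx 0 i; set v := s *m a x.
  have vD : v *m D = s by rewrite /v -mulmxA aD ?mulmx1//; exact: VO.
  have [w [w0 dw wz]] := flow_derivative v F Vx.
  pose u (t : R) := row_mx s ((1 - t) *: (s *m a (rsubmx (z t x)))) : 'rV[R]_(r + n).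
  have uw : u 0 = w 0.
    rewrite w0 Dy0// vD /u subr0 scale1r init// row_mxKr.
    by [].
  have du : forall t : R, 0 <= t <= 1 -> is_derive t 1 u ('D_(u t) (ray_field a) (z t x)).
    move=> t t01; rewrite (is_derive_ray_field _ oO (zW _ _ Vx t01) sa).
    rewrite /u row_mxKl row_mxKr zl//; set tau := (x - x0) *m D.
    set y := rsubmx (z t x).
    have [_ Dr] := is_derive_row_mx (ode x Vx t t01); rewrite zl// -/tau -/y in Dr.
    have Oy : O y := zW _ _ Vx t01.
    have Da := is_derive_comp (g := fun t => rsubmx (z t x)) oO Oy (smooth_C1 sa) Dr.
    have Dsa := is_derive_mulmx (is_derive_cstf s t 1) Da.
    rewrite mul0mx add0r in Dsa.
    have D1t := is_derive_subf (is_derive_cstf (1 : R) t 1) (is_derive_id t (1 : R)).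
    apply/is_derive_mx => p j; have [j' ->|j' ->] := split_ordP j.
      rewrite row_mxEl mxE (_ : (fun _ => _) = (fun=> s p j')); first exact: is_derive_cstf.
      by apply/funext => q; rewrite /u row_mxEl.
    have /is_derive_mx/(_ p j') Dsap := Dsa.
    have := is_derive_mulf D1t Dsap.
    have E : (fun q => u q p (rshift r j')) = (fun q => (1 - q) * (s *m a (rsubmx (z q x))) p j').
      by apply/funext => q; rewrite /u row_mxEr mxE.
    rewrite row_mxEr E /=.
    congr is_derive.
    have DE b : 'D_b a y = \sum_l b 0 l *: 'D_(delta_mx 0 l) a y.
      by have [_ ->] := C1_is_derive_mx b oO Oy (smooth_C1 sa).
    have DN b : 'D_(- b) a y = - 'D_b a y.
      by rewrite !DE -sumrN; apply: eq_bigr => l _; rewrite mxE scaleNr.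
    have DZ k b : 'D_(k *: b) a y = k *: 'D_b a y.
      by rewrite !DE scaler_sumr; apply: eq_bigr => l _; rewrite mxE scalerA.
    (* The derivative of u contains s times the derivative of a along tau a, whereas the variational
       equation has tau times the derivative of a along s a; [comm] identifies the two. *)
    rewrite DN DZ mulmxN comm// -scalemxAr /comp -/y !mxE sub0r.
    by ring.
  have := variational_unique F Vx uw du dw one01; rewrite /u subrr scale0r => w1.
  have D1 := wz 1 one01; rewrite -w1 in D1.
  rewrite -(mul0mx _ D'); apply: Jf => //; rewrite vD; exact: D1.
(* At x0 the parameter tau vanishes. For a row v of N, which D kills, the constant pair (0, v)
   therefore solves the variational equation, so the derivative of the end point along v is v
   itself. *)
have NJ : N *m 'J f x0 = 1%:M.
  rewrite -ND'; apply/row_matrixP => i; rewrite !row_mul.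
  set v := row i N; have vD : v *m D = 0 by rewrite /v -row_mul ND row0.
  have [w [w0 dw wz]] := flow_derivative v F Vx0.
  pose u (t : R) := row_mx 0 v : 'rV[R]_(r + n).
  have uw : u 0 = w 0 by rewrite w0 Dy0// vD.
  have du : forall t : R, 0 <= t <= 1 -> is_derive t 1 u ('D_(u t) (ray_field a) (z t x0)).
    move=> t t01; rewrite (is_derive_ray_field _ oO (zW _ _ Vx0 t01) sa).
    rewrite /u row_mxKl row_mxKr zl// subrr !mul0mx addr0 oppr0 row_mx0.
    exact: is_derive_cstf.
  have w1 := variational_unique F Vx0 uw du dw one01.
  have D1 := wz 1 one01; rewrite -w1 /u in D1.
  by apply: Jf => //; rewrite vD.
have cJ : {for x0, continuous (fun x => \det (N *m 'J f x) : R^o)}.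
  exact: Ck_continuous (Ck_det oV (CkMmx oV (Ck_cst 0 V N) (smooth_jacobian oV sf 0))) Vx0.
have nJ : \forall x \near x0, \det (N *m 'J f x) != 0.
  by apply: (near_neq0 cJ); rewrite NJ det1 oner_neq0.
have /nbhs_ballP[e /= e0 eP] : \forall x \near x0, V x /\ \det (N *m 'J f x) != 0.
  by apply: filterI => //; exact: open_nbhs_nbhs.
have oB : open (ball x0 e) by exact: ball_open.
exists (ball x0 e), f; split => //.
- exact: ballxx.
- by move=> x /eP[/VO].
- by move=> k; apply: Ck_sub (sf k) => x /eP[].
- by move=> x /eP[Vx dx]; split => //; exact: kill.
Qed.

End FrobeniusTheorem.

(** * Forms in a frame adapted to the orbit *)

Section WedgeDeterminant.
Context {R : realType}.

Definition block_perms k l : {set 'S_(k + l)} :=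
  [set t : 'S_(k + l) | [forall i : 'I_(k + l), (i < k)%N == (t i < k)%N]].

(** A permutation preserving the two blocks is a pair in S_k x S_l. Their number is the normalizing
    factor of [wedge], which it cancels in [wedge_det]. *)
Lemma card_block_perms k l : #|block_perms k l| = (k`! * l`!)%N.
Proof.
pose F (st : 'S_k * 'S_l) (i : 'I_(k + l)) : 'I_(k + l) :=
  match fintype.split i with inl a => lshift l (st.1 a) | inr b => rshift k (st.2 b) end.
have Fl st a : F st (lshift l a) = lshift l (st.1 a) by rewrite /F (unsplitK (inl a)).
have Fr st b : F st (rshift k b) = rshift k (st.2 b) by rewrite /F (unsplitK (inr b)).
have Finj st : injective (F st).
  move=> i j; have [a ->|a ->] := split_ordP i; have [b ->|b ->] := split_ordP j;
    rewrite ?Fl ?Fr => /eqP; rewrite ?eq_lshift ?eq_rshift ?eq_lrshift ?eq_rlshift//.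
    by move=> /eqP/perm_inj ->.
  by move=> /eqP/perm_inj ->.
pose G st : 'S_(k + l) := perm (Finj st).
have Ginj : injective G.
  move=> [s1 t1] [s2 t2] E; congr pair; apply/permP => a.
    have := congr1 (fun u : 'S_(k + l) => u (lshift l a)) E; rewrite !permE !Fl => /eqP.
    by rewrite eq_lshift => /eqP.
  have := congr1 (fun u : 'S_(k + l) => u (rshift k a)) E; rewrite !permE !Fr => /eqP.
  by rewrite eq_rshift => /eqP.
rewrite -(card_Sn k) -(card_Sn l) -card_prod -(card_imset _ Ginj).
apply: eq_card => t; apply/idP/imsetP => [|[[s u] _ ->]]; last first.
  rewrite inE; apply/forallP => i; rewrite permE.
  by have [a ->|a ->] := split_ordP i; rewrite ?Fl ?Fr /= ?ltn_ord// !ltnNge !leq_addr.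
rewrite inE => /forallP tP.
have tl a : exists a', t (lshift l a) = lshift l a'.
  have := tP (lshift l a); rewrite /= ltn_ord eq_sym eqb_id.
  by have [a' ->|b ->] := split_ordP (t (lshift l a)); [exists a'|].
have tr b : exists b', t (rshift k b) = rshift k b'.
  have := tP (rshift k b); rewrite /= ltnNge leq_addr/=.
  by have [a' ->|b' ->] := split_ordP (t (rshift k b)); [|exists b'].
have [f fP] := choice tl; have [g gP] := choice tr.
have fi : injective f.
  by move=> a b E; apply: (@lshift_inj k l); apply: (@perm_inj _ t); rewrite !fP E.
have gi : injective g.
  by move=> a b E; apply: (@rshift_inj k l); apply: (@perm_inj _ t); rewrite !gP E.
exists (perm fi, perm gi) => //; apply/permP => i; rewrite permE.
by have [a ->|a ->] := split_ordP i; rewrite ?Fl ?Fr ?fP ?gP /= permE.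
Qed.

(* Laplace expansion along the first k columns, in the form of a sum over all
   permutations of the rows. *)
Lemma wedge_det n k l (P : 'M[R]_(n, k)) (Q : 'M[R]_(n, l)) :
  wedge (fun A : 'M[R]_(k, n) => \det (A *m P)) (fun A : 'M[R]_(l, n) => \det (A *m Q)) =
  fun A : 'M[R]_(k + l, n) => \det (A *m row_mx P Q).
Proof.
apply/funext => A; rewrite /wedge.
pose Z := A *m row_mx P Q.
pose same (i j : 'I_(k + l)) := (i < k)%N == (j < k)%N.
(* The product of the two determinants is the determinant of a block diagonal matrix, to which only
   block-preserving permutations contribute. *)
have E (s : 'S_(k + l)) : \det (usubmx (row_perm s A) *m P) * \det (dsubmx (row_perm s A) *m Q) =
    \sum_(t in block_perms k l) (-1) ^+ t * \prod_i Z (s i) (t i).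
  rewrite -(@det_ublock _ _ _ _ 0).
  rewrite /determinant (bigID (mem (block_perms k l)))/= addrC big1 ?add0r => [|t].
    apply: eq_bigr => t; rewrite inE => /forallP tP; congr (_ * _).
    apply: eq_bigr => i _; have := tP i; rewrite /Z mul_mx_row.
    have [a ->|a ->] := split_ordP i.
            have [b ->|b ->] := split_ordP (t (lshift l a)) => [_|//].
      rewrite block_mxEul row_mxEl !mxE; apply: eq_bigr => j _; by rewrite !mxE.
    have [b ->|b ->] := split_ordP (t (rshift k a)) => [//|_].
    rewrite block_mxEdr row_mxEr !mxE; apply: eq_bigr => j _; by rewrite !mxE.
  rewrite inE => /forallPn[i]; move=> tP; rewrite (bigD1 i)//=.
  move: tP; have [a ->|a ->] := split_ordP i.
        have [b ->|b ->] := split_ordP (t (lshift l a)) => [//|_].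
    by rewrite block_mxEur mxE mul0r mulr0.
  have [b ->|b ->] := split_ordP (t (rshift k a)) => [_|//].
  by rewrite block_mxEdl mxE mul0r mulr0.
under eq_bigr do rewrite E mulr_sumr.
rewrite exchange_big/=.
(* For each fixed t, the substitution of t s^-1 for s turns the sum into the full determinant of Z;
   hence all block-preserving t contribute equally. *)
have D (t : 'S_(k + l)) : \sum_(s : 'S_(k + l)) (-1) ^+ s * ((-1) ^+ t * \prod_i Z (s i) (t i)) = \det Z.
  rewrite (reindex_inj (h := fun s => (t * s^-1)%g)); last first.
    by move=> s1 s2 /mulgI/invg_inj.
  apply: eq_bigr => s _.
  rewrite (reindex_inj (h := fun i => (s * t^-1)%g i)); last exact: perm_inj.
  rewrite mulrA -signr_addb; congr ((-1) ^+ _ * _).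
    by rewrite odd_permM odd_permV addbC addbA addbb.
  apply: eq_bigr => i _; congr (Z _ _).
    by rewrite -permM mulgA mulgKV mulgV perm1.
  by rewrite -permM mulgKV.
under eq_bigr do rewrite D.
by rewrite sumr_const card_block_perms -[X in _ * X]mulr_natl mulKf.
Qed.

Lemma wedgeDl n k l (a b : kform R n k) (c : kform R n l) A :
  wedge (fun B => a B + b B) c A = wedge a c A + wedge b c A.
Proof.
by rewrite /wedge -mulrDr -big_split/=; congr (_ * _); apply: eq_bigr => s _; rewrite mulrDl mulrDr.
Qed.

Lemma wedgeDr n k l (a : kform R n k) (b c : kform R n l) A :
  wedge a (fun B => b B + c B) A = wedge a b A + wedge a c A.
Proof.
by rewrite /wedge -mulrDr -big_split/=; congr (_ * _); apply: eq_bigr => s _; rewrite !mulrDr.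
Qed.

Lemma wedgeZl n k l (x : R) (a : kform R n k) (c : kform R n l) A :
  wedge (fun B => x * a B) c A = x * wedge a c A.
Proof.
rewrite /wedge [RHS]mulrCA; congr (_ * _); rewrite mulr_sumr.
by apply: eq_bigr => s _; rewrite -mulrA [RHS]mulrCA.
Qed.

Lemma wedgeZr n k l (x : R) (a : kform R n k) (c : kform R n l) A :
  wedge a (fun B => x * c B) A = x * wedge a c A.
Proof.
rewrite /wedge [RHS]mulrCA; congr (_ * _); rewrite mulr_sumr.
by apply: eq_bigr => s _; rewrite [a _ * (x * _)]mulrCA [LHS]mulrCA.
Qed.

End WedgeDeterminant.

Section ColumnForms.
Context {R : realType} {n : nat}.
Implicit Types (E : 'M[R]_n) (s t : seq nat).

Definition colsel k s : 'M[R]_(n, k) := \matrix_(i, j) ((i : nat) == nth 0%N s j)%:R.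

(* The columns of E being covectors e^0, ..., e^(n-1), this is the wedge
   product of the e^i for i ranging over s. *)
Definition colform E k s : kform R n k := fun A => \det (A *m (E *m colsel k s)).

Arguments colform E k s A : clear implicits.

(** Forms with constant coefficients in the frame are encoded as lists of terms, so that wedge
    products and contractions become list operations carried out by simplification. *)
Definition lincomb E k (L : seq (R * seq nat)) : kform R n k :=
  fun A => \sum_(p <- L) p.1 * colform E k p.2 A.

Arguments lincomb E k L A : clear implicits.

Lemma colsel_cat k l s t : size s = k ->
  row_mx (colsel k s) (colsel l t) = colsel (k + l) (s ++ t).
Proof.
move=> sk; apply/matrixP => i j; have [a ->|a ->] := split_ordP j.
  by rewrite row_mxEl !mxE nth_cat sk /= ltn_ord.
by rewrite row_mxEr !mxE nth_cat sk /= ltnNge leq_addr/= addKn.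
Qed.

Lemma wedge_colform E k l s t : size s = k ->
  wedge (colform E k s) (colform E l t) = colform E (k + l) (s ++ t).
Proof.
by move=> sk; rewrite /colform wedge_det -mul_mx_row colsel_cat.
Qed.

Lemma wedge_lincomb E k l L L' : all (fun p => size p.2 == k) L ->
  wedge (lincomb E k L) (lincomb E l L') =
  lincomb E (k + l) [seq (p.1 * q.1, p.2 ++ q.2) | p <- L, q <- L'].
Proof.
move=> Lk; apply/funext => A; rewrite /lincomb big_allpairs_dep/=.
elim: L Lk => [|p L IH] /=.
  rewrite big_nil => _; rewrite /wedge big1 ?mulr0// => s _.
  by rewrite big_nil mul0r mulr0.
move=> /andP[/eqP pk /IH {}IH]; rewrite big_cons -IH.
rewrite (_ : (fun B => _) = (fun B => p.1 * colform E k p.2 B + \sum_(p <- L) p.1 * colform E k p.2 B)); last first.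
  by apply/funext => B; rewrite big_cons.
rewrite wedgeDl wedgeZl; congr (_ + _).
elim: L' {IH} => [|q L' IH].
  rewrite big_nil /wedge big1 ?mulr0// => s _.
  by rewrite big_nil !mulr0.
rewrite big_cons -IH.
rewrite (_ : (fun B => _) = (fun B => q.1 * colform E l q.2 B + \sum_(p <- L') p.1 * colform E l p.2 B)); last first.
  by apply/funext => B; rewrite big_cons.
by rewrite wedgeDr wedgeZr wedge_colform// mulrDr mulrA.
Qed.

Definition del (j : nat) s := take j s ++ drop j.+1 s.

Lemma interior_colform E k (v : 'rV[R]_n) s A : size s = k.+1 -> all (fun i => i < n)%N s ->
  interior_prod (k := k) v (colform E (1 + k) s) A =
  \sum_(j < k.+1) (-1) ^+ j * (v *m E *m colsel 1 [:: nth 0%N s j]) 0 0 * colform E k (del j s) A.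
Proof.
move=> sk sn; rewrite /interior_prod /colform (expand_det_row _ 0).
apply: eq_bigr => j _; rewrite /cofactor add0n mulrCA -mulrA [in RHS]mulrCA -[RHS]mulrCA.
congr (_ * (_ * _)).
  have E0 (B : 'M[R]_(1, 1 + k)) (C : 'M[R]_(k, 1 + k)) : col_mx B C 0 j = B 0 j.
    by rewrite -[RHS](col_mxEu B C); congr (col_mx B C _ _); exact: val_inj.
  rewrite mul_col_mx E0 mulmxA !mxE; apply: eq_bigr => i _; congr (_ * _).
  by rewrite !mxE.
congr (\det _); apply/matrixP => a b; rewrite mul_col_mx 2![in LHS]mxE.
have E1 (B : 'M[R]_(1, 1 + k)) (C : 'M[R]_(k, 1 + k)) c : col_mx B C (lift 0 a) c = C a c.
  by rewrite -[RHS](col_mxEd B C); congr (col_mx B C _ _); exact: val_inj.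
rewrite E1.
rewrite !mxE; apply: eq_bigr => i _; congr (_ * _); rewrite !mxE.
apply: eq_bigr => i' _; congr (_ * _); rewrite !mxE; congr (_ == _)%:R.
rewrite /del nth_cat size_take sk ltn_ord /= /bump.
case: leqP => jb; first by rewrite nth_drop addSn subnKC.
by rewrite nth_take.
Qed.

Lemma interior_lincomb E k (v : 'rV[R]_n) L A :
  all (fun p => (size p.2 == k.+1) && all (fun i => i < n)%N p.2) L ->
  interior_prod (k := k) v (lincomb E (1 + k) L) A =
  lincomb E k [seq (p.1 * ((-1) ^+ j * (v *m E *m colsel 1 [:: nth 0%N p.2 j]) 0 0), del j p.2)
    | p <- L, j <- iota 0 k.+1] A.
Proof.
move=> Lk; rewrite /lincomb big_allpairs_dep/= /interior_prod big_seq [RHS]big_seq.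
apply: eq_bigr => p /(allP Lk)/andP[/eqP pk pn].
have := interior_colform E v A pk pn; rewrite /interior_prod => ->.
rewrite mulr_sumr -(big_mkord predT (fun j => p.1 * ((-1) ^+ j *
  (v *m E *m colsel 1 [:: nth 0%N p.2 j]) 0 0 * colform E k (del j p.2) A))).
by rewrite /index_iota subn0; apply: eq_big => // j _; exact: mulrA.
Qed.

Lemma colform_swap E k p a b s A : size (p ++ a :: b :: s) = k ->
  colform E k (p ++ a :: b :: s) A = - colform E k (p ++ b :: a :: s) A.
Proof.
rewrite size_cat /= => sk.
have i1 : (size p < k)%N by rewrite -sk -addSnnS leq_addr.
have i2 : ((size p).+1 < k)%N by rewrite -sk -!addSnnS leq_addr.
pose i := Ordinal i1; pose j := Ordinal i2.
have E1 : colsel k (p ++ a :: b :: s) = col_perm (tperm i j) (colsel k (p ++ b :: a :: s)).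
  apply/matrixP => r c; rewrite !mxE; congr (_ == _)%:R; rewrite !nth_cat.
  case: tpermP => [->|->|/eqP ci /eqP cj] /=.
  - by rewrite ltnn subnn ltnNge leqnSn /= subSnn.
  - by rewrite ltnn subnn ltnNge leqnSn /= subSnn.
  - case: ltnP => // pc; rewrite -!val_eqE /= in ci cj.
    have : (c - size p)%N = (c - size p - 2).+2.
      have h1 : (size p < c)%N by rewrite ltn_neqAle eq_sym ci.
      have h2 : ((size p).+1 < c)%N by rewrite ltn_neqAle eq_sym cj.
      by rewrite -addn2 subnK// ltn_subRL addn1.
    by move=> ->.
rewrite /colform E1 col_permE !mulmxA det_mulmx det_perm odd_permV odd_tperm.
have -> : i != j by rewrite -val_eqE /= neq_ltn ltnSn.
by rewrite mulrN1.
Qed.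

Lemma colform_dup E k s A : size s = k -> ~~ uniq s -> colform E k s A = 0.
Proof.
move=> sk /(uniqPn 0%N)[i [j [ij js e]]].
rewrite sk in js; rewrite /colform -det_tr.
apply: (@determinant_alternate _ _ _ (Ordinal (ltn_trans ij js)) (Ordinal js)).
  by rewrite -val_eqE /= ltn_eqF.
move=> r; rewrite !mxE; apply: eq_bigr => c _; congr (_ * _).
by rewrite !mxE; apply: eq_bigr => d _; rewrite !mxE /= e.
Qed.

(** With [sort_sign], an insertion sort that also records the parity of the transpositions made, by
    which a wedge of covectors changes sign. *)
Fixpoint insert_sign a s : bool * seq nat :=
  match s with
  | [::] => (false, [:: a])
  | b :: t => if (a <= b)%N then (false, a :: s)
              else let r := insert_sign a t in (~~ r.1, b :: r.2)
  end.

Fixpoint sort_sign s : bool * seq nat :=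
  match s with
  | [::] => (false, [::])
  | a :: t => let r := sort_sign t in let q := insert_sign a r.2 in (r.1 (+) q.1, q.2)
  end.

Lemma size_insert a s : size (insert_sign a s).2 = (size s).+1.
Proof. by elim: s => //= b t IH; case: ifP => //= _; rewrite IH. Qed.

Lemma size_sort s : size (sort_sign s).2 = size s.
Proof. by elim: s => //= a t IH; rewrite size_insert IH. Qed.

Lemma colform_insert E k p a s A : size (p ++ a :: s) = k ->
  colform E k (p ++ a :: s) A = (-1) ^+ (insert_sign a s).1 * colform E k (p ++ (insert_sign a s).2) A.
Proof.
elim: s p => [|b t IH] p sk /=; first by rewrite mul1r.
case: ifP => _ /=; first by rewrite mul1r.
rewrite colform_swap// -cat_rcons IH; last by rewrite cat_rcons -sk !size_cat.
by rewrite cat_rcons; case: (insert_sign a t).1; rewrite /= ?expr0 ?expr1 ?mulN1r ?mul1r ?opprK.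
Qed.

Lemma colform_sort E k p s A : size (p ++ s) = k ->
  colform E k (p ++ s) A = (-1) ^+ (sort_sign s).1 * colform E k (p ++ (sort_sign s).2) A.
Proof.
elim: s p => [|a t IH] p sk /=; first by rewrite mul1r.
rewrite -cat_rcons IH; last by rewrite cat_rcons.
rewrite cat_rcons colform_insert; last by rewrite -sk !size_cat /= size_sort.
by rewrite mulrA -signr_addb.
Qed.

Definition normal_term (p : R * seq nat) : R * seq nat :=
  (if uniq p.2 then (if (sort_sign p.2).1 then - p.1 else p.1) else 0, (sort_sign p.2).2).

(** After this normalization equal basis forms are syntactically equal, so that [ring] can collect
    their coefficients. *)
Lemma lincomb_normal E k L A : all (fun p => size p.2 == k) L ->
  lincomb E k L A = lincomb E k (map normal_term L) A.
Proof.
move=> Lk; rewrite /lincomb big_map big_seq [RHS]big_seq.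
apply: eq_bigr => p /(allP Lk)/eqP pk; rewrite /normal_term /=.
case: ifPn => u; last by rewrite colform_dup// mulr0 mul0r.
rewrite (@colform_sort E k [::])//=.
by case: (sort_sign p.2).1; rewrite ?expr0 ?expr1 ?mulN1r ?mul1r ?mulNr ?mulrN.
Qed.

End ColumnForms.
Arguments colform {R n} E k s A.
Arguments lincomb {R n} E k L A.

(** * The normal form of omega, phi and K at a point *)

Section OrbitFrame.
Context {R : realType}.
Implicit Types (w : kform R 6 2) (f : kform R 6 3) (E K : 'M[R]_6).

Definition crd E (i : nat) (x : 'rV[R]_6) : R := (x *m E *m colsel 1 [:: i]) 0 0.

Lemma colform1 E i (x : 'rV[R]_6) : colform E 1 [:: i] x = crd E i x.
Proof. by rewrite /colform /crd [LHS](@det_mx11 R) mulmxA. Qed.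

Lemma crdE E i (x : 'rV[R]_6) (hi : (i < 6)%N) : crd E i x = (x *m E) 0 (Ordinal hi).
Proof.
rewrite /crd mxE (bigD1 (Ordinal hi))//= big1 => [|j ji].
  by rewrite addr0 [X in _ * X]mxE eqxx mulr1.
by rewrite [X in _ * X]mxE /= -(val_eqE j (Ordinal hi)) /= in ji *; rewrite (negPf ji) mulr0.
Qed.

Lemma crd_inj E x : E \in unitmx -> (forall i, (i < 6)%N -> crd E i x = 0) -> x = 0.
Proof.
move=> uE h; rewrite -[x](mulmxK uE) (_ : x *m E = 0) ?mul0mx//.
apply/rowP => i; rewrite [RHS]mxE -(h i (ltn_ord i)) (crdE _ _ (ltn_ord i)).
by congr ((x *m E) 0 _); apply: val_inj.
Qed.

Lemma crdD E i x y : crd E i (x + y) = crd E i x + crd E i y.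
Proof. by rewrite /crd !mulmxDl mxE. Qed.

Lemma crdZ E i k x : crd E i (k *: x) = k * crd E i x.
Proof. by rewrite /crd -!scalemxAl mxE. Qed.

Lemma covec_colform E k : (k.-1 < 6)%N -> covec E k = colform E 1 [:: k.-1].
Proof.
move=> k6; apply/funext => x; rewrite colform1 (crdE _ _ k6) /covec.
by congr ((x *m E) 0 _); apply: val_inj; rewrite /= inordK.
Qed.

(* Here the covectors are numbered from 0: e^k is column k - 1 of E. *)
Definition omega_terms : seq (R * seq nat) :=
  [:: (1, [:: 0%N; 1%N]); (1, [:: 2%N; 3%N]); (1, [:: 4%N; 5%N])].
Definition phi_terms : seq (R * seq nat) :=
  [:: (1, [:: 0%N; 3%N; 5%N]); (1, [:: 1%N; 2%N; 5%N]); (1, [:: 1%N; 3%N; 4%N])].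

Definition orbit_frame w f E :=
  [/\ E \in unitmx, w = lincomb E 2 omega_terms & f = lincomb E 3 phi_terms].

Lemma orbit_frame_ex w f : orbit_O0plus w f -> exists E, orbit_frame w f E.
Proof.
move=> [E uE [wE fE]]; exists E; split=> //.
  rewrite wE /covec2 !covec_colform// !wedge_colform//.
  by apply/funext => A; rewrite /lincomb !big_cons big_nil !mul1r addr0 addrA.
rewrite fE /covec3 /covec2 !covec_colform// !wedge_colform//.
by apply/funext => A; rewrite /lincomb !big_cons big_nil !mul1r addr0 addrA.
Qed.

Lemma orbit_frame_change w f E C : C \in unitmx -> orbit_frame w f E ->
  orbit_frame (fun A => w (A *m C)) (fun A => f (A *m C)) (C *m E).
Proof.
move=> uC [uE -> ->]; split; first by rewrite unitmx_mul uC.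
  by apply/funext => A; apply: eq_bigr => p _; rewrite /colform !mulmxA.
by apply/funext => A; apply: eq_bigr => p _; rewrite /colform !mulmxA.
Qed.

Lemma colform_iota E A : colform E 6 (iota 0 6) A = \det (A *m E).
Proof.
rewrite /colform (_ : colsel 6 (iota 0 6) = 1%:M) ?mulmx1//.
by apply/matrixP => i j; rewrite !mxE nth_iota.
Qed.

(** Of the 27 products in omega^3, the 6 without repeated index all sort to e^012345 with sign +,
    and 3! divides them out. *)
Lemma liouville_frame w f E : orbit_frame w f E ->
  liouville w = lincomb E 6 [:: (1, iota 0 6)].
Proof.
move=> [uE -> _]; apply/funext => A; rewrite /liouville.
rewrite !wedge_lincomb// lincomb_normal//=.
rewrite /lincomb !big_cons !big_nil /=; set x := colform E 6 _ A.
by rewrite (_ : (3`!)%:R = 6 :> R)//; field.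
Qed.

Definition K0 : 'M[R]_6 := \matrix_(i, j) (if odd i && (j.+1 == i) then - 2 else 0).

Definition frame_K E := E *m K0 *m invmx E.

Lemma crd_K E x i : E \in unitmx -> (i < 6)%N ->
  crd E i (x *m frame_K E) = if odd i then 0 else - 2 * crd E i.+1 x.
Proof.
move=> uE i6; rewrite /frame_K (crdE _ _ i6) !mulmxA mulmxKV// mxE.
case: ifPn => oi.
  apply: big1 => j _; rewrite [X in _ * X]mxE /=; case: ifP => [/andP[oj /eqP ij]|_]; last by rewrite mulr0.
  by move: oj; rewrite -ij /= oi.
have i16 : (i.+1 < 6)%N by move: i i6 oi => [|[|[|[|[|[|]]]]]].
rewrite (bigD1 (Ordinal i16))//= big1 => [|j ji].
  by rewrite [X in _ * X]mxE /= oi eqxx addr0 (crdE _ _ i16) mulrC.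
rewrite [X in _ * X]mxE /= ; case: ifP => [/andP[oj /eqP ij]|_]; last by rewrite mulr0.
by move: ji; rewrite -val_eqE /= -ij eqxx.
Qed.

(** Both sides are expanded into lists of terms and sorted. What remains is a comparison of
    coefficients of 5-forms, linear in the coordinates of v. *)
Lemma K_spec_frame w f E : orbit_frame w f E -> K_spec w f (frame_K E).
Proof.
move=> F v; have [uE wE fE] := F; apply/funext => A.
rewrite (liouville_frame F).
have -> : interior_prod (k := 2) v f = lincomb E 2
    [seq (p.1 * ((-1) ^+ j * crd E (nth 0%N p.2 j) v), del j p.2) | p <- phi_terms, j <- iota 0 3].
  by apply/funext => B; rewrite fE (@interior_lincomb _ _ E 2).
rewrite fE wedge_lincomb// (@interior_lincomb _ _ E 5)//.
rewrite -/(crd _ _ _).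
rewrite [RHS](congr1 -%R (lincomb_normal _ _ _))// [LHS]lincomb_normal//.
rewrite /lincomb /= !big_cons !big_nil /=.
rewrite -!/(crd _ _ _) !crd_K//=.
by rewrite !expr0 !expr1 !exprS !expr0; ring.
Qed.

End OrbitFrame.

Section PointwiseGeometry.
Context {R : realType}.
Implicit Types (w : kform R 6 2) (f : kform R 6 3) (E K : 'M[R]_6).

Lemma det_col_mx_row' n (u : 'rV[R]_(1 + n)) (k : 'I_(1 + n)) :
  \det (col_mx u (row' k (1%:M : 'M[R]_(1 + n)))) = (-1) ^+ k * u 0 k.
Proof.
have E0 j (C : 'M[R]_(n, 1 + n)) : col_mx u C 0 j = u 0 j.
  by rewrite -[RHS](col_mxEu u C); congr (col_mx u C _ _); exact: val_inj.
have E1 (C : 'M[R]_(n, 1 + n)) a c : col_mx u C (lift 0 a) c = C a c.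
  by rewrite -[RHS](col_mxEd u C); congr (col_mx u C _ _); exact: val_inj.
rewrite (expand_det_col _ k) big_ord_recl big1 => [|i _]; last first.
  by rewrite E1 !mxE eq_sym (negPf (neq_lift _ _)) mul0r.
rewrite addr0 E0 /cofactor add0n.
have -> : row' 0 (col' k (col_mx u (row' k 1%:M))) = 1%:M :> 'M[R]_n.
  apply/matrixP => a b; rewrite 2![LHS]mxE E1 !mxE.
  by rewrite (inj_eq lift_inj).
by rewrite det1 mulr1 mulrC.
Qed.

Lemma liouville_det w f E A : orbit_frame w f E -> liouville w A = \det (A *m E).
Proof.
move=> F; rewrite (liouville_frame F) /lincomb big_cons big_nil addr0 mul1r.
exact: colform_iota.
Qed.

(** Evaluated on all standard basis vectors except the k-th, the volume form contracted with a row
    of K leaves its k-th coordinate, up to sign and a nonzero constant. The right side does not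
    mention K or E, which gives the uniqueness of K and later its smoothness. *)
Lemma K_spec_entry w f E K (a k : 'I_6) : orbit_frame w f E -> K_spec w f K ->
  K a k = (-1) ^+ k * (- wedge (interior_prod (k := 2) (delta_mx 0 a) f) f (row' k (1%:M : 'M[R]_6)))
    / liouville w 1%:M.
Proof.
move=> F KS; have [uE _ _] := F.
have := KS (delta_mx 0 a) => /(congr1 (fun g => g (row' k (1%:M : 'M[R]_6)))) <-.
rewrite /interior_prod !(liouville_det _ F) det_mulmx mul1mx mulrA mulfK; last first.
  by rewrite -unitfE -unitmxE.
by rewrite (@det_col_mx_row' 5) mulrA -expr2 sqrr_sign mul1r -rowE mxE.
Qed.

Lemma K_spec_unique w f E K K' : orbit_frame w f E -> K_spec w f K -> K_spec w f K' -> K = K'.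
Proof.
by move=> F KS KS'; apply/matrixP => a k; rewrite (K_spec_entry _ _ F KS) (K_spec_entry _ _ F KS').
Qed.

Lemma Kmap_spec w f E : orbit_frame w f E -> K_spec w f (Kmap w f).
Proof.
move=> F; have := K_spec_frame F => H.
by apply: (xgetPex 0 (P := [set K | K_spec w f K])); exists (frame_K E).
Qed.

Lemma Kmap_frame w f E : orbit_frame w f E -> Kmap w f = frame_K E.
Proof. by move=> F; apply: (K_spec_unique F (Kmap_spec F) (K_spec_frame F)). Qed.

Lemma Kmap_change w f E C : C \in unitmx -> orbit_frame w f E ->
  Kmap (fun A => w (A *m C)) (fun A => f (A *m C)) = C *m Kmap w f *m invmx C.
Proof.
move=> uC F; have [uE _ _] := F.
rewrite (Kmap_frame F) (Kmap_frame (orbit_frame_change uC F)) /frame_K.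
have -> : invmx (C *m E) = invmx E *m invmx C.
  by apply: (can_inj (mulKmx (_ : C *m E \in unitmx))); rewrite ?unitmx_mul ?uC// mulmxV ?unitmx_mul ?uC// mulmxA mulmxK// mulmxV.
by rewrite !mulmxA.
Qed.

Definition eval3 f (x y z : 'rV[R]_6) : R := f (col_mx x (col_mx y z) : 'M[R]_(1 + 2, 6)).

Lemma eval2_colform E a b (x y : 'rV[R]_6) : (a < 6)%N -> (b < 6)%N ->
  eval2 (colform E 2 [:: a; b]) x y = crd E a x * crd E b y - crd E b x * crd E a y.
Proof.
move=> a6 b6; have := @interior_colform R 6 E 1 x [:: a; b] y erefl.
rewrite /= a6 b6 => /(_ isT); rewrite /interior_prod /eval2 => ->.
rewrite !big_ord_recl big_ord0 /= -!/(crd _ _ _) !colform1.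
by rewrite expr0 expr1; ring.
Qed.

Lemma eval3_colform E a b c (x y z : 'rV[R]_6) : (a < 6)%N -> (b < 6)%N -> (c < 6)%N ->
  eval3 (colform E 3 [:: a; b; c]) x y z =
  crd E a x * (crd E b y * crd E c z - crd E c y * crd E b z)
  - crd E b x * (crd E a y * crd E c z - crd E c y * crd E a z)
  + crd E c x * (crd E a y * crd E b z - crd E b y * crd E a z).
Proof.
move=> a6 b6 c6; have := @interior_colform R 6 E 2 x [:: a; b; c] (col_mx y z) erefl.
rewrite /= a6 b6 c6 => /(_ isT); rewrite /interior_prod /eval3 => ->.
rewrite !big_ord_recl big_ord0 /= -!/(crd _ _ _).
have E2 s t : (s < 6)%N -> (t < 6)%N -> colform E 2 [:: s; t] (col_mx y z) =
  crd E s y * crd E t z - crd E t y * crd E s z by exact: eval2_colform.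
rewrite !E2// /bump /= !expr0 !expr1 exprS expr1.
by ring.
Qed.

Lemma omega_crd w f E (x y : 'rV[R]_6) : orbit_frame w f E -> eval2 w x y =
  (crd E 0 x * crd E 1 y - crd E 1 x * crd E 0 y) +
  (crd E 2 x * crd E 3 y - crd E 3 x * crd E 2 y) +
  (crd E 4 x * crd E 5 y - crd E 5 x * crd E 4 y).
Proof.
move=> [_ -> _]; rewrite -!eval2_colform// /eval2 /lincomb !big_cons big_nil /=.
by rewrite !mul1r addr0 addrA.
Qed.

Lemma phi_crd w f E (x y z : 'rV[R]_6) : orbit_frame w f E -> eval3 f x y z =
  eval3 (colform E 3 [:: 0%N; 3%N; 5%N]) x y z +
  eval3 (colform E 3 [:: 1%N; 2%N; 5%N]) x y z +
  eval3 (colform E 3 [:: 1%N; 3%N; 4%N]) x y z.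
Proof.
move=> [_ _ ->]; rewrite /eval3 /lincomb !big_cons big_nil /=.
by rewrite !mul1r addr0 addrA.
Qed.

Lemma Fform_eval3 w f x y z : eval3 (Fform w f) x y z = - 2 * eval3 f (x *m Kmap w f) y z.
Proof.
rewrite /eval3 /Fform; congr (_ * f _).
by rewrite (col_mxKu x (col_mx y z)) (col_mxKd x (col_mx y z)).
Qed.

Lemma Fform_frame w f E A : orbit_frame w f E ->
  Fform w f A = 4 * colform E 3 [:: 1%N; 3%N; 5%N] A.
Proof.
move=> F; have [uE _ _] := F.
pose A1 : 'M[R]_(1 + 2, 6) := A; pose A2 : 'M[R]_(1 + 1, 6) := dsubmx A1.
pose x := usubmx A1; pose y := usubmx A2; pose z := dsubmx A2.
have -> : A = col_mx x (col_mx y z) by rewrite /x /y /z !vsubmxK.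
rewrite -[LHS]/(eval3 (Fform w f) x y z) -[colform _ _ _ _]/(eval3 (colform E 3 _) x y z) Fform_eval3 (phi_crd _ _ _ F).
rewrite (Kmap_frame F) !eval3_colform// !crd_K//=.
by ring.
Qed.

End PointwiseGeometry.

Section OrbitConsequences.
Context {R : realType}.
Implicit Types (w : kform R 6 2) (f : kform R 6 3) (E K : 'M[R]_6).

Lemma matrix_eq_crd E (A B : 'M[R]_6) : E \in unitmx ->
  (forall x i, (i < 6)%N -> crd E i (x *m A) = crd E i (x *m B)) -> A = B.
Proof.
move=> uE h; apply/row_matrixP => r; rewrite !rowE; apply/eqP; rewrite -subr_eq0; apply/eqP.
apply: (crd_inj uE) => i i6; rewrite -[X in _ + X]scaleN1r crdD crdZ h// mulN1r subrr.
by [].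
Qed.

(** The shift in the direction opposite to [K0]; the factor -1/2 is inverse to the -2 there, so that
    K0 K1 + K1 K0 = 1. *)
Definition K1 : 'M[R]_6 := \matrix_(i, j) (if odd j && (i.+1 == j) then - 2^-1 else 0).

(* [frame_S E] squares to zero, and its sum with K is an involution. *)
Definition frame_S E := E *m K1 *m invmx E.

Lemma crd_S E x i : E \in unitmx -> (i < 6)%N ->
  crd E i (x *m frame_S E) = if odd i then - 2^-1 * crd E i.-1 x else 0.
Proof.
move=> uE i6; rewrite /frame_S (crdE _ _ i6) !mulmxA mulmxKV// mxE.
case: ifPn => oi; last first.
  by apply: big1 => j _; rewrite [X in _ * X]mxE /= (negPf oi) mulr0.
have i16 : (i.-1 < 6)%N by exact: leq_ltn_trans (leq_pred i) i6.
have i0 : (0 < i)%N by case: i oi {i6 i16}.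
rewrite (bigD1 (Ordinal i16))//= big1 => [|j ji].
  by rewrite [X in _ * X]mxE /= oi prednK// eqxx addr0 (crdE _ _ i16) mulrC.
rewrite [X in _ * X]mxE /= ; case: ifP => [/andP[_ /eqP ij]|_]; last by rewrite mulr0.
by move: ji; rewrite -val_eqE /= -ij eqxx.
Qed.

Section Frame.
Context {w f E} (F : orbit_frame w f E).
Let uE : E \in unitmx. Proof. by case: F. Qed.
Let K := Kmap w f.
Let KE : K = frame_K E. Proof. exact: Kmap_frame F. Qed.

Lemma Kmap_sq : K *m K = 0.
Proof.
apply: (matrix_eq_crd uE) => x i i6; rewrite mulmxA KE crd_K// mulmx0.
have -> : crd E i 0 = 0 by rewrite /crd !mul0mx mxE.
case: ifPn => // oi.
have i16 : (i.+1 < 6)%N by move: i i6 oi => [|[|[|[|[|[|]]]]]].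
by rewrite crd_K//= oi mulr0.
Qed.

Lemma frame_S_sq : frame_S E *m frame_S E = 0.
Proof.
apply: (matrix_eq_crd uE) => x i i6; rewrite mulmxA crd_S// mulmx0.
have -> : crd E i 0 = 0 by rewrite /crd !mul0mx mxE.
case: ifPn => // oi; rewrite crd_S//; last exact: leq_ltn_trans (leq_pred i) i6.
by case: i oi {i6} => //= i oi; rewrite (negPf oi) mulr0.
Qed.

Lemma KS_SK : K *m frame_S E + frame_S E *m K = 1%:M.
Proof.
apply: (matrix_eq_crd uE) => x i i6; rewrite mulmxDr (mulmxA x K) (mulmxA x (frame_S E)) crdD KE mulmx1.
rewrite crd_S// [X in _ + X]crd_K//.
case: ifPn => oi.
  rewrite addr0 crd_K//; last exact: leq_ltn_trans (leq_pred i) i6.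
  by case: i oi i6 => //= i oi i6; rewrite (negPf oi); field.
have i16 : (i.+1 < 6)%N by move: i i6 oi => [|[|[|[|[|[|]]]]]].
by rewrite add0r crd_S//= oi; field.
Qed.

Lemma Kmap_S_unit : K + frame_S E \in unitmx.
Proof.
suff H : (K + frame_S E) *m (K + frame_S E) = 1%:M by have [] := mulmx1_unit H.
by rewrite mulmxDl !mulmxDr Kmap_sq frame_S_sq add0r addr0 KS_SK.
Qed.

(** If u K = 0, then u = u (K S + S K) = (u S) K. *)
Lemma ker_K_sub (u : 'rV[R]_6) : u *m K = 0 -> (u <= K)%MS.
Proof.
move=> uK; apply/submxP; exists (u *m frame_S E).
by rewrite -[LHS]mulmx1 -KS_SK mulmxDr (mulmxA u K) uK mul0mx add0r mulmxA.
Qed.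

Lemma kermx_K : (kermx K == K)%MS.
Proof.
apply/andP; split; last by apply/sub_kermxP; exact: Kmap_sq.
by apply/row_subP => i; apply: ker_K_sub; apply/sub_kermxP; exact: row_sub.
Qed.

(** Kernel and image coincide, so the rank r satisfies 6 - r = r. *)
Lemma rank_K : \rank K = 3%N.
Proof.
have := eqmx_rank kermx_K; rewrite mxrank_ker.
by have := rank_leq_row K; lia.
Qed.

(** The projection onto TM/L in coordinates: with indices from 1 these are e^2, e^4, e^6, whose
    common kernel is ker K. Statements about TM/L become statements about R^3 through this
    matrix. *)
Definition odd_part : 'M[R]_(6, 3) := E *m colsel 3 [:: 1%N; 3%N; 5%N].

Lemma odd_partE (u : 'rV[R]_6) (j : 'I_3) : (u *m odd_part) 0 j = crd E (j.*2.+1) u.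
Proof.
rewrite /odd_part /crd mulmxA !mxE; apply: eq_bigr => i _; congr (_ * _); rewrite !mxE.
by case: j => [[|[|[|]]]].
Qed.

Lemma ker_odd_part (u : 'rV[R]_6) : (u <= kermx K)%MS <-> u *m odd_part = 0.
Proof.
split=> [/sub_kermxP uK|uS].
  apply/rowP => j; rewrite odd_partE [RHS]mxE.
  have j6 : (j.*2 < 6)%N by case: j => [[|[|[|]]]].
  have := crd_K u uE j6; rewrite -KE uK odd_double {1}/crd !mul0mx mxE.
  by move=> /eqP; rewrite eq_sym mulf_eq0 oppr_eq0 pnatr_eq0/= => /eqP.
apply/sub_kermxP; apply: (crd_inj uE) => i i6; rewrite KE crd_K//.
case: ifPn => // oi.
have j3 : (i./2 < 3)%N by move: i i6 oi => [|[|[|[|[|[|]]]]]].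
have := odd_partE u (Ordinal j3); rewrite uS mxE /=.
by rewrite (even_halfK oi) => <-; rewrite mulr0.
Qed.

Lemma odd_part_section : exists T : 'M[R]_(3, 6), T *m odd_part = 1%:M.
Proof.
exists ((colsel 3 [:: 1%N; 3%N; 5%N])^T *m invmx E); rewrite /odd_part mulmxA mulmxKV//.
apply/matrixP => i j; rewrite !mxE.
rewrite !big_ord_recl big_ord0 !mxE /=.
by case: i => [[|[|[|]]]] // ?; case: j => [[|[|[|]]]] // ?; rewrite /= /bump /=; ring.
Qed.

Lemma q_odd_part (u v : 'rV[R]_6) :
  eval2 w u (v *m K) = 2 * (u *m odd_part *m (v *m odd_part)^T) 0 0.
Proof.
rewrite (omega_crd _ _ F) KE !crd_K//= mxE.
under eq_bigr do rewrite [X in _ * X]mxE !odd_partE.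
by rewrite !big_ord_recl big_ord0 /= /bump /=; ring.
Qed.

Lemma Fform_odd_part A : Fform w f A = 4 * \det (A *m odd_part).
Proof. by rewrite (Fform_frame _ F). Qed.

Definition bvec (i : 'I_6) : 'rV[R]_6 := delta_mx 0 i *m invmx E.

Lemma crd_bvec (j : nat) (i : 'I_6) : (j < 6)%N -> crd E j (bvec i) = (i == j :> nat)%:R.
Proof. by move=> j6; rewrite (crdE _ _ j6) /bvec mulmxKV// mxE eqxx /= eq_sym. Qed.

Lemma lagrangian_K : lagrangian w (kermx K).
Proof.
move=> u; split=> [/ker_odd_part uS v /ker_odd_part vS|h].
  have ue (x : 'rV[R]_6) (j : 'I_3) : x *m odd_part = 0 -> crd E (j.*2.+1) x = 0.
    by move=> xS; rewrite -odd_partE xS mxE.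
  rewrite (omega_crd _ _ F).
  have := ue u 0 uS; have := ue u 1 uS; have := ue u (inord 2) uS.
  have := ue v 0 vS; have := ue v 1 vS; have := ue v (inord 2) vS.
  by rewrite !inordK//= => -> -> -> -> -> ->; rewrite !mulr0 !mul0r !subrr !addr0.
apply/ker_odd_part; apply/rowP => j; rewrite odd_partE [RHS]mxE.
have j6 : (j.*2 < 6)%N by case: j => [[|[|[|]]]].
(* Pairing u with this vector of L, of even index 2j, reads off the coordinate of u of index 2j + 1
   up to sign. *)
have bK : (bvec (Ordinal j6) <= kermx K)%MS.
  apply/ker_odd_part; apply/rowP => i; rewrite odd_partE crd_bvec ?mxE /=.
    by rewrite -[in RHS](mulr0n (1 : R)); congr (_%:R); case: i => [[|[|[|]]]] //; case: j {j6} => [[|[|[|]]]].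
  by case: i => [[|[|[|]]]].
have := h _ bK; rewrite (omega_crd _ _ F) !crd_bvec//=.
by case: j j6 bK => [[|[|[|]]]] //= ? ? ? ?; lra.
Qed.

Lemma phi_K_K x y z : eval3 f (x *m K) (y *m K) z = 0.
Proof. by rewrite (phi_crd _ _ _ F) KE !eval3_colform// !crd_K//=; ring. Qed.

Lemma Fform_K x y z : eval3 (Fform w f) (x *m K) y z = 0.
Proof. by rewrite Fform_eval3 -mulmxA Kmap_sq mulmx0 (phi_crd _ _ _ F) !eval3_colform// /crd !mul0mx !mxE; ring. Qed.

Lemma phi_swap12 x y z : eval3 f x y z = - eval3 f y x z.
Proof. by rewrite !(phi_crd _ _ _ F) !eval3_colform//; ring. Qed.

Lemma phi_swap23 x y z : eval3 f x y z = - eval3 f x z y.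
Proof. by rewrite !(phi_crd _ _ _ F) !eval3_colform//; ring. Qed.

Lemma phi_linear1 k x x' y z : eval3 f (k *: x + x') y z = k * eval3 f x y z + eval3 f x' y z.
Proof. by rewrite !(phi_crd _ _ _ F) !eval3_colform// !crdD !crdZ; ring. Qed.

Lemma phi_nondegenerate x : (forall y z, eval3 f x y z = 0) -> x = 0.
Proof.
move=> h; apply: (crd_inj uE) => i i6.
have H (a b : 'I_6) := h (bvec a) (bvec b).
have {}H (a b : 'I_6) := etrans (esym (phi_crd x (bvec a) (bvec b) F)) (H a b).
have o i (hi : (i < 6)%N) : 'I_6 := Ordinal hi.
(* For each of these six pairs of basis vectors, exactly one term of phi survives and leaves one
   coordinate of x up to sign; all six coordinates occur. *)
have := H (@Ordinal 6 3 isT) (@Ordinal 6 5 isT); have := H (@Ordinal 6 2 isT) (@Ordinal 6 5 isT).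
have := H (@Ordinal 6 1 isT) (@Ordinal 6 5 isT); have := H (@Ordinal 6 0 isT) (@Ordinal 6 5 isT).
have := H (@Ordinal 6 1 isT) (@Ordinal 6 3 isT); have := H (@Ordinal 6 0 isT) (@Ordinal 6 3 isT).
rewrite !eval3_colform// !crd_bvec//=.
move=> h1 h2 h3 h4 h5 h6; move: i i6 => [|[|[|[|[|[|]]]]]] // _; lra.
Qed.

Lemma Fform_nondegenerate x : (forall y z, eval3 (Fform w f) x y z = 0) -> x *m K = 0.
Proof.
move=> h; apply/sub_kermxP/ker_odd_part; apply/rowP => j; rewrite odd_partE [RHS]mxE.
have H (a b : 'I_6) : 4 * eval3 (colform E 3 [:: 1%N; 3%N; 5%N]) x (bvec a) (bvec b) = 0.
  by rewrite -(h (bvec a) (bvec b)) /eval3 (Fform_frame _ F).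
have := H (@Ordinal 6 3 isT) (@Ordinal 6 5 isT); have := H (@Ordinal 6 1 isT) (@Ordinal 6 5 isT).
have := H (@Ordinal 6 1 isT) (@Ordinal 6 3 isT).
rewrite !eval3_colform// !crd_bvec//=.
by move=> h1 h2 h3; case: j => [[|[|[|]]]] //= _; lra.
Qed.

Lemma Fform_det A B (P : 'M[R]_3) : (forall i, (row i (A - P *m B) <= kermx K)%MS) ->
  Fform w f A = \det P * Fform w f B.
Proof.
move=> h; rewrite !Fform_odd_part mulrCA -det_mulmx (mulmxA P B); congr (_ * \det _).
apply/eqP; rewrite -subr_eq0 -mulmxBl; apply/eqP/row_matrixP => i.
by rewrite row_mul row0; apply/ker_odd_part; exact: h.
Qed.

(** F is 4 times the determinant of the classes of the rows in TM/L, identified with R^3 by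
    [odd_part]. *)
Lemma Fform_basis A : basis_mod 1%:M (kermx K) A <-> Fform w f A != 0.
Proof.
have [T TS] := odd_part_section.
rewrite Fform_odd_part mulf_eq0 pnatr_eq0/= -unitfE -unitmxE.
split=> [[AK _]|uA].
  have /andP[_ sub] := AK.
  have /sub_addsmxP[[X Y] /= E1] := submx_trans (submx1 T) sub.
  have YS : Y *m kermx K *m odd_part = 0.
    apply/row_matrixP => i; rewrite row_mul row0; apply/ker_odd_part.
    by rewrite row_mul; exact: submxMl.
  have : X *m (A *m odd_part) = 1%:M by rewrite -TS E1 mulmxDl YS addr0 (mulmxA X A).
  by move=> /mulmx1_unit[].
split; last by rewrite mxrank1 mxrank_ker rank_K.
apply/andP; split; first exact: submx1.
apply/row_subP => i; set u := row i _.
pose c := u *m odd_part *m invmx (A *m odd_part).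
rewrite -[u](subrK (c *m A)) addrC; apply: addmx_sub_adds; first exact: submxMl.
by apply/ker_odd_part; rewrite mulmxBl -(mulmxA c A) mulmxKV// subrr.
Qed.

End Frame.
End OrbitConsequences.

Local Notation dom := Defs.dom.

(** * Changes of charts *)

Section ChartLemmas.
Context {R : realType} {n : nat} {M : manifold R n}.
Implicit Types (i j k : chart_index M) (p : M) (U : set M).

(** Inside the open image of the chart, this set is the preimage of U under the inverse chart, which
    is continuous there. *)
Lemma open_chart_image i U : open U -> open (chart M i @` (dom M i `&` U)).
Proof.
move=> oU.
have -> : chart M i @` (dom M i `&` U) =
    (chart M i @` dom M i) `&` [set x | (chart M i @` dom M i) x -> U (chart_inv M i x)].
  apply/seteqP; split=> [x [p [dp Up] <-]|x [[p dp <-] h]].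
    by split; [exists p|rewrite /= chartK].
  by exists p => //; split=> //; rewrite -(chartK dp); apply: h; exists p.
rewrite openE => x [Sx Ux]; rewrite /interior.
have n1 : \forall y \near x, (chart M i @` dom M i) y.
  by apply: open_nbhs_nbhs; split=> //; exact: chart_image_open.
have n2 : \forall y \near x, U (chart_inv M i y).
  by apply: (chart_inv_continuous Sx); apply: open_nbhs_nbhs; split=> //; exact: Ux.
by apply: filterS2 n1 n2 => y Sy Uy; split.
Qed.

Lemma chart_image_sub i U : chart M i @` (dom M i `&` U) `<=` chart M i @` dom M i.
Proof. by move=> _ [r [dr _] <-]; exists r. Qed.

Lemma open_overlap i j : open (chart M i @` (dom M i `&` dom M j)).
Proof. exact: open_chart_image (dom_open j). Qed.

(** The chain rule on the image of the triple overlap, where the transition maps compose. *)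
Lemma coord_change_trans i j k p : dom M i p -> dom M j p -> dom M k p ->
  coord_change i j p *m coord_change j k p = coord_change i k p.
Proof.
move=> di dj dk; rewrite /coord_change.
pose U := chart M i @` (dom M i `&` (dom M j `&` dom M k)).
have oU : open U by apply: open_chart_image; apply: openI; exact: dom_open.
have Up : U (chart M i p) by exists p.
have sub1 : U `<=` chart M i @` (dom M i `&` dom M j) by move=> _ [r [? []] ? ? <-]; exists r.
have sub2 : U `<=` chart M i @` (dom M i `&` dom M k) by move=> _ [r [? []] ? ? <-]; exists r.
pose f := chart M k \o chart_inv M j; pose g := chart M j \o chart_inv M i.
have gp : g (chart M i p) = chart M j p by rewrite /g /= chartK.
have Vp : (chart M j @` (dom M j `&` dom M k)) (g (chart M i p)) by rewrite gp; exists p.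
have := jacobian_comp oU (@open_overlap j k) Up Vp (smooth_C1 (@transition_smooth _ _ M j k))
  (Ck_sub sub1 (smooth_C1 (@transition_smooth _ _ M i j))).
rewrite -/f -/g gp => <-; apply: (near_jacobian oU Up).
  apply: (Ck_comp oU (@open_overlap j k) _ (smooth_C1 (@transition_smooth _ _ M j k))
    (Ck_sub sub1 (smooth_C1 (@transition_smooth _ _ M i j)))).
  by move=> _ [r [? []] ? ? <-]; rewrite /= chartK//; exists r.
by move=> _ [r [? []] ? ? <-]; rewrite /f /g /= !chartK.
Qed.

Lemma coord_change_id i p : dom M i p -> coord_change i i p = 1%:M.
Proof.
move=> di; rewrite /coord_change.
have oU := @chart_image_open _ _ M i.
have Up : (chart M i @` dom M i) (chart M i p) by exists p.
rewrite -(near_jacobian (f := fun x => x) oU Up (Ck_id 1 oU)); last first.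
  by move=> _ [r dr <-]; rewrite /= chartK.
have H (v : 'rV[R]_n) : v *m 'J (fun x : 'rV[R]_n => x) (chart M i p) = v.
  have [_ <-] := C1_is_derive v oU Up (Ck_id 1 oU).
  by have [_ ->] := is_derive_id (chart M i p) v.
by apply/row_matrixP => r; rewrite rowE H row1.
Qed.

Lemma coord_changeK i j p : dom M i p -> dom M j p ->
  coord_change i j p *m coord_change j i p = 1%:M.
Proof. by move=> di dj; rewrite coord_change_trans// coord_change_id. Qed.

Lemma coord_change_unit i j p : dom M i p -> dom M j p -> coord_change i j p \in unitmx.
Proof. by move=> di dj; case: (mulmx1_unit (coord_changeK di dj)) => h _; exact: h. Qed.

Lemma coord_change_inv i j p : dom M i p -> dom M j p ->
  coord_change j i p = invmx (coord_change i j p).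
Proof.
move=> di dj; have u := coord_change_unit di dj.
by rewrite -[LHS](mulKmx u) coord_changeK// mulmx1.
Qed.

Lemma smooth_coord_change i j :
  smooth_on (chart M i @` (dom M i `&` dom M j)) (fun x => coord_change i j (chart_inv M i x)).
Proof.
move=> k; have oV := @open_overlap i j.
apply: (Ck_eq oV _ (smooth_jacobian oV (@transition_smooth _ _ M i j) k)).
by move=> _ [p [di dj] <-]; rewrite /coord_change chartK.
Qed.

Lemma smooth_coord_change_inv i j :
  smooth_on (chart M i @` (dom M i `&` dom M j)) (fun x => coord_change j i (chart_inv M i x)).
Proof.
move=> k; have oV := @open_overlap i j.
apply: (Ck_eq oV _ (Ck_invmx oV _ (smooth_coord_change i j k))).
  by move=> _ [p [di dj] <-]; rewrite chartK//; exact/esym/coord_change_inv.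
by move=> _ [p [di dj] <-]; rewrite chartK// coord_change_unit.
Qed.

Lemma smooth_chart_change i U j (m l : nat) (f : 'rV[R]_n -> 'M[R]_(m, l)) : open U -> U `<=` dom M i ->
  smooth_on (chart M i @` (dom M i `&` U)) f ->
  smooth_on (chart M j @` (dom M j `&` U)) (f \o (chart M i \o chart_inv M j)).
Proof.
move=> oU Ui sf k; have oV := @open_chart_image j U oU.
apply: (Ck_comp (V := chart M i @` (dom M i `&` U)) oV (@open_chart_image i U oU) _ (sf k)).
  by move=> _ [r [dj Ur] <-]; rewrite /= chartK//; exists r => //; split=> //; exact: Ui.
apply: Ck_sub (@transition_smooth _ _ M j i k).
by move=> _ [r [dj Ur] <-]; exists r => //; split=> //; exact: Ui.
Qed.

Lemma endo_in_chart_apply i (K : M -> 'M[R]_n) (X : M -> 'rV[R]_n) x :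
  (chart M i @` dom M i) x ->
  field_in_chart i (apply_endo K X) x = field_in_chart i X x *m endo_in_chart i K x.
Proof.
move=> [p di <-]; rewrite /field_in_chart /apply_endo /endo_in_chart chartK//.
have := coord_changeK (dom_chart_at p) di.
move: (coord_change _ i p) (coord_change i _ p) => C D CD.
by rewrite !mulmxA -(mulmxA (X p) C D) CD mulmx1.
Qed.

(* The constant field of the chart i with value v. *)
Definition chart_field i (v : 'rV[R]_n) : M -> 'rV[R]_n :=
  fun p => v *m coord_change i (chart_at M p) p.

Lemma smooth_chart_field i U v : open U -> U `<=` dom M i -> smooth_field_on U (chart_field i v).
Proof.
move=> oU Ui j k; have oV := @open_chart_image j U oU.
have sub : chart M j @` (dom M j `&` U) `<=` chart M j @` (dom M j `&` dom M i).
  by move=> _ [r [dj Ur] <-]; exists r => //; split=> //; exact: Ui.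
apply: (Ck_eq oV _ (CkMmx oV (Ck_cst k _ v) (Ck_sub sub (smooth_coord_change_inv j i k)))).
move=> _ [r [dj Ur] <-]; rewrite /field_in_chart /chart_field (chartK dj).
by rewrite -(coord_change_trans (Ui r Ur) (dom_chart_at r) dj) mulmxA.
Qed.

End ChartLemmas.

(** * The Nijenhuis tensor and the foliation in a chart *)

Section ThreeFormCalculus.
Context {R : realType}.

Lemma row0_col_mx n m (u : 'rV[R]_m) (C : 'M[R]_(n, m)) : row 0 (col_mx u C) = u.
Proof.
apply/rowP => j; rewrite mxE -[RHS](col_mxEu u C).
by congr (col_mx u C _ _); exact: val_inj.
Qed.

Lemma col_mx_lift n m (u : 'rV[R]_m) (C : 'M[R]_(n, m)) i j :
  col_mx u C (lift 0 i) j = C i j.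
Proof.
by rewrite -[RHS](col_mxEd u C); congr (col_mx u C _ _); exact: val_inj.
Qed.

Lemma rowS_col_mx n m (u : 'rV[R]_m) (C : 'M[R]_(n, m)) i :
  row (lift 0 i) (col_mx u C) = row i C.
Proof. by apply/rowP => j; rewrite mxE col_mx_lift mxE. Qed.

Lemma row'0_col_mx n m (u : 'rV[R]_m) (C : 'M[R]_(n, m)) : row' 0 (col_mx u C) = C.
Proof. by apply/matrixP => i j; rewrite mxE col_mx_lift. Qed.

Lemma row'S_col_mx n m (u : 'rV[R]_m) (C : 'M[R]_(n.+1, m)) (i : 'I_n.+1) :
  row' (lift 0 i) (col_mx u C) = col_mx u (row' i C : 'M[R]_(n, m)).
Proof.
have c0 k (D : 'M[R]_(k, m)) j : col_mx u D 0 j = u 0 j.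
  by rewrite -[RHS](col_mxEu u D); congr (col_mx u D _ _); exact: val_inj.
apply/matrixP => a j; rewrite mxE; case: (unliftP 0 (a : 'I_n.+1)) => [b ->|->].
  rewrite (col_mx_lift u (row' i C : 'M[R]_(n, m))) [RHS]mxE -(col_mx_lift u C).
  by congr (col_mx u C _ _); apply: val_inj; rewrite /= /bump /= !add1n ltnS addnS.
rewrite (c0 n (row' i C)) -(c0 _ C); congr (col_mx u C _ _); exact: val_inj.
Qed.

(** Only the form is differentiated: y, z and t are constant vectors, as in [ext_deriv]. *)
Definition dform (a : 'rV[R]_6 -> kform R 6 3) (x v y z t : 'rV[R]_6) : R :=
  'D_v (fun x' => eval3 (a x') y z t : R^o) x.

Lemma ext_deriv_eval3 (a : 'rV[R]_6 -> kform R 6 3) x y0 y1 y2 y3 :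
  ext_deriv a x (col_mx y0 (col_mx y1 (col_mx y2 y3)) : 'M[R]_(1 + (1 + (1 + 1)), 6)) =
  dform a x y0 y1 y2 y3 - dform a x y1 y0 y2 y3 + dform a x y2 y0 y1 y3 - dform a x y3 y0 y1 y2.
Proof.
have r1 m (u : 'rV[R]_m) : row 0 u = u by apply/rowP => j; rewrite mxE.
rewrite /ext_deriv !big_ord_recl big_ord0.
rewrite (@row0_col_mx 3) (@row'0_col_mx 3).
rewrite !(@rowS_col_mx 3) !(@row'S_col_mx 2).
rewrite !(@row0_col_mx 2) !(@row'0_col_mx 2).
rewrite !(@rowS_col_mx 2) !(@row'S_col_mx 1).
rewrite !(@row0_col_mx 1) !(@row'0_col_mx 1).
rewrite !(@rowS_col_mx 1) !(@row'S_col_mx 0).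
rewrite !r1.
have r0 (u v : 'rV[R]_6) : col_mx u (row' 0 v : 'M[R]_(0, 6)) = u.
  by apply/rowP => j; rewrite -[RHS](col_mxEu u (row' 0 v : 'M[R]_(0, 6))); congr (col_mx u _ _ _); exact: val_inj.
rewrite !r0 /dform /eval3 /= /bump /= !expr0 !expr1 !exprS !expr0.
by ring.
Qed.

Definition alternating3 (g : kform R 6 3) :=
  [/\ forall k x x' y z, eval3 g (k *: x + x') y z = k * eval3 g x y z + eval3 g x' y z,
      forall x y z, eval3 g x y z = - eval3 g y x z &
      forall x y z, eval3 g x y z = - eval3 g x z y].

(** With the third argument fixed the form is a matrix product, to which the product rule for
    matrices applies; this serves to differentiate the form and two of its arguments together. *)
Lemma eval3_mx g (y z t : 'rV[R]_6) : alternating3 g -> eval3 g y z t =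
  (y *m (\matrix_(i, j) eval3 g (delta_mx 0 i) (delta_mx 0 j) t) *m z^T) 0 0.
Proof.
move=> [lin s12 s23].
have lin0 z' t' : eval3 g 0 z' t' = 0.
  by have := lin 1 0 0 z' t'; rewrite scale1r addr0 mul1r => h; lra.
have lsum (c : 'I_6 -> R) (e : 'I_6 -> 'rV[R]_6) z' t' :
    eval3 g (\sum_i c i *: e i) z' t' = \sum_i c i * eval3 g (e i) z' t'.
  elim/big_rec2: _ => [//|i u v _ <-].
  by rewrite lin.
rewrite mxE {1}(row_sum_delta y) lsum.
under [RHS]eq_bigr => j _ do rewrite mxE mulr_suml [z^T _ _]mxE.
rewrite exchange_big/=; apply: eq_bigr => i _.
rewrite s12 {1}(row_sum_delta z) lsum -sumrN mulr_sumr; apply: eq_bigr => j _.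
by rewrite mxE s12; ring.
Qed.

End ThreeFormCalculus.

Section FormFamilies.
Context {R : realType} (O : set 'rV[R]_6) (oO : open O).

Lemma near_is_derive (V W : normedModType R) (f g : V -> W) x v d :
  {near x, f =1 g} -> is_derive x v f d -> is_derive x v g d.
Proof.
move=> fg [df Df]; split; first exact: near_derivable fg df.
by rewrite -(near_derive v fg).
Qed.

Section OneForm.
Variables (a : 'rV[R]_6 -> kform R 6 3).
Hypothesis a_smooth : forall A, smooth_on (V := R^o) O (fun x => a x A).
Hypothesis a_alt : forall x, O x -> alternating3 (a x).

Lemma is_derive_eval3 (y z : 'rV[R]_6 -> 'rV[R]_6) t x v dy dz : O x ->
  is_derive x v y dy -> is_derive x v z dz ->
  is_derive x v (fun x => eval3 (a x) (y x) (z x) t : R^o)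
    (eval3 (a x) dy (z x) t + dform a x v (y x) (z x) t + eval3 (a x) (y x) dz t).
Proof.
move=> Ox Dy Dz.
pose m (x : 'rV[R]_6) : 'M[R]_6 := \matrix_(i, j) eval3 (a x) (delta_mx 0 i) (delta_mx 0 j) t.
have sm : Ck 1 O m.
  apply/(Ck_mx _ _ oO) => i j.
  have S : Ck (V := R^o) 1 O (fun x => eval3 (a x) (delta_mx 0 i) (delta_mx 0 j) t).
    exact: a_smooth.
  by apply: (Ck_eq oO _ S) => x' _; rewrite mxE.
have Dm := C1_is_derive_mx v oO Ox sm.
set dm := (\sum_j _) in Dm.
have DzT : is_derive x v (fun x => (z x)^T) dz^T.
  move/is_derive_mx : Dz => Dz; apply/is_derive_mx => i j; rewrite mxE.
  rewrite (_ : (fun _ => _) = (fun y => z y j i)); first exact: Dz.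
  by apply/funext => r; rewrite mxE.
have bil (u w : 'rV[R]_6) : is_derive x v (fun x => eval3 (a x) u w t : R^o) ((u *m dm *m w^T) 0 0).
  have D1 := is_derive_mulmx (is_derive_mulmx (is_derive_cstf u x v) Dm) (is_derive_cstf w^T x v).
  have /is_derive_mx/(_ 0 0) := D1; rewrite mul0mx add0r mulmx0 addr0 => D2.
  by apply: (near_is_derive _ D2); apply: (open_near_eq oO Ox) => r Or; rewrite (eval3_mx _ _ _ (a_alt Or)).
have -> : dform a x v (y x) (z x) t = (y x *m dm *m (z x)^T) 0 0.
  by have [_ <-] := bil (y x) (z x).
have D1 := is_derive_mulmx (is_derive_mulmx Dy Dm) DzT.
have /is_derive_mx/(_ 0 0) := D1; rewrite mulmxDl 2!mxE -/(m x) => D2.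
rewrite !(eval3_mx _ _ _ (a_alt Ox)) -/(m x).
by apply: (near_is_derive _ D2); apply: (open_near_eq oO Ox) => r Or; rewrite (eval3_mx _ _ _ (a_alt Or)).
Qed.

Lemma derive_vanishing (y z : 'rV[R]_6 -> 'rV[R]_6) t x v dy dz : O x ->
  (forall x, O x -> eval3 (a x) (y x) (z x) t = 0) ->
  is_derive x v y dy -> is_derive x v z dz ->
  eval3 (a x) dy (z x) t + dform a x v (y x) (z x) t + eval3 (a x) (y x) dz t = 0.
Proof.
move=> Ox h Dy Dz; have [_ <-] := is_derive_eval3 t Ox Dy Dz.
rewrite -[RHS](@derive_cst R 'rV[R]_6 R^o (0 : R^o) x v).
by apply: near_derive; apply: (open_near_eq oO Ox).
Qed.

Lemma eval30 x y z : O x -> [/\ eval3 (a x) 0 y z = 0, eval3 (a x) y 0 z = 0 & eval3 (a x) y z 0 = 0].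
Proof.
move=> Ox; have [lin s12 s23] := a_alt Ox.
have lin0 z' t' : eval3 (a x) 0 z' t' = 0.
  by have := lin 1 0 0 z' t'; rewrite scale1r addr0 mul1r => h; lra.
by split=> //; [rewrite s12 lin0 oppr0|rewrite s23 s12 lin0 opprK].
Qed.

End OneForm.

Variables (w : 'rV[R]_6 -> kform R 6 2) (f : 'rV[R]_6 -> kform R 6 3).
Let K (x : 'rV[R]_6) : 'M[R]_6 := Kmap (w x) (f x).
Let F (x : 'rV[R]_6) : kform R 6 3 := Fform (w x) (f x).
Hypothesis w_smooth : forall A, smooth_on (V := R^o) O (fun x => w x A).
Hypothesis f_smooth : forall A, smooth_on (V := R^o) O (fun x => f x A).
Hypothesis frames : forall x, O x -> exists E, orbit_frame (w x) (f x) E.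

Lemma smooth_wedge k l (a : 'rV[R]_6 -> kform R 6 k) (b : 'rV[R]_6 -> kform R 6 l) A :
  (forall A, smooth_on (V := R^o) O (fun x => a x A)) ->
  (forall A, smooth_on (V := R^o) O (fun x => b x A)) ->
  smooth_on (V := R^o) O (fun x => wedge (a x) (b x) A).
Proof.
move=> sa sb m; apply: (CkM oO); first exact: Ck_cst.
apply: (Ck_sum _ oO) => s _; apply: (CkM oO); first exact: Ck_cst.
by apply: (CkM oO); [exact: sa|exact: sb].
Qed.

(** The frames vary with x in no controlled way, so the quotient of [K_spec_entry] is used. The
    frame at x only shows that the denominator, the determinant of that frame, is nonzero. *)
Lemma smooth_Kmap : smooth_on O K.
Proof.
move=> m; apply/(Ck_mx _ _ oO) => i j.
have sl A : smooth_on (V := R^o) O (fun x => liouville (w x) A).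
  move=> k; apply: (CkM oO); last exact: Ck_cst.
  by apply: smooth_wedge => // B; exact: smooth_wedge.
have l0 x : O x -> liouville (w x) 1%:M != 0.
  move=> /frames[E FE]; rewrite (liouville_det _ FE) mul1mx -unitfE -unitmxE.
  by case: FE.
have sw A : smooth_on (V := R^o) O (fun x => wedge (interior_prod (k := 2) (delta_mx 0 i) (f x)) (f x) A).
  by apply: smooth_wedge => // B; exact: f_smooth.
have S := CkM oO (CkM oO (Ck_cst m O ((-1) ^+ j : R^o)) (CkZ (-1) oO (sw (row' j (1%:M : 'M[R]_6)) m)))
  (CkV oO l0 (sl 1%:M m)).
apply: (Ck_eq oO _ S) => x /frames[E FE].
by rewrite /K (K_spec_entry _ _ FE (Kmap_spec FE)) /GRing.scale/= mulN1r.
Qed.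

Lemma f_alternating x : O x -> alternating3 (f x).
Proof.
move=> /frames[E FE]; split=> *; [exact: phi_linear1 FE _ _ _ _ _|exact: phi_swap12 FE _ _ _|exact: phi_swap23 FE _ _ _].
Qed.

Lemma F_alternating x : O x -> alternating3 (F x).
Proof.
move=> /frames[E FE].
have FC (y z t : 'rV[R]_6) : eval3 (F x) y z t = 4 * eval3 (colform E 3 [:: 1%N; 3%N; 5%N]) y z t.
  by rewrite /eval3 /F (Fform_frame _ FE).
split=> *; rewrite !FC !eval3_colform// ?crdD ?crdZ; ring.
Qed.

Lemma smooth_F A : smooth_on (V := R^o) O (fun x => F x A).
Proof.
move=> k.
pose A1 : 'M[R]_(1 + 2, 6) := A.
have E1 x : O x -> F x A = \sum_i (usubmx A1 *m K x) 0 i * (- 2 * f x (col_mx (delta_mx 0 i : 'rV[R]_6) (dsubmx A1))).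
  move=> Ox; have [lin _ _] := f_alternating Ox.
  pose A2 : 'M[R]_(1 + 1, 6) := dsubmx A1.
  have Ed : dsubmx A1 = col_mx (usubmx A2) (dsubmx A2) by rewrite vsubmxK.
  rewrite /F /Fform -/A1 -/(K x) Ed.
  transitivity (- 2 * eval3 (f x) (usubmx A1 *m K x) (usubmx A2) (dsubmx A2)) => //.
  rewrite {1}(row_sum_delta (usubmx A1 *m K x)).
  have lin0 z' t' : eval3 (f x) 0 z' t' = 0.
    by have := lin 1 0 0 z' t'; rewrite scale1r addr0 mul1r => h; lra.
  have -> : eval3 (f x) (\sum_i (usubmx A1 *m K x) 0 i *: delta_mx 0 i) (usubmx A2) (dsubmx A2) =
      \sum_i (usubmx A1 *m K x) 0 i * eval3 (f x) (delta_mx 0 i) (usubmx A2) (dsubmx A2).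
    by elim/big_rec2: _ => [//|i u v _ <-]; rewrite lin.
  by rewrite mulr_sumr; apply: eq_bigr => i _; rewrite mulrCA.
have SK := CkMmx oO (Ck_cst k O (usubmx A1)) (smooth_Kmap k).
have S : Ck k O (fun x => \sum_i (usubmx A1 *m K x) 0 i * (- 2 * f x (col_mx (delta_mx 0 i : 'rV[R]_6) (dsubmx A1))) : R^o).
  apply: (Ck_sum _ oO) => i _; apply: (CkM oO); first by move/(Ck_mx _ _ oO) : SK; exact.
  by apply: (CkM oO); [exact: Ck_cst|exact: f_smooth].
by apply: (Ck_eq oO _ S) => x Ox; rewrite E1.
Qed.

Hypothesis f_closed : forall x, O x -> ext_deriv f x = fun=> 0.
Hypothesis F_closed : forall x, O x -> ext_deriv F x = fun=> 0.

Lemma closed_dform (a : 'rV[R]_6 -> kform R 6 3) x y0 y1 y2 y3 : ext_deriv a x = (fun=> 0) ->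
  dform a x y0 y1 y2 y3 - dform a x y1 y0 y2 y3 + dform a x y2 y0 y1 y3 - dform a x y3 y0 y1 y2 = 0.
Proof. by move=> h; rewrite -ext_deriv_eval3 h. Qed.

(* With l = u K and m = t K, the hypotheses are dphi = 0, dF = 0 and the
   derivatives of the identities F(y, ., .) = - 2 phi(y K, ., .),
   phi(y K, z K, .) = 0 and F(y K, ., .) = 0. *)
Lemma nijenhuis_linear (T : Type) (df dF : T -> T -> T -> T -> R) (p P : T -> T -> T -> R)
    (l m u t A B w1 w2 w3 w4 v1 v2 v3 v4 v5 v6 : T) :
  df m l A B + p v1 A B = - 2^-1 * dF m u A B ->
  df l m A B + p v2 A B = - 2^-1 * dF l t A B ->
  P w3 A B = - 2 * p w1 A B -> P w4 A B = - 2 * p w2 A B ->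
  dF u m A B + P w3 A B = 0 -> dF t l A B + P w4 A B = 0 ->
  df l m A B - df m l A B + df A l m B - df B l m A = 0 ->
  dF l t A B - dF t l A B + dF A l t B - dF B l t A = 0 ->
  dF m u A B - dF u m A B + dF A m u B - dF B m u A = 0 ->
  df A l m B + p v3 m B + p l v5 B = 0 -> df B l m A + p v4 m A + p l v6 A = 0 ->
  dF A l t B + P v3 t B = 0 -> dF B l t A + P v4 t A = 0 ->
  dF A m u B + P v5 u B = 0 -> dF B m u A + P v6 u A = 0 ->
  P v3 t B = - 2 * p v3 m B -> P v4 t A = - 2 * p v4 m A ->
  P v5 u B = - 2 * p v5 l B -> P v6 u A = - 2 * p v6 l A ->
  p v5 l B = - p l v5 B -> p v6 l A = - p l v6 A ->
  p v1 A B - p v2 A B + p w1 A B - p w2 A B = 0.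
Proof. move=> *; lra. Qed.

(** On constant fields u and t, the left side is K[Ku, t] + K[u, Kt] - [Ku, Kt]. By nondegeneracy of
    phi it suffices to test it against phi(., A, B). Closedness is used on (Ku, Kt, A, B) for phi
    and on (Ku, t, A, B) and (Kt, u, A, B) for F: with these choices every derivative of a form can
    be exchanged for a derivative of K. *)
Lemma nijenhuis x u t : O x ->
  u *m 'D_(t *m K x) K x - t *m 'D_(u *m K x) K x
  + t *m 'D_u K x *m K x - u *m 'D_t K x *m K x = 0.
Proof.
move=> Ox; have [E FE] := frames Ox.
apply: (phi_nondegenerate FE) => A B.
have DK v : is_derive x v K ('D_v K x).
  by apply: derivableP; have [] := C1_is_derive_mx v oO Ox (smooth_C1 smooth_Kmap).
have DuK (y : 'rV[R]_6) v : is_derive x v (fun x => y *m K x) (y *m 'D_v K x).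
  by have := is_derive_mulmx (is_derive_cstf y x v) (DK v); rewrite mul0mx add0r.
have [flin f12 f23] := f_alternating Ox; have [Flin F12 F23] := F_alternating Ox.
have Ff y z p : eval3 (F x) y z p = - 2 * eval3 (f x) (y *m K x) z p by exact: Fform_eval3.
have f0 y z := eval30 f_alternating y z Ox.
have F0 y z := eval30 F_alternating y z Ox.
have r1 v y p q : dform f x v (y *m K x) p q + eval3 (f x) (y *m 'D_v K x) p q = - 2^-1 * dform F x v y p q.
  have D1 := is_derive_eval3 f_smooth f_alternating q Ox (DuK y v) (is_derive_cstf p x v).
  have D2 := is_derive_eval3 smooth_F F_alternating q Ox (is_derive_cstf y x v) (is_derive_cstf p x v).
  have D3 := is_derive_mulf (is_derive_cstf (- 2 : R) x v) D1.
  have : 'D_v (fun x => eval3 (F x) y p q : R^o) x = 'D_v (fun x => - 2 * eval3 (f x) (y *m K x) p q : R^o) x.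
    by apply: near_derive; apply: (open_near_eq oO Ox) => r Or; exact: Fform_eval3.
  have [_ ->] := D2; have [_ ->] := D3.
  have [_ -> _] := f0 (y *m K x) q; have [-> _ _] := F0 p q; have [_ -> _] := F0 y q.
  by move=> h; lra.
have r2 v y z q : dform f x v (y *m K x) (z *m K x) q + eval3 (f x) (y *m 'D_v K x) (z *m K x) q
    + eval3 (f x) (y *m K x) (z *m 'D_v K x) q = 0.
  have := derive_vanishing f_smooth f_alternating (t := q) Ox _ (DuK y v) (DuK z v).
  move=> <-; first by ring.
  by move=> r /frames[E' FE']; exact: phi_K_K FE' _ _ _.
have r3 v y p q : dform F x v (y *m K x) p q + eval3 (F x) (y *m 'D_v K x) p q = 0.
  have := derive_vanishing smooth_F F_alternating (t := q) Ox _ (DuK y v) (is_derive_cstf p x v).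
  have [_ -> _] := F0 (y *m K x) q.
  move=> <-; first by ring.
  by move=> r /frames[E' FE']; exact: Fform_K FE' _ _ _.
have cf y0 y1 y2 y3 := closed_dform y0 y1 y2 y3 (f_closed Ox).
have cF y0 y1 y2 y3 := closed_dform y0 y1 y2 y3 (F_closed Ox).
set l := u *m K x; set m := t *m K x.
have h1 := r1 m u A B; have h2 := r1 l t A B.
have h3 := Ff (t *m 'D_u K x) A B; have h4 := Ff (u *m 'D_t K x) A B.
have h5 := r3 u t A B; have h6 := r3 t u A B.
have h7 := cf l m A B; have h8 := cF l t A B; have h9 := cF m u A B.
have h10 := r2 A u t B; have h11 := r2 B u t A.
have h12 := r3 A u t B; have h13 := r3 B u t A; have h14 := r3 A t u B; have h15 := r3 B t u A.
have h16 y z q : eval3 (F x) y z q = - 2 * eval3 (f x) y (z *m K x) q.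
  by rewrite F12 Ff f12; ring.
have h17 := h16 (u *m 'D_A K x) t B; have h18 := h16 (u *m 'D_B K x) t A.
have h19 := h16 (t *m 'D_A K x) u B; have h20 := h16 (t *m 'D_B K x) u A.
have h21 := f12 (t *m 'D_A K x) l B; have h22 := f12 (t *m 'D_B K x) l A.
rewrite -/l -/m in h1 h2 h5 h6 h10 h11 h12 h13 h14 h15 h17 h18 h19 h20.
have sum4 (a b c d : 'rV[R]_6) : eval3 (f x) (a - b + c - d) A B =
    eval3 (f x) a A B - eval3 (f x) b A B + eval3 (f x) c A B - eval3 (f x) d A B.
  have -> : a - b + c - d = (-1) *: b + ((-1) *: d + (1 *: c + a)).
    by apply/rowP => j; rewrite !mxE; ring.
  by rewrite !flin; ring.
rewrite sum4.
exact: (nijenhuis_linear h1 h2 h3 h4 h5 h6 h7 h8 h9 h10 h11 h12 h13 h14 h15 h17 h18 h19 h20 h21 h22).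
Qed.

End FormFamilies.

(** * Frobenius' theorem applied to ker K *)

Section OddEvenSplitting.
Context {R : realType}.
Implicit Types (E : 'M[R]_6).

(** Its rows are the frame vectors of index 1, 3, 5. They span a complement of L, and K maps them to
    a basis of L. *)
Definition odd_section E : 'M[R]_(3, 6) := (colsel 3 [:: 1%N; 3%N; 5%N])^T *m invmx E.
Definition even_part E : 'M[R]_(6, 3) := E *m colsel 3 [:: 0%N; 2%N; 4%N].

Lemma odd_section_odd E : E \in unitmx -> odd_section E *m odd_part (E := E) = 1%:M.
Proof.
move=> uE; rewrite /odd_section /odd_part mulmxA mulmxKV//.
apply/matrixP => i j; rewrite !mxE !big_ord_recl big_ord0 !mxE /=.
by case: i => [[|[|[|]]]] // ?; case: j => [[|[|[|]]]] // ?; rewrite /= /bump /=; ring.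
Qed.

Lemma odd_section_even E : E \in unitmx -> odd_section E *m even_part E = 0.
Proof.
move=> uE; rewrite /odd_section /even_part mulmxA mulmxKV//.
apply/matrixP => i j; rewrite !mxE !big_ord_recl big_ord0 !mxE /=.
by case: i => [[|[|[|]]]] // ?; case: j => [[|[|[|]]]] // ?; rewrite /= /bump /=; ring.
Qed.

Lemma odd_section_K_even E : E \in unitmx ->
  odd_section E *m frame_K E *m even_part E = (- 2)%:M.
Proof.
move=> uE; rewrite /odd_section /even_part /frame_K !mulmxA mulmxKV// mulmxKV//.
apply/row_matrixP => i; rewrite row_mul [row i (_ *m _)]row_mul; apply/rowP => j.
have -> : row i (colsel 3 [:: 1%N; 3%N; 5%N])^T *m K0 = - 2 *: (row i (colsel 3 [:: 0%N; 2%N; 4%N])^T : 'rV[R]_6).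
  apply/rowP => k; rewrite !mxE !big_ord_recl big_ord0 !mxE /=.
  by case: i => [[|[|[|]]]] // ?; case: k => [[|[|[|[|[|[|]]]]]]] // ?; rewrite /= /bump /=; ring.
rewrite -scalemxAl !mxE !big_ord_recl big_ord0 !mxE /=.
by case: i => [[|[|[|]]]] // ?; case: j => [[|[|[|]]]] // ?; rewrite /= /bump /=; ring.
Qed.

End OddEvenSplitting.

Section LocalFoliation.
Context {R : realType} (O : set 'rV[R]_6) (oO : open O).
Variables (w : 'rV[R]_6 -> kform R 6 2) (f : 'rV[R]_6 -> kform R 6 3).
Let K (x : 'rV[R]_6) : 'M[R]_6 := Kmap (w x) (f x).
Let F (x : 'rV[R]_6) : kform R 6 3 := Fform (w x) (f x).
Hypothesis w_smooth : forall A, smooth_on (V := R^o) O (fun x => w x A).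
Hypothesis f_smooth : forall A, smooth_on (V := R^o) O (fun x => f x A).
Hypothesis frames : forall x, O x -> exists E, orbit_frame (w x) (f x) E.
Hypothesis F_closed : forall x, O x -> ext_deriv F x = fun=> 0.

Lemma open_unit_det p (g : 'rV[R]_6 -> 'M[R]_p) : Ck 0 O g ->
  open [set x | O x /\ \det (g x) != 0].
Proof.
move=> cg; rewrite openE => x [Ox dx]; rewrite /interior.
have c := Ck_continuous (Ck_det oO cg) Ox.
apply: filterI; last exact: (near_neq0 c dx).
by apply: open_nbhs_nbhs; split.
Qed.

Variables (T : 'M[R]_(3, 6)) (D : 'M[R]_(6, 3)).
Let O1 := [set x | O x /\ \det (T *m K x *m D) != 0].
(** The rows of T K lie in L = Im K; the inverse factor replaces them by the basis of L with a D =
    1, the normalization that [frobenius] asks for. *)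
Let a (x : 'rV[R]_6) : 'M[R]_(3, 6) := invmx (T *m K x *m D) *m T *m K x.

Let smooth_TKD : smooth_on O (fun x => T *m K x *m D).
Proof.
move=> k; apply: (CkMmx oO _ (Ck_cst k O D)).
exact: (CkMmx oO (Ck_cst k O T) (smooth_Kmap oO w_smooth f_smooth frames k)).
Qed.

Lemma open_adapted : open O1.
Proof. exact: open_unit_det (smooth_TKD 0). Qed.

Lemma smooth_adapted : smooth_on O1 a.
Proof.
have oO1 := open_adapted; have sub : O1 `<=` O by move=> x [].
move=> k; apply: (CkMmx oO1 _ (Ck_sub sub (smooth_Kmap oO w_smooth f_smooth frames k))).
apply: (CkMmx oO1 _ (Ck_cst k O1 T)).
apply: (Ck_invmx oO1 _ (Ck_sub sub (smooth_TKD k))).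
by move=> x [_]; rewrite unitmxE unitfE.
Qed.

Lemma adapted_D x : O1 x -> a x *m D = 1%:M.
Proof.
by move=> [_ d]; rewrite /a -!mulmxA (mulmxA T) mulVmx// unitmxE unitfE.
Qed.

(** By a D = 1 the matrix [a x] has rank 3, which is also the rank of K; the inclusion of its row
    space in that of K is therefore an equality. *)
Lemma adapted_span x (u : 'rV[R]_6) : O1 x -> u *m K x = 0 -> (u <= a x)%MS.
Proof.
move=> O1x uK; have [Ox _] := O1x; have [E FE] := frames Ox.
have sub : (a x <= K x)%MS by exact: submxMl.
have ra : \rank (a x) = 3%N.
  apply/eqP; rewrite eqn_leq rank_leq_row/=.
  by rewrite -{1}(mxrank1 R 3) -(adapted_D O1x) mxrankM_maxl.
have : (K x <= a x)%MS.
  by have := mxrank_leqif_sup sub; rewrite ra (rank_K FE) => -[_ <-].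
by apply: submx_trans; exact: ker_K_sub FE _ uK.
Qed.

(* The bracket of s a and t a lies in ker K because F annihilates exactly ker K
   and is closed; it is killed by D because a D = 1; on ker K, D is injective. *)
Lemma adapted_linear (dml dlm dA dB p q : R) :
  dml + p = 0 -> dlm + q = 0 -> dA = 0 -> dB = 0 -> dlm - dml + dA - dB = 0 -> p - q = 0.
Proof. move=> *; lra. Qed.

Lemma adapted_commute x (s t : 'rV[R]_3) : O1 x ->
  s *m 'D_(t *m a x) a x = t *m 'D_(s *m a x) a x.
Proof.
move=> O1x; have [Ox _] := O1x; have [E FE] := frames Ox.
have oO1 := open_adapted; have sub : O1 `<=` O by move=> y [].
have altF := F_alternating frames.
have altF1 y : O1 y -> alternating3 (F y) by move=> /sub/altF.
have sF A : smooth_on (V := R^o) O1 (fun y => F y A).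
  by move=> k; apply: Ck_sub sub (smooth_F oO w_smooth f_smooth frames A k).
have [Flin F12 F23] := altF x Ox.
have Da v : is_derive x v a ('D_v a x).
  by apply: derivableP; have [] := C1_is_derive_mx v oO1 O1x (smooth_C1 smooth_adapted).
have Dsa (c : 'rV[R]_3) v : is_derive x v (fun y => c *m a y) (c *m 'D_v a x).
  by have := is_derive_mulmx (is_derive_cstf c x v) (Da v); rewrite mul0mx add0r.
have aK y : exists S, a y = S *m K y by exists (invmx (T *m K y *m D) *m T).
have Fa (c : 'rV[R]_3) y p q : O1 y -> eval3 (F y) (c *m a y) p q = 0.
  by move=> /sub/frames[E' FE']; have [S ->] := aK y; rewrite mulmxA; exact: Fform_K FE' _ _ _.
have r (c : 'rV[R]_3) v p q : dform F x v (c *m a x) p q + eval3 (F x) (c *m 'D_v a x) p q = 0.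
  have := derive_vanishing oO1 sF altF1 (t := q) O1x (fun y O1y => Fa c y p q O1y) (Dsa c v) (is_derive_cstf p x v).
  have [_ -> _] := eval30 altF1 (c *m a x) q O1x.
  by move=> <-; ring.
apply/eqP; rewrite -subr_eq0; apply/eqP.
set l := s *m a x; set m := t *m a x.
set br := s *m 'D_m a x - t *m 'D_l a x.
have brK : br *m K x = 0.
  apply: (Fform_nondegenerate FE) => A B; rewrite -/(F x).
  have h1 := r s m A B; have h2 := r t l A B.
  have z (y q : 'rV[R]_6) : eval3 (F x) y m q = 0.
    have E0 := Fa t x y q O1x.
    by rewrite F12; apply/eqP; rewrite oppr_eq0; apply/eqP; exact: E0.
  (* Differentiating F(s a, m, B) = 0 along A leaves one further term, F evaluated with m as an
     argument; it vanishes because m lies in L. *)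
  have h3 : dform F x A l m B = 0.
    have := r s A m B; have := z (s *m 'D_A a x) B.
    by move: (eval3 _ _ _ _) => e -> ; rewrite addr0.
  have h4 : dform F x B l m A = 0.
    have := r s B m A; have := z (s *m 'D_B a x) A.
    by move: (eval3 _ _ _ _) => e -> ; rewrite addr0.
  have c := closed_dform l m A B (F_closed Ox).
  have -> : eval3 (F x) br A B = eval3 (F x) (s *m 'D_m a x) A B - eval3 (F x) (t *m 'D_l a x) A B.
    have -> : br = (-1) *: (t *m 'D_l a x) + s *m 'D_m a x by rewrite scaleN1r addrC.
    by rewrite Flin mulN1r addrC.
  exact: (adapted_linear h1 h2 h3 h4 c).
have brD : br *m D = 0.
  have DaD v : 'D_v a x *m D = 0.
    have D1 := is_derive_mulmx (Da v) (is_derive_cstf D x v).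
    rewrite mulmx0 addr0 in D1; have [_ <-] := D1.
    rewrite -[RHS](derive_cst (1%:M : 'M[R]_3) x v).
    by apply: near_derive; apply: (open_near_eq oO1 O1x) => y; exact: adapted_D.
  have g (X Y : 'M[R]_(3, 6)) : X *m D = 0 -> Y *m D = 0 -> (s *m X - t *m Y) *m D = 0.
    by move=> XD YD; rewrite mulmxBl -!mulmxA XD YD !mulmx0 subrr.
  exact: (g _ _ (DaD m) (DaD l)).
have fin (v : 'rV[R]_6) (X : 'M[R]_(3, 6)) :
    v *m D = 0 -> X *m D = 1%:M -> (v <= X)%MS -> v = 0.
  move=> vD XD /submxP[c cE].
  by rewrite cE -[c]mulmx1 -XD (mulmxA c) -cE vD mul0mx.
exact: (fin _ _ brD (adapted_D O1x) (adapted_span O1x brK)).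
Qed.

End LocalFoliation.

(** The frame at x0 alone supplies all constant matrices: [even_part] normalizes the basis of L,
    while [odd_section] spans a complement on which [odd_part] gives coordinates. At x0 the matrix T
    K D is -2 times the identity, so it stays invertible nearby. *)
Lemma chart_foliation (R : realType) (O : set 'rV[R]_6) (w : 'rV[R]_6 -> kform R 6 2)
    (f : 'rV[R]_6 -> kform R 6 3) x0 : open O -> O x0 ->
  (forall A, smooth_on (V := R^o) O (fun x => w x A)) ->
  (forall A, smooth_on (V := R^o) O (fun x => f x A)) ->
  (forall x, O x -> exists E, orbit_frame (w x) (f x) E) ->
  (forall x, O x -> ext_deriv (fun x => Fform (w x) (f x)) x = fun=> 0) ->
  exists (U : set 'rV[R]_6) (g : 'rV[R]_6 -> 'rV[R]_3),
    [/\ open U, U x0, U `<=` O, smooth_on U g & forall x, U x ->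
      row_full ('J g x) /\ (kermx ('J g x) == kermx (Kmap (w x) (f x)))%MS].
Proof.
move=> oO Ox0 sw sf fr cF; have [E FE] := fr x0 Ox0; have [uE _ _] := FE.
pose T := odd_section E; pose D := even_part E.
pose O1 := [set x | O x /\ \det (T *m Kmap (w x) (f x) *m D) != 0].
have O1x0 : O1 x0.
  split=> //; rewrite (Kmap_frame FE) odd_section_K_even// det_scalar.
  by rewrite expf_neq0// oppr_eq0 pnatr_eq0.
pose a (x : 'rV[R]_6) : 'M[R]_(3, 6) :=
  invmx (T *m Kmap (w x) (f x) *m D) *m T *m Kmap (w x) (f x).
have oO1 : open O1 := @open_adapted R O oO w f sw sf fr T D.
have sa : smooth_on O1 a := smooth_adapted oO sw sf fr T D.
have aD x : O1 x -> a x *m D = 1%:M by exact: adapted_D.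
have comm x (s t : 'rV[R]_3) : O1 x -> s *m 'D_(t *m a x) a x = t *m 'D_(s *m a x) a x.
  by exact: (adapted_commute oO sw sf fr cF).
have [U [g [oU Ux0 UO1 sg gP]]] := frobenius oO1 O1x0 sa (odd_section_even uE)
  (odd_section_odd uE) aD comm.
exists U, g; split=> //; first by move=> x /UO1[].
move=> x Ux; have [aJ NJ] := gP x Ux; have O1x := UO1 x Ux; have [Ox _] := O1x.
have [E' FE'] := fr x Ox.
have rJ : \rank ('J g x) = 3%N.
  apply/eqP; rewrite eqn_leq rank_leq_col/=.
  apply: (@leq_trans (\rank (odd_section E *m 'J g x))); last exact: mxrankM_maxr.
  by rewrite mxrank_unit// unitmxE unitfE.
split; first by rewrite /row_full rJ.
have sub : (kermx (Kmap (w x) (f x)) <= kermx ('J g x))%MS.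
  apply/row_subP => i; apply/sub_kermxP.
  have uK : row i (kermx (Kmap (w x) (f x))) *m Kmap (w x) (f x) = 0.
    by apply/sub_kermxP; exact: row_sub.
  have /submxP[c ->] := adapted_span fr O1x uK.
  by rewrite -mulmxA aJ mulmx0.
apply/andP; split=> //.
(* Both kernels have rank 6 - 3, so the inclusion is an equality. *)
have := mxrank_leqif_sup sub; rewrite !mxrank_ker rJ (rank_K FE') => -[_ <-].
by [].
Qed.

(** * The metric and the volume form at a point *)

Section PointwiseMetric.
Context {R : realType} {w : kform R 6 2} {f : kform R 6 3} {E : 'M[R]_6}.
Context (FE : orbit_frame w f E).
Let K : 'M[R]_6 := Kmap w f.
Let q (u v : 'rV[R]_6) : R := eval2 w u (v *m K).
Let S : 'M[R]_(6, 3) := odd_part (E := E).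
Let uE : E \in unitmx. Proof. by case: FE. Qed.

Lemma eval2_linear k (u u' v : 'rV[R]_6) : eval2 w (k *: u + u') v = k * eval2 w u v + eval2 w u' v.
Proof. by rewrite !(omega_crd _ _ FE) !crdD !crdZ; ring. Qed.

Lemma eval2_swap (u v : 'rV[R]_6) : eval2 w u v = - eval2 w v u.
Proof. by rewrite !(omega_crd _ _ FE); ring. Qed.

Lemma eval2_mx (u v : 'rV[R]_6) :
  eval2 w u v = \sum_i \sum_j u 0 i * v 0 j * eval2 w (delta_mx 0 i) (delta_mx 0 j).
Proof.
have lin0 z : eval2 w 0 z = 0.
  by have := eval2_linear 1 0 0 z; rewrite scale1r addr0 mul1r => h; lra.
have lsum (c : 'I_6 -> R) (e : 'I_6 -> 'rV[R]_6) z :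
    eval2 w (\sum_i c i *: e i) z = \sum_i c i * eval2 w (e i) z.
  elim/big_rec2: _ => [//|i x y _ <-].
  by rewrite eval2_linear.
rewrite {1}(row_sum_delta u) lsum; apply: eq_bigr => i _.
rewrite eval2_swap {1}(row_sum_delta v) lsum -sumrN mulr_sumr; apply: eq_bigr => j _.
by rewrite (eval2_swap (delta_mx 0 i)); ring.
Qed.

Lemma q_linear k u u' v : q (k *: u + u') v = k * q u v + q u' v.
Proof. exact: eval2_linear. Qed.

Lemma q_sym u v : q u v = q v u.
Proof.
have T (a b : 'rV[R]_3) : (a *m b^T) 0 0 = (b *m a^T) 0 0.
  by rewrite !mxE; apply: eq_bigr => i _; rewrite !mxE mulrC.
by rewrite /q !(q_odd_part FE) T.
Qed.

Lemma q_ker u v : u *m K = 0 -> q u v = 0.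
Proof. by move=> uK; rewrite q_sym /q uK (omega_crd _ _ FE) /crd !mul0mx !mxE; ring. Qed.

Lemma q_gt0 u : u *m K != 0 -> 0 < q u u.
Proof.
move=> uK; have uS : u *m S != 0.
  apply: contraNneq uK => uS; apply/eqP/sub_kermxP.
  by apply/(ker_odd_part FE).
rewrite /q (q_odd_part FE) -/S mulr_gt0// mxE.
have ge0 i : 0 <= (u *m S) 0 i * (u *m S)^T i 0 by rewrite [X in _ * X]mxE -expr2 sqr_ge0.
have [i ui] : exists i, (u *m S) 0 i != 0.
  apply/existsP; apply: contraNT uS => /existsPn h; apply/eqP/rowP => i.
  by have := h i; rewrite negbK => /eqP ->; rewrite mxE.
rewrite (bigD1 i)//= ltr_pwDl ?sumr_ge0//.
by rewrite [X in _ * X]mxE -expr2 lt0r sqrf_eq0 ui sqr_ge0.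
Qed.

Lemma row_sub_ker (A : 'M[R]_(3, 6)) i : (A <= kermx K)%MS -> (row i A <= kermx K)%MS.
Proof. by apply: submx_trans; exact: row_sub. Qed.

Lemma Fform_det_sub A B (P : 'M[R]_3) : (A - P *m B <= kermx K)%MS ->
  Fform w f A = \det P * Fform w f B.
Proof. by move=> h; apply: (Fform_det FE) => i; exact: row_sub_ker. Qed.

Lemma Fform_positive : exists A, 0 < Fform w f A.
Proof.
exists (odd_section E); rewrite (Fform_odd_part FE) odd_section_odd// det1 mulr1.
by rewrite ltr0n.
Qed.

Lemma Fform_orthonormal : exists2 A, forall i j, q (row i A) (row j A) = (i == j)%:R & 0 < Fform w f A.
Proof.
(* The frame vectors of odd index are orthogonal for q with square 2, hence this scaling. *)
pose r : R := (Num.sqrt 2)^-1.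
have r0 : 0 < r by rewrite invr_gt0 sqrtr_gt0.
exists (r *: odd_section E) => [i j|].
  have rS k : row k (r *: odd_section E) *m S = r *: delta_mx 0 k.
    by rewrite -row_mul -scalemxAl odd_section_odd// linearZ/= row1.
  rewrite /q (q_odd_part FE) -/S !rS linearZ/= -scalemxAl -scalemxAr trmx_delta.
  have r2 : r * r = 2^-1 by rewrite /r -invfM -expr2 sqr_sqrtr.
  rewrite mul_delta_mx_cond scalerA r2 mxE mulmxnE mxE eqxx/=.
  by rewrite mulVKf.
rewrite (Fform_odd_part FE) -scalemxAl odd_section_odd// detZ det1 mulr1.
by rewrite mulr_gt0// exprn_gt0.
Qed.

(** Orthonormality reads 2 (A S)(A S)^T = 1, so 8 d^2 = 1 for d = det (A S). As F = 4 d is positive,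
    it equals sqrt 2. *)
Lemma orthonormal_volume A : (forall i j, q (row i A) (row j A) = (i == j)%:R) ->
  0 < Fform w f A -> (Num.sqrt 2)^-1 * Fform w f A = 1.
Proof.
move=> qA FA.
have G : 2 *: ((A *m S) *m (A *m S)^T) = 1%:M.
  apply/matrixP => i j; rewrite [RHS]mxE -(qA i j) /q (q_odd_part FE) -/S -!row_mul !mxE.
  by congr (2 * _); apply: eq_bigr => k _; rewrite !mxE.
have := congr1 determinant G; rewrite detZ det_mulmx det_tr det1.
rewrite (Fform_odd_part FE) -/S in FA *; move: FA; set d := \det _ => d0 dd.
have s0 : 0 < Num.sqrt 2 :> R by rewrite sqrtr_gt0.
have s2 : Num.sqrt 2 ^+ 2 = 2 :> R by rewrite sqr_sqrtr.
apply: (mulfI (lt0r_neq0 s0)); rewrite mulVKf ?lt0r_neq0// mulr1.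
apply/eqP; rewrite -(@eqrXn2 _ 2)//; last exact: ltW.
by rewrite s2; apply/eqP; move: dd; rewrite !exprS expr0 => dd; lra.
Qed.

Lemma volume_alternating (c : R) : alternating_form (fun A => c * Fform w f A).
Proof.
split=> [i A B C b d rA rB rC|A i j ij rij].
  rewrite !(Fform_odd_part FE).
  have r' (X : 'M[R]_(3, 6)) : row' i (X *m S) = row' i X *m S.
    by apply/matrixP => a e; rewrite 3!mxE; apply: eq_bigr => k _; rewrite [row' i X a k]mxE.
  have -> : \det (A *m S) = b * \det (B *m S) + d * \det (C *m S).
    apply: (determinant_multilinear (i0 := i)).
    - by rewrite !row_mul rA mulmxDl -!scalemxAl.
    - by rewrite !r' rB.
    - by rewrite !r' rC.
  by ring.
rewrite (Fform_odd_part FE) (determinant_alternate ij) ?mulr0// => k.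
by have := congr1 (fun r : 'rV[R]_6 => (r *m S) 0 k) rij; rewrite -!row_mul !mxE.
Qed.

Lemma volume_ker A i : (row i A <= kermx K)%MS -> Fform w f A = 0.
Proof.
move=> /(ker_odd_part FE) h; rewrite (Fform_odd_part FE) -/S in h *.
rewrite (expand_det_row _ i) big1 ?mulr0// => j _.
have -> : (A *m S) i j = 0 by rewrite -row_mul in h; have := congr1 (fun r : 'rV[R]_3 => r 0 j) h; rewrite !mxE.
by rewrite mul0r.
Qed.

Lemma basis_coordinates A B : Fform w f B != 0 -> exists P : 'M[R]_3, (A - P *m B <= kermx K)%MS.
Proof.
rewrite (Fform_odd_part FE) mulf_eq0 negb_or => /andP[_]; rewrite -/S -unitfE -unitmxE => uB.
exists ((A *m S) *m invmx (B *m S)); apply/row_subP => i; apply/(ker_odd_part FE).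
by rewrite -row_mul mulmxBl -(mulmxA _ B) mulmxKV// subrr row0.
Qed.

(** The rows of A together with L span everything and K kills L, so the rows of A K already span Im
    K = L. *)
Lemma basis_image A : Fform w f A != 0 -> (A *m K == kermx K)%MS.
Proof.
move=> /(Fform_basis FE)[/andP[_ sub] _].
have KK := kermx_K FE; rewrite -/K in KK.
have /andP[K1 K2] := KK.
apply/andP; split; first exact: submx_trans (submxMl _ _) K2.
apply: (submx_trans K1).
have /sub_addsmxP[[X Y] /= E1] := submx_trans (submx1 (1%:M : 'M[R]_6)) sub.
have Y0 : Y *m kermx K *m K = 0 by rewrite -mulmxA mulmx_ker mulmx0.
by rewrite -[X in (X <= _)%MS]mul1mx E1 mulmxDl Y0 addr0 -mulmxA submxMl.
Qed.

(* The constant matrix N is a complement of K at a point, hence also nearby;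
   inverting K + N then inverts K on its image. *)
Lemma complement_inverse (N : 'M[R]_6) (x : 'rV[R]_6) :
  (\rank N <= 3)%N -> K + N \in unitmx -> (x <= K)%MS -> x *m invmx (K + N) *m K = x.
Proof.
move=> rN uKN xK.
have cap : (K :&: N)%MS = 0.
  apply/eqP; rewrite -mxrank_eq0.
  have := mxrank_sum_cap K N; rewrite (rank_K FE).
  have : (6 <= \rank (K + N)%MS)%N.
    by rewrite -{1}(mxrank_unit uKN) mxrankS// addmx_sub_adds.
  by lia.
set y := x *m invmx (K + N).
have yE : y *m K + y *m N = x by rewrite -mulmxDr mulmxKV.
have : (y *m N <= K :&: N)%MS.
  rewrite sub_capmx submxMl andbT.
  have -> : y *m N = x + (-1) *: (y *m K) by rewrite -yE scaleN1r addrAC subrr add0r.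
  by rewrite addmx_sub// scalemx_sub// submxMl.
by rewrite cap submx0 => /eqP yN; move: yE; rewrite yN addr0.
Qed.

Lemma frame_S_rank : (\rank (frame_S E) <= 3)%N.
Proof.
have : (frame_S E <= kermx (frame_S E))%MS by apply/sub_kermxP; exact: frame_S_sq.
by move=> /mxrankS; rewrite mxrank_ker; have := rank_leq_row (frame_S E); lia.
Qed.

End PointwiseMetric.

(** * Fields on the manifold *)

Section ChartData.
Context {R : realType} {M : manifold R 6}.
Variables (omega : M -> kform R 6 2) (phi : M -> kform R 6 3).
Hypothesis omega_form : differential_form omega.
Hypothesis phi_form : differential_form phi.
Hypothesis harmonic : F_harmonic omega phi.
Hypothesis orbit : forall p, orbit_O0plus (omega p) (phi p).
Let frames p := orbit_frame_ex (orbit p).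
Let K := Kfield omega phi.

(** Regularity is local. This is needed when the formula for a map changes from point to point, as
    for the metric of L. *)
Lemma Ck_local n (V : normedModType R) k (U : set 'rV[R]_n) (g : 'rV[R]_n -> V) :
  (forall x, U x -> exists W, [/\ open W, W x & Ck k W g]) -> Ck k U g.
Proof.
elim: k g => [|k IH] g h.
  by split=> // x /h[W [_ Wx cg]]; exact: Ck_continuous cg Wx.
split=> [x /h[W [_ Wx cg]]|j]; first exact: Ck_continuous cg Wx.
split=> [x /h[W [_ Wx [_ /(_ j)[dg _]]]]|]; first exact: dg.
by apply: IH => x /h[W [oW Wx [_ /(_ j)[_ cg]]]]; exists W.
Qed.

Lemma open_chart_preimage i (W : set 'rV[R]_6) : open W ->
  open [set p | dom M i p /\ W (chart M i p)].
Proof.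
move=> oW; rewrite openE => p [dp Wp]; rewrite /interior.
apply: filterI; first by apply: open_nbhs_nbhs; split=> //; exact: dom_open.
by apply: (chart_continuous dp); apply: open_nbhs_nbhs.
Qed.

Lemma chart_frame i x : (chart M i @` dom M i) x ->
  exists E, orbit_frame (form_in_chart i omega x) (form_in_chart i phi x) E.
Proof.
move=> [p di <-]; rewrite /form_in_chart (chartK di).
have [E FE] := frames p.
exists (coord_change i (chart_at M p) p *m E).
exact: (orbit_frame_change (coord_change_unit di (dom_chart_at p)) FE).
Qed.

Lemma chart_K i x : (chart M i @` dom M i) x ->
  endo_in_chart i K x = Kmap (form_in_chart i omega x) (form_in_chart i phi x).
Proof.
move=> [p di <-]; rewrite /form_in_chart /endo_in_chart (chartK di).
have [E FE] := frames p.
have dc := dom_chart_at p.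
by rewrite (Kmap_change (coord_change_unit di dc) FE) (coord_change_inv di dc).
Qed.

(** By [Kmap_change] the coordinate change C conjugates K, and the inverse of C at the end of the
    conjugate cancels against the C inserted in phi. *)
Lemma chart_F i x : (chart M i @` dom M i) x ->
  form_in_chart i (Ffield omega phi) x = Fform (form_in_chart i omega x) (form_in_chart i phi x).
Proof.
move=> [p di <-]; rewrite /form_in_chart (chartK di).
have [E FE] := frames p.
have uC := coord_change_unit di (dom_chart_at p).
move: (coord_change i _ p) uC => C uC.
apply/funext => A; rewrite /Ffield /Fform /=; congr (_ * phi p _).
have mc (u : 'M[R]_(1, 6)) (v : 'M[R]_(2, 6)) :
    (col_mx u v : 'M[R]_(3, 6)) *m C = col_mx (u *m C) (v *m C).
  exact: (@mul_col_mx R 1 2 6 6 u v C).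
rewrite (Kmap_change uC FE) mc !mulmxA mulmxKV//.
pose A1 : 'M[R]_(1 + 2, 6) := A.
have -> : usubmx (A1 *m C) = usubmx A1 *m C by rewrite -[in LHS](vsubmxK A1) mul_col_mx col_mxKu.
have -> : dsubmx (A1 *m C) = dsubmx A1 *m C by rewrite -[in LHS](vsubmxK A1) mul_col_mx col_mxKd.
by [].
Qed.

Lemma ext_deriv_near (O : set 'rV[R]_6) (a b : 'rV[R]_6 -> kform R 6 3) x : open O -> O x ->
  (forall y, O y -> a y = b y) -> ext_deriv a x = ext_deriv b x.
Proof.
move=> oO Ox ab; apply/funext => A; apply: eq_bigr => i _; congr (_ * _).
by apply: near_derive; apply: (open_near_eq oO Ox) => y Oy; rewrite ab.
Qed.

Lemma chart_F_closed i x : (chart M i @` dom M i) x ->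
  ext_deriv (fun x => Fform (form_in_chart i omega x) (form_in_chart i phi x)) x = fun=> 0.
Proof.
move=> Ox; rewrite -(harmonic.2 i x Ox); apply/esym.
by apply: (ext_deriv_near (@chart_image_open _ _ M i) Ox) => y Oy; exact: chart_F.
Qed.

Lemma smooth_K : smooth_endo K.
Proof.
move=> i k; have oO := @chart_image_open _ _ M i.
apply: (Ck_eq oO _ (smooth_Kmap oO (omega_form.2 i) (phi_form.2 i) (@chart_frame i) k)).
by move=> x Ox; rewrite chart_K.
Qed.

Lemma foliation_K : foliation 3 (fun p => kermx (K p)).
Proof.
move=> p; pose i := chart_at M p.
have oO := @chart_image_open _ _ M i.
have Op : (chart M i @` dom M i) (chart M i p) by exists p => //; exact: dom_chart_at.
have [W [g [oW Wp WO sg gP]]] := chart_foliation oO Op (omega_form.2 i) (phi_form.2 i)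
  (@chart_frame i) (@chart_F_closed i).
pose U := [set q | dom M i q /\ W (chart M i q)].
have oU : open U by exact: open_chart_preimage.
have Ui : U `<=` dom M i by move=> q [].
exists U, (g \o chart M i); split=> //.
- by split=> //; exact: dom_chart_at.
- move=> j; have sg1 : smooth_on (chart M i @` (dom M i `&` U)) g.
    by move=> k; apply: Ck_sub (sg k) => _ [q [_ [_ Wq]] <-].
  exact: smooth_chart_change oU Ui sg1.
move=> q [diq Wq]; have [rJ /andP[k1 k2]] := gP _ Wq.
pose c := chart_at M q; have dcq : dom M c q := dom_chart_at q.
(* [differential_at] works in the preferred chart of q, which need not be the chart i chosen for p;
   the chain rule relates the two. *)
have -> : differential_at (g \o chart M i) q = coord_change c i q *m 'J g (chart M i q).
  have Oc := @open_chart_image _ _ _ c U oU.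
  have Xq : (chart M c @` (dom M c `&` U)) (chart M c q) by exists q => //; split.
  have E1 : (chart M i \o chart_inv M c) (chart M c q) = chart M i q by rewrite /= chartK.
  have Wq' : W ((chart M i \o chart_inv M c) (chart M c q)) by rewrite E1.
  have sub : chart M c @` (dom M c `&` U) `<=` chart M c @` (dom M c `&` dom M i).
    by move=> _ [r [dr [dir _]] <-]; exists r.
  have := jacobian_comp Oc oW Xq Wq' (smooth_C1 sg)
    (Ck_sub sub (smooth_C1 (@transition_smooth _ _ M c i))).
  by rewrite E1.
have uC := coord_change_unit dcq diq.
have Oq : (chart M i @` dom M i) (chart M i q) by exists q.
have KE := chart_K Oq.
have {}KE : Kmap (form_in_chart i omega (chart M i q)) (form_in_chart i phi (chart M i q)) =
    invmx (coord_change c i q) *m K q *m coord_change c i q.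
  by rewrite -KE /endo_in_chart (chartK diq) (coord_change_inv dcq diq).
rewrite {}KE in k1 k2; move: (coord_change c i q) uC k1 k2 => C uC k1 k2.
move: ('J g (chart M i q)) rJ k1 k2 => J rJ k1 k2.
split.
  have CJ : (C *m J :=: J)%MS by apply: eqmxMfull; rewrite row_full_unit.
  by rewrite /row_full CJ.
apply/andP; split; apply/row_subP => r.
  set u := row r _; apply/sub_kermxP.
  have uJ : u *m C *m J = 0 by rewrite -mulmxA; apply/sub_kermxP; exact: row_sub.
  have /sub_kermxP : (u *m C <= kermx (invmx C *m K q *m C))%MS.
    by apply: submx_trans k1; apply/sub_kermxP.
  rewrite !mulmxA mulmxK// => h.
  by rewrite -[LHS](mulmxK uC) h mul0mx.
set u := row r _.
have uK : u *m K q = 0 by apply/sub_kermxP; exact: row_sub.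
apply/sub_kermxP; rewrite mulmxA; apply/sub_kermxP; apply: submx_trans k2; apply/sub_kermxP.
by rewrite !mulmxA mulmxK// uK mul0mx.
Qed.

(** The derivatives of X and Y cancel, two of the terms because K^2 = 0. What is left is the
    expression of [nijenhuis] at the values of X and Y in the preferred chart of p. *)
Lemma nijenhuis_field (X Y : M -> 'rV[R]_6) : smooth_field X -> smooth_field Y ->
  forall p, bracket (apply_endo K X) Y p *m K p + bracket X (apply_endo K Y) p *m K p
    - bracket (apply_endo K X) (apply_endo K Y) p = 0.
Proof.
move=> sX sY p; pose i := chart_at M p; pose x := chart M i p.
have di : dom M i p := dom_chart_at p.
have oO := @chart_image_open _ _ M i; set O := chart M i @` _ in oO.
have Ox : O x by exists p.
pose Xi := field_in_chart i X; pose Yi := field_in_chart i Y; pose Ki := endo_in_chart i K.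
have S1 Z : smooth_field Z -> Ck 1 O (field_in_chart i Z).
  by move=> /(_ i 1%N); rewrite setIT.
have DX v := C1_is_derive_mx v oO Ox (S1 X sX); have DY v := C1_is_derive_mx v oO Ox (S1 Y sY).
have DK v := C1_is_derive_mx v oO Ox (smooth_C1 (smooth_K i)).
have dX v : is_derive x v Xi ('D_v Xi x) by apply: derivableP; have [] := DX v.
have dY v : is_derive x v Yi ('D_v Yi x) by apply: derivableP; have [] := DY v.
have dK v : is_derive x v Ki ('D_v Ki x) by apply: derivableP; have [] := DK v.
have eK Z : forall y, O y -> field_in_chart i Z y *m Ki y = field_in_chart i (apply_endo K Z) y.
  by move=> y Oy; apply/esym/endo_in_chart_apply.
have dKX v : 'D_v (field_in_chart i (apply_endo K X)) x = 'D_v Xi x *m Ki x + Xi x *m 'D_v Ki x.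
  by have [_ <-] := is_derive_mulmx (dX v) (dK v); apply/esym/near_derive; exact: (open_near_eq oO Ox (eK X)).
have dKY v : 'D_v (field_in_chart i (apply_endo K Y)) x = 'D_v Yi x *m Ki x + Yi x *m 'D_v Ki x.
  by have [_ <-] := is_derive_mulmx (dY v) (dK v); apply/esym/near_derive; exact: (open_near_eq oO Ox (eK Y)).
have Kp : Ki x = K p.
  by rewrite /Ki /endo_in_chart /x (chartK di) coord_change_id// mul1mx mulmx1.
have [E FE] := chart_frame Ox.
have KK : Ki x *m Ki x = 0 by rewrite /Ki chart_K//; exact: Kmap_sq FE.
have := nijenhuis oO (omega_form.2 i) (phi_form.2 i) (@chart_frame i) (harmonic.1 i) (@chart_F_closed i) (Xi x) (Yi x) Ox.
have eD v : 'D_v (fun x => Kmap (form_in_chart i omega x) (form_in_chart i phi x)) x = 'D_v Ki x.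
  by apply: near_derive; apply: (open_near_eq oO Ox) => y Oy; rewrite /Ki chart_K.
rewrite !eD -(chart_K Ox) -/Ki => N.
rewrite /bracket -/i -/x -(eK X x Ox) -(eK Y x Ox) -/Xi -/Yi !dKX !dKY -Kp.
have linX : forall u v, 'D_(u + v) Xi x = 'D_u Xi x + 'D_v Xi x.
  move=> u v; have [_ ->] := DX (u + v); have [_ ->] := DX u; have [_ ->] := DX v.
  by rewrite -big_split; apply: eq_bigr => j _; rewrite mxE scalerDl.
move: N KK; move: ('D_(Yi x *m Ki x) Ki x) ('D_(Xi x *m Ki x) Ki x) ('D_(Xi x) Ki x) ('D_(Yi x) Ki x).
move: ('D_(Xi x *m Ki x) Yi x) ('D_(Yi x) Xi x) ('D_(Xi x) Yi x) ('D_(Yi x *m Ki x) Xi x).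
move: (Xi x) (Yi x) (Ki x) => u t k a b c d A B C D N KK.
rewrite !mulmxBl !mulmxDl -!(mulmxA _ k k) KK !mulmx0 !add0r -[RHS]N.
by apply/rowP => j; rewrite !mxE; ring.
Qed.

End ChartData.

(** * Metric and orientation of TM/L *)

Section MetricAndOrientation.
Context {R : realType} {M : manifold R 6}.
Variables (omega : M -> kform R 6 2) (phi : M -> kform R 6 3).
Hypothesis omega_form : differential_form omega.
Hypothesis phi_form : differential_form phi.
Hypothesis orbit : forall p, orbit_O0plus (omega p) (phi p).
Let frames p := orbit_frame_ex (orbit p).
Let K := Kfield omega phi.
Let L p : 'M[R]_6 := kermx (K p).
Let F := Ffield omega phi.
Let q p (u v : 'rV[R]_6) : R := eval2 (omega p) u (v *m K p).

Lemma field_in_chart_push i (X : M -> 'rV[R]_6) p : dom M i p ->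
  field_in_chart i X (chart M i p) *m coord_change i (chart_at M p) p = X p.
Proof.
move=> di; have dc := dom_chart_at p.
rewrite /field_in_chart (chartK di) (coord_change_inv di dc).
exact: mulmxKV (coord_change_unit di dc) (X p).
Qed.

Lemma eval2_in_chart i p u v : dom M i p ->
  eval2 (form_in_chart i omega (chart M i p)) u v =
  eval2 (omega p) (u *m coord_change i (chart_at M p) p) (v *m coord_change i (chart_at M p) p).
Proof.
move=> di; rewrite /form_in_chart /eval2 (chartK di); congr (omega p _).
exact: (@mul_col_mx R 1 1 6 6 u v _).
Qed.

Lemma smooth_eval2 i k V (u v : 'rV[R]_6 -> 'rV[R]_6) : open V -> V `<=` chart M i @` dom M i ->
  Ck k V u -> Ck k V v -> Ck (V := R^o) k V (fun x => eval2 (form_in_chart i omega x) (u x) (v x)).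
Proof.
move=> oV VO cu cv; have [cu' cv'] := (proj1 (Ck_mx k u oV) cu, proj1 (Ck_mx k v oV) cv).
have S : Ck (V := R^o) k V (fun x => \sum_a \sum_b
    u x 0 a * v x 0 b * eval2 (form_in_chart i omega x) (delta_mx 0 a) (delta_mx 0 b)).
  apply: (Ck_sum _ oV) => a _; apply: (Ck_sum _ oV) => b _.
  apply: (CkM oV (CkM oV (cu' 0 a) (cv' 0 b))).
  exact: Ck_sub VO (omega_form.2 i _ k).
apply: (Ck_eq oV _ S) => x /VO Ox; have [E FE] := chart_frame orbit Ox.
by rewrite [RHS](eval2_mx FE).
Qed.

Lemma smooth_apply_endo (A : M -> 'M[R]_6) U X : smooth_endo A -> open U ->
  smooth_field_on U X -> smooth_field_on U (apply_endo A X).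
Proof.
move=> sA oU sX i k; have oV := @open_chart_image _ _ _ i U oU.
have sub := @chart_image_sub _ _ M i U.
apply: (Ck_eq oV _ (CkMmx oV (sX i k) (Ck_sub sub (sA i k)))) => x /sub Ox.
by rewrite endo_in_chart_apply.
Qed.

Lemma metric_q : metric_on (fun=> 1%:M) L q.
Proof.
split.
- move=> p c u u' v _ _ _; have [E FE] := frames p; exact: q_linear FE c u u' v.
- move=> p u v _ _; have [E FE] := frames p; exact: q_sym FE u v.
- move=> p u v /sub_kermxP uK _; have [E FE] := frames p; exact: q_ker FE u v uK.
- move=> p u _ uL; have [E FE] := frames p.
  by apply: (q_gt0 FE); apply: contraNneq uL => uK; apply/sub_kermxP.
move=> U X Y oU sX sY _ i k; have oV := @open_chart_image _ _ _ i U oU.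
have sKY := smooth_apply_endo (smooth_K omega_form phi_form orbit) oU sY.
have sub := @chart_image_sub _ _ M i U.
apply: (Ck_eq oV _ (smooth_eval2 oV sub (sX i k) (sKY i k))).
by move=> _ [p [di _] <-]; rewrite (eval2_in_chart _ _ di) !(field_in_chart_push _ di) /= (chartK di).
Qed.

(** A matrix on which F is positive at p is kept constant in a chart; by continuity F stays positive
    on it nearby. *)
Lemma local_frame p : exists U (s : M -> 'M[R]_(3, 6)),
  [/\ open U, U p, forall j, smooth_field_on U (fun q => row j (s q)) &
      forall q, U q -> 0 < F q (s q)].
Proof.
pose i := chart_at M p; have di : dom M i p := dom_chart_at p.
have oO := @chart_image_open _ _ M i.
have Op : (chart M i @` dom M i) (chart M i p) by exists p.
have [E FE] := chart_frame orbit Op; have [A FA] := Fform_positive FE.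
pose Fi x := Fform (form_in_chart i omega x) (form_in_chart i phi x) A : R^o.
pose W := [set x | (chart M i @` dom M i) x /\ 0 < Fi x].
have oW : open W.
  rewrite openE => x [Ox Fx]; rewrite /interior; apply: filterI.
    by apply: open_nbhs_nbhs; split.
  have c : {for x, continuous Fi}.
    exact: Ck_continuous (smooth_F oO (omega_form.2 i) (phi_form.2 i) (@chart_frame _ _ _ _ orbit i) A 0%N) Ox.
  exact: (c _ (open_nbhs_nbhs (conj (@open_gt R 0) Fx))).
have oU := @open_chart_preimage _ M i W oW; set U := [set _ | _] in oU.
have Ui : U `<=` dom M i by move=> r [].
exists U, (fun r => A *m coord_change i (chart_at M r) r); split=> //.
- move=> j; have := smooth_chart_field (row j A) oU Ui.
  by congr (smooth_field_on U _); apply/funext => r; rewrite row_mul.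
move=> r [dr [Or Fr]].
have : 0 < form_in_chart i F (chart M i r) A by rewrite (chart_F orbit Or).
by rewrite /form_in_chart (chartK dr).
Qed.

Definition positive_bases p : set 'M[R]_(3, 6) := [set A | 0 < F p A].

Lemma Ffield_det p A B (P : 'M[R]_3) : (A - P *m B <= L p)%MS -> F p A = \det P * F p B.
Proof. by move=> AP; have [E FE] := frames p; rewrite /F /Ffield (Fform_det_sub FE AP). Qed.

Lemma orientation_positive : orientation_on (fun=> 1%:M) L positive_bases.
Proof.
split.
- move=> p A FA; have [E FE] := frames p; apply/(Fform_basis FE).
  exact: lt0r_neq0.
- by move=> p A B P _ FB AB; rewrite /positive_bases /= (Ffield_det AB) pmulr_lgt0.
exact: local_frame.
Qed.

Lemma volume_positive : quotient_volume_form L q positive_bases (fun p A => (Num.sqrt 2)^-1 * F p A).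
Proof.
move=> p; have [E FE] := frames p; split.
- exact: (volume_alternating FE).
- by move=> A i Ai; rewrite /F /Ffield (volume_ker FE Ai) mulr0.
by move=> A FA qA; exact: (orthonormal_volume FE qA FA).
Qed.

(** Two orientations agree at p once they share a basis; here it is shown that F is positive on a
    basis B in [o p]. Take an orthonormal A with F positive. If A = P B modulo L with det P < 0,
    then, the rank 3 being odd, -A belongs to [o p]; it is orthonormal, yet the volume form takes a
    negative value on it instead of 1. *)
Lemma volume_orientation_unique (o : M -> set 'M[R]_(3, 6)) : orientation_on (fun=> 1%:M) L o ->
  quotient_volume_form L q o (fun p A => (Num.sqrt 2)^-1 * F p A) -> positive_bases = o.
Proof.
move=> [ob oP oex] vol; apply/funext => p.
have [E FE] := frames p.
have [U [s [_ Up _ /(_ p Up)]]] := oex p; move: (s p) => B oB.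
have FB0 : F p B != 0 by apply/(Fform_basis FE); exact: ob.
have FB : 0 < F p B.
  have [A qA FA] := Fform_orthonormal FE.
  have [P AP] := basis_coordinates FE A FB0.
  have := FA; rewrite (Fform_det_sub FE AP) => PB.
  have [P0|P0|P0] := ltgtP 0 (\det P); last by move: PB; rewrite -P0 mul0r ltxx.
    by move: PB; rewrite pmulr_rgt0.
  have AN : (- A - (-1)%:M *m A <= kermx (Kmap (omega p) (phi p)))%MS.
    by rewrite mul_scalar_mx scaleN1r opprK addrC subrr sub0mx.
  have NA : (- A - (- P) *m B <= kermx (Kmap (omega p) (phi p)))%MS.
    by rewrite mulNmx -opprD eqmx_opp.
  have F_NA : F p (- A) = - F p A.
    by rewrite (Ffield_det AN) det_scalar -signr_odd mulN1r.
  have oNA : o p (- A).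
    apply/(oP p _ B _ _ oB NA); last first.
      by rewrite -scaleN1r detZ -signr_odd mulN1r oppr_gt0.
    by apply/(Fform_basis FE); rewrite -[Fform _ _ _]/(F p (- A)) F_NA oppr_eq0 lt0r_neq0.
  have q_opp u v : q p (- u) (- v) = q p u v.
    have q0 z : q p 0 z = 0 by apply: (q_ker FE); exact: mul0mx.
    have qN y z : q p (- y) z = - q p y z.
      have : q p (-1 *: y + 0) z = -1 * q p y z + q p 0 z by exact: q_linear FE _ _ _ _.
      by rewrite scaleN1r addr0 q0 addr0 mulN1r.
    have qS y z : q p y z = q p z y by exact: q_sym FE _ _.
    by rewrite qN qS qN opprK qS.
  have [_ _ /(_ _ oNA)] := vol p; rewrite F_NA mulrN => vN.
  suff : - ((Num.sqrt 2)^-1 * F p A) = 1.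
    have : 0 < (Num.sqrt 2)^-1 * F p A by rewrite mulr_gt0// invr_gt0 sqrtr_gt0.
    by move: (_ * _) => c c0 c1; lra.
  by apply: vN => i j; rewrite !linearN /= -[RHS](qA i j); exact: q_opp.
apply/seteqP; split=> A oA.
  have A0 : F p A != 0 by exact: lt0r_neq0.
  have [P AP] := basis_coordinates FE A FB0.
  have Ab : basis_mod 1%:M (L p) A by apply/(Fform_basis FE).
  apply/(oP p A B P Ab oB AP).
  by move: oA; rewrite /positive_bases /= (Ffield_det AP) pmulr_lgt0.
have Ab := ob p A oA.
have [P AP] := basis_coordinates FE A FB0.
have := proj1 (oP p A B P Ab oB AP) oA.
by rewrite /positive_bases /= (Ffield_det AP) pmulr_lgt0.
Qed.

End MetricAndOrientation.

(** * Metric and orientation of L *)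

Section LeafMetric.
Context {R : realType} {M : manifold R 6}.
Variables (omega : M -> kform R 6 2) (phi : M -> kform R 6 3).
Hypothesis omega_form : differential_form omega.
Hypothesis phi_form : differential_form phi.
Hypothesis orbit : forall p, orbit_O0plus (omega p) (phi p).
Let frames p := orbit_frame_ex (orbit p).
Let K := Kfield omega phi.
Let L p : 'M[R]_6 := kermx (K p).
Let q p (u v : 'rV[R]_6) : R := eval2 (omega p) u (v *m K p).

(** The pseudo-inverse picks some preimage under K, without any claim of regularity in p;
    [leaf_metric_preimage] shows that on L the choice does not matter. *)
Definition leaf_metric p (x y : 'rV[R]_6) : R := eval2 (omega p) (x *m pinvmx (K p)) y.

Lemma leaf_preimage p (y : 'rV[R]_6) : (y <= L p)%MS -> exists v, y = v *m K p.
Proof.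
have [E FE] := frames p; have /andP[h _] := kermx_K FE.
by move=> /submx_trans/(_ h)/submxP.
Qed.

(** Two preimages of x differ by a vector of ker K, and y = v K for some v; the pairing of the
    difference with y is a value of q at a vector of its kernel. *)
Lemma leaf_metric_preimage p (x y x' : 'rV[R]_6) : (y <= L p)%MS ->
  x' *m K p = x -> leaf_metric p x y = eval2 (omega p) x' y.
Proof.
move=> /leaf_preimage[v ->] <-; have [E FE] := frames p.
set x1 := x' *m K p *m pinvmx (K p).
have k : (x1 - x') *m K p = 0 by rewrite mulmxBl /x1 mulmxKpV ?submxMl// subrr.
have : q p (1 *: (x1 - x') + x') v = 1 * q p (x1 - x') v + q p x' v by exact: q_linear FE _ _ _ _.
have -> : q p (x1 - x') v = 0 by exact: q_ker FE _ _ k.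
by rewrite scale1r subrK mulr0 add0r.
Qed.

Lemma leaf_metric_K p (u v : 'rV[R]_6) : leaf_metric p (u *m K p) (v *m K p) = q p u v.
Proof.
apply: leaf_metric_preimage => //; apply/sub_kermxP.
by have [E FE] := frames p; rewrite -mulmxA [K p *m _](Kmap_sq FE) mulmx0.
Qed.

Lemma leaf_metric_smooth U X Y : open U -> smooth_field_on U X -> smooth_field_on U Y ->
  (forall p, U p -> (X p <= L p)%MS /\ (Y p <= L p)%MS) ->
  smooth_fun_on (V := R^o) U (fun p => leaf_metric p (X p) (Y p)).
Proof.
move=> oU sX sY XY i k; have oV := @open_chart_image _ _ _ i U oU.
set V := chart M i @` _ in oV *.
have sub : V `<=` _ := @chart_image_sub _ _ M i U.
apply: Ck_local => x Vx; have [E FE] := chart_frame orbit (sub x Vx).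
pose N := frame_S E; pose KN y := endo_in_chart i K y + N.
have sKN j : Ck j V KN.
  have sK := Ck_sub sub (smooth_K omega_form phi_form orbit i j).
  exact: CkD oV sK (Ck_cst j V N).
pose W := [set y | V y /\ \det (KN y) != 0].
have oW : open W := open_unit_det oV (sKN 0%N).
have WV : W `<=` V by move=> y [].
have WO : W `<=` chart M i @` dom M i by move=> y /WV/sub.
exists W; split=> //.
  split=> //; rewrite /KN (chart_K orbit (sub x Vx)) -unitfE -unitmxE.
  exact: Kmap_S_unit FE.
have uKN y : W y -> KN y \in unitmx by move=> [_ d]; rewrite unitmxE unitfE.
have S := CkMmx oW (Ck_sub WV (sX i k)) (Ck_invmx oW uKN (Ck_sub WV (sKN k))).
apply: (Ck_eq oW _ (smooth_eval2 omega_form orbit oW WO S (Ck_sub WV (sY i k)))).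
move=> y Wy; have [p [di Up] yE] := WV y Wy; have dc := dom_chart_at p.
rewrite -yE (eval2_in_chart _ _ _ di) (field_in_chart_push _ di) /= (chartK di).
have [Xp Yp] := XY p Up.
(* The smooth preimage given by the inverse of K + N may replace the pseudo-inverse, provided that K
   maps it back to X p. *)
apply/esym/(leaf_metric_preimage Yp); rewrite yE.
have Xi : (field_in_chart i X y <= endo_in_chart i K y)%MS.
  have [u uE] := leaf_preimage Xp.
  rewrite -yE /field_in_chart /endo_in_chart (chartK di) uE (coord_change_inv dc di).
  have := coord_change_unit dc di; move: (coord_change _ _ _) => C uC.
  by apply/submxP; exists (u *m C); rewrite !mulmxA mulmxK.
have [E' FE'] := chart_frame orbit (WO y Wy).
have inv : field_in_chart i X y *m invmx (KN y) *m endo_in_chart i K y = field_in_chart i X y.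
  have := uKN y Wy; move: Xi; rewrite /KN (chart_K orbit (WO y Wy)) => Xi u.
  exact: (complement_inverse FE' (frame_S_rank FE) u Xi).
have KE : endo_in_chart i K y *m coord_change i (chart_at M p) p = coord_change i (chart_at M p) p *m K p.
  rewrite /endo_in_chart -yE (chartK di) (coord_change_inv di dc).
  exact: mulmxKV (coord_change_unit di dc) _.
have := field_in_chart_push X di; rewrite yE -{1}inv.
move: (coord_change _ _ _) KE => C KE <-.
by rewrite -(mulmxA _ C (K p)) -KE mulmxA.
Qed.

Lemma metric_leaf : metric_on L (fun=> 0) leaf_metric.
Proof.
split; last exact: leaf_metric_smooth.
- move=> p c u u' v _ _ _; have [E FE] := frames p.
  by rewrite /leaf_metric mulmxDl -scalemxAl; exact: eval2_linear FE _ _ _ _.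
- move=> p u v /leaf_preimage[a ->] /leaf_preimage[b ->].
  by have [E FE] := frames p; rewrite !leaf_metric_K; exact: q_sym FE _ _.
- move=> p u v; rewrite submx0 => /eqP -> /leaf_preimage[b ->].
  have [E FE] := frames p; rewrite -(mul0mx 1 (K p)) leaf_metric_K.
  by apply: (q_ker FE); exact: mul0mx.
move=> p u /leaf_preimage[a ->]; rewrite submx0 => aK; rewrite leaf_metric_K.
by have [E FE] := frames p; exact: q_gt0 FE _ aK.
Qed.

(** K carries bases of TM/L to bases of L, and A K = P B K means that the rows of A - P B lie in L,
    so the sign of det P is the same upstairs and in L. The smooth local frames are the images of
    those of [local_frame]. *)
Lemma orientation_leaf : orientation_on L (fun=> 0)
  (fun p => (fun A => A *m K p) @` positive_bases omega phi p).
Proof.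
have bK p A : positive_bases omega phi p A -> (A *m K p == kermx (K p))%MS.
  move=> FA; have [E FE] := frames p; apply: (basis_image FE).
  exact: lt0r_neq0.
split.
- move=> p _ [A FA <-]; have [E FE] := frames p; split.
    by have := bK p A FA; rewrite !addsmx0.
  by rewrite mxrank0 mxrank_ker (rank_K FE : \rank (K p) = 3%N).
- move=> p A B P _ [B0 FB0 <-]; rewrite submx0 subr_eq0 => /eqP ->.
  split=> [[A0 FA0 AE]|P0].
    have AP : (A0 - P *m B0 <= kermx (K p))%MS.
      by apply/sub_kermxP; rewrite mulmxBl AE -mulmxA subrr.
    by move: FA0; rewrite /positive_bases /= (Ffield_det orbit AP) pmulr_lgt0.
  exists (P *m B0); last by rewrite mulmxA.
  have AP : (P *m B0 - P *m B0 <= kermx (K p))%MS by rewrite subrr sub0mx.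
  by rewrite /positive_bases /= (Ffield_det orbit AP) mulr_gt0.
move=> p; have [U [s [oU Up ss sP]]] := local_frame omega_form phi_form orbit p.
exists U, (fun r => s r *m K r); split=> //.
  move=> j; have := smooth_apply_endo (smooth_K omega_form phi_form orbit) oU (ss j).
  by congr (smooth_field_on U _); apply/funext => r; rewrite row_mul.
by move=> r Ur; exists (s r) => //; exact: sP.
Qed.

End LeafMetric.

Theorem proposition4p6 (R : realType) (M : manifold R 6)
    (omega : M -> kform R 6 2) (phi : M -> kform R 6 3)
    (omega_symplectic : symplectic_form omega)
    (phi_form : differential_form phi)
    (phi_primitive : forall p, primitive (omega p) (phi p))
    (phi_harmonic : F_harmonic omega phi)
    (phi_orbit : forall p, orbit_O0plus (omega p) (phi p)) :
  let K := Kfield omega phi in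
  let L := fun p => kermx (K p) in
  let TM := fun _ : M => 1%:M : 'M[R]_6 in
  let zero := fun _ : M => 0 : 'M[R]_6 in
  let q := fun p (u v : 'rV[R]_6) => eval2 (omega p) u (v *m K p) in
  (* (i) *)
  [/\ smooth_endo K,
      forall p, K p *m K p = 0,
      forall p, (kermx (K p) == K p)%MS,
      foliation 3 L &
      forall p, lagrangian (omega p) (L p)] /\
  (* (ii) *)
  (forall X Y : M -> 'rV[R]_6, smooth_field X -> smooth_field Y ->
     forall p, bracket (apply_endo K X) Y p *m K p
             + bracket X (apply_endo K Y) p *m K p
             - bracket (apply_endo K X) (apply_endo K Y) p = 0) /\
  (* (iii) *)
  metric_on TM L q /\
  exists o : M -> set 'M[R]_(3, 6),
    unique (fun o' => orientation_on TM L o' /\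
              quotient_volume_form L q o'
                (fun p A => (Num.sqrt 2)^-1 * Ffield omega phi p A)) o /\
  (* (iv) *)
  exists g : M -> 'rV[R]_6 -> 'rV[R]_6 -> R,
    [/\ metric_on L zero g,
        forall p (u v : 'rV[R]_6), g p (u *m K p) (v *m K p) = q p u v,
        orientation_on L zero (fun p => (fun A => A *m K p) @` o p) &
        forall p (x y x' : 'rV[R]_6), (x <= L p)%MS -> (y <= L p)%MS ->
          x' *m K p = x -> g p x y = eval2 (omega p) x' y].
Proof.
case: omega_symplectic => omega_form _ _ K L TM zero q.
split; first split.
- exact: smooth_K omega_form phi_form phi_orbit.
- by move=> p; have [E FE] := orbit_frame_ex (phi_orbit p); exact: Kmap_sq FE.
- by move=> p; have [E FE] := orbit_frame_ex (phi_orbit p); exact: kermx_K FE.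
- exact: foliation_K omega_form phi_form phi_harmonic phi_orbit.
- by move=> p; have [E FE] := orbit_frame_ex (phi_orbit p); exact: lagrangian_K FE.
split; first exact: nijenhuis_field omega_form phi_form phi_harmonic phi_orbit.
split; first exact: metric_q omega_form phi_form phi_orbit.
exists (positive_bases omega phi); split.
  split; last by move=> o' [oo vo]; apply (volume_orientation_unique phi_orbit oo vo).
  split; first exact: orientation_positive omega_form phi_form phi_orbit.
  exact: volume_positive phi_orbit.
exists (leaf_metric omega phi); split.
- exact: metric_leaf omega_form phi_form phi_orbit.
- exact: leaf_metric_K phi_orbit.
- exact: orientation_leaf omega_form phi_form phi_orbit.
by move=> p x y x' _ yL; exact: leaf_metric_preimage phi_orbit _ _ _ _ yL.
Qed.
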